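(* Let $F_3$ be a truly three-dimensional probability distribution on $\mathbb{Z}^3$ with mean zero and finite variance under which the three coordinates are independent, let $(a_n)_{n\ge 1}$ be a strictly increasing sequence of positive integers, and let $\{S_k\}$ be the $\mathbb{Z}^2$ in $\mathbb{Z}^3$ random walk in varying dimension determined by $F_3$ and $(a_n)$. Put $$\phi(n)=\frac{\log(a_{n+1}/a_n)}{\log a_{n+1}},\qquad n\ge 1 .$$ (i) If $\sum_{n} n^{-1/2}\phi(n)<\infty$, then $\{S_k\}$ is transient. (ii) If $\sum_{n} n^{-1/2}\phi(n)=\infty$ and the sequence $\{\phi(n)\}$ is nonincreasing, then $\{S_k\}$ is recurrent.
   Context: A distribution on $\mathbb{Z}^D$ is truly $D$-dimensional if it is not supported on any proper linear subspace of $\mathbb{R}^D$. For $d<D$, the $\mathbb{Z}^d$ in $\mathbb{Z}^D$ random walk in varying dimension determined by a distribution $F_D$ on $\mathbb{Z}^D$ and an increasing sequence $(a_n)_{n\ge1}$ is the process $\{S_k\}_{k\ge 0}$ in $\mathbb{Z}^D$ with $S_0=0$ and independent increments $S_k-S_{k-1}$ ($k\ge1$), where $S_k-S_{k-1}$ has distribution $F_D$ if $k\in\{a_n:n\ge1\}$, and has distribution $F_d$ otherwise; here $F_d$ is the projection of $F_D$ to the first $d$ coordinates (the remaining $D-d$ coordinates of the increment being $0$). The process is recurrent if almost surely $S_k=0$ for infinitely many $k$, and transient if almost surely $S_k=0$ for only finitely many $k$. *)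

(* Defs.v *)
From HB Require Import structures.
From mathcomp Require Import all_boot all_order all_algebra.
From mathcomp Require Import finmap.
From mathcomp Require Import all_classical all_reals all_analysis.

Set Implicit Arguments.
Unset Strict Implicit.
Unset Printing Implicit Defensive.
Import Order.TTheory GRing.Theory Num.Theory.

Local Open Scope classical_set_scope.
Local Open Scope ring_scope.

(* Discrete sigma-algebras on Z and Z^D: every subset is measurable, so a
   [probability (lattice D) R] is exactly a distribution on Z^D. *)
HB.instance Definition _ := isPointed.Build int 0.

HB.instance Definition _ := @isMeasurable.Build default_measure_display
  int (@discrete_measurable int) (@discrete_measurable0 int)
  (@discrete_measurableC int) (@discrete_measurableU int).

Definition lattice (D : nat) : Type := 'rV[int]_D.

HB.instance Definition _ (D : nat) := GRing.Zmodule.on (lattice D).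

HB.instance Definition _ (D : nat) := isPointed.Build (lattice D) 0.

HB.instance Definition _ (D : nat) :=
  @isMeasurable.Build default_measure_display (lattice D)
  (@discrete_measurable (lattice D)) (@discrete_measurable0 (lattice D))
  (@discrete_measurableC (lattice D)) (@discrete_measurableU (lattice D)).

Definition entry (D : nat) (i : 'I_D) (x : lattice D) : int := x ord0 i.

Definition entryR (R : realType) (D : nat) (i : 'I_D) (x : lattice D) : R :=
  (entry i x)%:~R.

Definition first_coords (D d : nat) (x : lattice D) : lattice D :=
  \row_(i < D) if (i < d)%N then entry i x else 0.

Definition mutually_independent (dT dU : measure_display)
    (T : measurableType dT) (U : measurableType dU) (R : realType)
    (P : probability T R) (I : choiceType) (X : I -> T -> U) : Prop :=
  forall (J : {fset I}) (A : I -> set U),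
    (forall i, measurable (A i)) ->
    P [set w | forall i, i \in J -> A i (X i w)] =
    (\prod_(i <- J) P (X i @^-1` A i))%E.

(* As Z^D is countable, F is supported on V iff V has F-mass 1. *)
Definition truly_dimensional (R : realType) (D : nat)
    (F : probability (lattice D) R) : Prop :=
  forall V : {vspace 'rV[R]_D}, V != fullv ->
    F [set x | map_mx (intr : int -> R) x \in V] != 1%E.

Definition mean_zero (R : realType) (D : nat)
    (F : probability (lattice D) R) : Prop :=
  forall i : 'I_D, 'E_F[entryR R i]%E = 0%E.

(* If a coordinate is not square-integrable, then [variance], the integral of
   a nonnegative function, is +oo, whatever junk its centering constant is. *)
Definition finite_variance (R : realType) (D : nat)
    (F : probability (lattice D) R) : Prop :=
  forall i : 'I_D, ('V_F[entryR R i] < +oo)%E.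

Definition independent_coordinates (R : realType) (D : nat)
    (F : probability (lattice D) R) : Prop :=
  mutually_independent F (@entry D).

(* [increment S k] is S_(k+1) - S_k, so that k ranges over all of nat. *)
Definition increment (T : Type) (D : nat) (S : nat -> T -> lattice D)
    (k : nat) (w : T) : lattice D := S k.+1 w - S k w.

(* The sequence (a_n) is indexed from 1; the value a 0 is never used. *)
Record walk_in_varying_dimension (dT : measure_display)
    (T : measurableType dT) (R : realType) (P : probability T R) (D d : nat)
    (F : probability (lattice D) R) (a : nat -> nat)
    (S : nat -> {RV P >-> lattice D}) : Prop := {
  walk_start : forall w, S 0%N w = 0;
  walk_independent : mutually_independent P (increment S);
  walk_special_law : forall k, (exists2 n, (0 < n)%N & a n = k.+1) ->
    forall A, P (increment S k @^-1` A) = F A;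
  walk_regular_law : forall k, ~ (exists2 n, (0 < n)%N & a n = k.+1) ->
    forall A, P (increment S k @^-1` A) = F (first_coords d @^-1` A)
}.

Definition recurrent (dT : measure_display) (T : measurableType dT)
    (R : realType) (P : probability T R) (D : nat)
    (S : nat -> {RV P >-> lattice D}) : Prop :=
  \forall w \ae P, infinite_set [set k | S k w = 0].

Definition transient (dT : measure_display) (T : measurableType dT)
    (R : realType) (P : probability T R) (D : nat)
    (S : nat -> {RV P >-> lattice D}) : Prop :=
  \forall w \ae P, finite_set [set k | S k w = 0].

Definition phi (R : realType) (a : nat -> nat) (n : nat) : R :=
  ln ((a n.+1)%:R / (a n)%:R) / ln (a n.+1)%:R.

(* Main.v *)
Require Import Defs.
From HB Require Import structures.
From mathcomp Require Import all_boot all_order all_algebra.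
From mathcomp Require Import finmap.
From mathcomp Require Import all_classical all_reals all_analysis.
From mathcomp Require Import measurable_realfun.
From mathcomp Require Import zify ring lra.

(** The three coordinates of the walk are independent walks on the integers: at
    time [k] the first two have made [k] steps, and the third one [n] steps,
    where [n] is the number of special times up to [k], so [n = specials a k]
    and [a_n <= k < a_(n+1)].  The proof needs two local bounds for a
    nondegenerate centred walk on the integers with finite variance: it is at a
    given point at time [k] with probability at most [C * k ^ (- 1 / 2)]
    ([hit_upper]), and at zero with probability at least [c * k ^ (- 1 / 2)] at
    the large times [k] of one residue class modulo some [q], with [c] not
    depending on the starting point ([hit_lower]).  Both come from splitting off
    a fair coin between two atoms of the step law.  Given the other steps and
    the number of coins, the position is a binomial variable, for which both
    bounds are estimates of binomial coefficients, and the number of coins is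
    itself binomial, hence of order [k] up to a Chebyshev error.  The event
    [S k = 0] thus has probability at most of order [1 / (k * sqrt n)], and at
    least that order at suitable times.

    Transience.  Let [H_n] be the event that there is a visit to zero in the
    block [a_n <= k < a_(n+1)], of length [g].  In the block only the plane walk
    moves, so after a visit the plane walk spends at zero during the next [g]
    steps an expected time [G(g) >= c * ln (g + 1)], whereas the expected time
    spent there in the window [a_n <= k < a_(n+1) + g], on the event that the
    height is zero at time [a_n], is at most of order
    [ln (a_(n+1) / a_n) / sqrt n].  Hence so is [P(H_n) * G(g)] ([visit_le],
    [block_visit_green]).  If [g ^ 4 >= a_(n+1)], then [G(g)] is at least of
    order [ln a_(n+1)] and [P(H_n)] at most of order [n ^ (- 1 / 2) * phi n]; if
    not, [P(H_n)] is at most of order [n ^ (- 5 / 4)].  The Borel-Cantelli lemma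
    concludes.

    Recurrence.  Give a visit in the [n]-th block the weight [1 / ln a_(n+1)],
    so that the expected weight of the [n]-th block is of the order of
    [n ^ (- 1 / 2) * phi n], and let [Phi N] be the sum of these numbers up to
    [N].  From any starting point the expected weight of the visits up to block
    [N] is at least [al * Phi N - be], with [al] not depending on the starting
    point ([weight_from]); after a visit, as [phi] is nonincreasing, the expected
    weight of the visits from then on is at most [C * (1 + Phi N)]
    ([weight_after]).  Decomposing at the first visit ([visit_ge]) and letting
    [N] tend to infinity, the walk visits zero again with probability at least
    [al / (2 * C)], whatever its past ([visit_after_ge]).  So, if [u] is the
    probability that there is no visit after time [M], and [u_m] that there is
    none between [M] and [m], then [u] is at most [(1 - al / (2 * C)) * u_m], and
    [u_m] tends to [u] as [m] grows; therefore [u = 0] ([no_more_visit_null]). *)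

Set Implicit Arguments.
Unset Strict Implicit.
Unset Printing Implicit Defensive.
Import Order.TTheory GRing.Theory Num.Theory.

Local Open Scope classical_set_scope.
Local Open Scope ring_scope.

(** * Countable sums and nonnegative integrals *)

Section esum_tools.
Context {R : realType}.
Local Open Scope ereal_scope.

Lemma esum_ge_term (I : choiceType) (D : set I) (f : I -> \bar R) (i : I) :
  D i -> 0 <= f i -> f i <= \esum_(j in D) f j.
Proof.
move=> Di fi; rewrite esum_ge//; exists [set i].
  by split; [exact: finite_set1|move=> j ->].
by rewrite fsbig_set1.
Qed.

Lemma ge0_esumZl (I : choiceType) (D : set I) (f : I -> \bar R) (c : \bar R) :
  0 <= c -> (forall i, D i -> 0 <= f i) ->
  \esum_(i in D) (c * f i) = c * \esum_(i in D) f i.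
Proof.
move=> c0 f0; case: c c0 => [c|_|//].
  rewrite lee_fin => c0; rewrite /esum -ereal_supZl//; last first.
    by apply/set0P; exists 0; exists set0; rewrite ?fsbig_set0//; exact: fsets_set0.
  congr ereal_sup; apply/seteqP; split => x /=.
    move=> [X [finX XD] <-]; exists (\sum_(i \in X) f i); first by exists X.
    by rewrite !fsbig_finite//= big_seq ge0_sume_distrr -?big_seq// => i;
      rewrite in_fset_set// inE => /XD/f0.
  move=> [_ [X [finX XD] <-] <-]; exists X => //.
  by rewrite !fsbig_finite//= big_seq -ge0_sume_distrr -?big_seq// => i;
    rewrite in_fset_set// inE => /XD/f0.
have [[i Di fi]|/forall2NP h] := pselect (exists2 i, D i & 0 < f i).
  have fD : 0 < \esum_(j in D) f j.
    by rewrite (lt_le_trans fi)// esum_ge_term// ltW.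
  rewrite [RHS]gt0_mulye//; apply/eqP; rewrite -leye_eq.
  apply: (@le_trans _ _ (+oo * f i)); first by rewrite gt0_mulye.
  apply: (@esum_ge_term _ D (fun i => +oo * f i) i Di).
  by rewrite mule_ge0// f0.
have fE i : D i -> f i = 0.
  move=> Di; apply/eqP; rewrite eq_le f0// andbT leNgt; apply/negP.
  by have [|] := h i.
rewrite !esum1 ?mule0// => i Di; by rewrite fE// mule0.
Qed.

Lemma ge0_esumZr (I : choiceType) (D : set I) (f : I -> \bar R) (c : \bar R) :
  0 <= c -> (forall i, D i -> 0 <= f i) ->
  \esum_(i in D) (f i * c) = (\esum_(i in D) f i) * c.
Proof.
move=> c0 f0; rewrite muleC -ge0_esumZl//.
by apply: eq_esum => i _; rewrite muleC.
Qed.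

Lemma exchange_esum (I J : choiceType) (f : I -> J -> \bar R) :
  (forall i j, 0 <= f i j) ->
  \esum_(i in setT) \esum_(j in setT) f i j =
  \esum_(j in setT) \esum_(i in setT) f i j.
Proof.
move=> f0; rewrite !esum_esum//.
rewrite (reindex_esum ([set: J] `*`` fun=> [set: I]) _ (fun x => (x.2, x.1)))//.
split => //=.
  by move=> [i j] [i' j'] _ _ /= [-> ->].
by move=> [i j] _; exists (j, i).
Qed.

Lemma esum_pair (I J : choiceType) (f : I -> J -> \bar R) :
  (forall i j, 0 <= f i j) ->
  \esum_(i in setT) \esum_(j in setT) f i j = \esum_(k in setT) f k.1 k.2.
Proof.
move=> f0; rewrite esum_esum//; congr esum.
by apply/seteqP; split => // -[].
Qed.

Lemma esum_bij (I J : choiceType) (e : I -> J) (f : J -> \bar R) :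
  bijective e -> \esum_(i in setT) f (e i) = \esum_(j in setT) f j.
Proof.
move=> [g eK gK]; rewrite (reindex_esum setT setT e)//; split => //.
  by move=> x y _ _ /(can_inj eK).
by move=> y _; exists (g y).
Qed.

Lemma esum_single (I : choiceType) (f : I -> \bar R) (i : I) :
  0 <= f i -> (forall j, j != i -> f j = 0) -> \esum_(j in setT) f j = f i.
Proof.
move=> f0 fE; rewrite -(@esum_set1 _ _ i f)// [RHS]esum_mkcond.
apply: eq_esum => j _; case: ifPn => //; rewrite notin_setE/= => ji.
by apply: fE; apply/eqP.
Qed.

End esum_tools.

Section fibers.
Context d (T : measurableType d) (R : realType) (mu : {measure set T -> \bar R}).
Context (C : countType) (X : T -> C).
Hypothesis mX : forall c, measurable (X @^-1` [set c]).
Local Open Scope ereal_scope.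

Lemma measurable_discrete (A : set C) : measurable (X @^-1` A).
Proof.
have -> : X @^-1` A = \bigcup_(c in A) (X @^-1` [set c]).
  by apply/seteqP; split => [w Aw|w [c Ac /= ->]//]; exists (X w).
rewrite bigcup_mkcond; apply: countable_bigcupT_measurable => // c.
by case: ifP.
Qed.

Lemma ge0_integral_fibers (D : set T) (f : T -> \bar R) :
  measurable D -> measurable_fun D f -> (forall w, D w -> 0 <= f w) ->
  \int[mu]_(w in D) f w =
  \esum_(c in setT) \int[mu]_(w in D `&` X @^-1` [set c]) f w.
Proof.
move=> mD mf f0.
pose F n := D `&` (choice.pickle \o X) @^-1` [set n].
have DE : D = \bigcup_n F n.
  by apply/seteqP; split => [w Dw|w [n _ [//]]]; exists (choice.pickle (X w)).
have mF n : measurable (F n).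
  by apply: measurableI => //; rewrite comp_preimage; exact: measurable_discrete.
rewrite {1}DE ge0_integral_bigcup//; last 3 first.
- by rewrite -DE.
- by move=> w; rewrite -DE; exact: f0.
- apply/trivIsetP => i j _ _ /eqP ij; apply/seteqP; split => // w.
  by move=> [[_ /= wi] [_ /= wj]]; apply: ij; rewrite -wi -wj.
rewrite nneseries_esumT; last first.
  by move=> n; apply: integral_ge0 => w [Dw _]; exact: f0.
transitivity (\esum_(n in choice.pickle @` [set: C]) \int[mu]_(w in F n) f w).
  rewrite [RHS]esum_mkcond; apply: eq_esum => n _; case: ifPn => //.
  rewrite notin_setE/= => nC; rewrite (_ : F n = set0) ?integral_set0//.
  by apply/seteqP; split => // w [_ /= wn]; apply: nC; exists (X w).
rewrite esum_image; last by move=> x y _ _; exact: (pcan_inj choice.pickleK).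
apply: eq_esum => c _; congr integral; rewrite /F; congr setI.
by apply/seteqP; split => w /= => [/(pcan_inj choice.pickleK)//|/(congr1 choice.pickle)].
Qed.

Lemma measure_fibers (D : set T) : measurable D ->
  mu D = \esum_(c in setT) mu (D `&` X @^-1` [set c]).
Proof.
move=> mD; rewrite -[LHS]mul1e -integral_cst// ge0_integral_fibers//.
apply: eq_esum => c _; rewrite integral_cst ?mul1e//.
exact: measurableI.
Qed.

Lemma ge0_integral_law (f : C -> \bar R) : (forall c, 0 <= f c) ->
  \int[mu]_w f (X w) = \esum_(c in setT) mu (X @^-1` [set c]) * f c.
Proof.
move=> f0; have mf : measurable_fun setT (f \o X).
  by move=> _ Y mY; rewrite setTI comp_preimage; exact: measurable_discrete.
have /= -> := ge0_integral_fibers measurableT mf (fun w _ => f0 (X w)).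
apply: eq_esum => c _; rewrite setTI (eq_integral (cst (f c))); last by move=> w; rewrite inE /= => ->.
by rewrite integral_cst// muleC.
Qed.

End fibers.
(** * Central binomial coefficients *)

Section binomials.

Lemma bin_central_odd m : 'C(m.*2.+2, m.+1) = (2 * 'C(m.*2.+1, m))%N.
Proof.
rewrite binS -(@bin_sub m.*2.+1 m.+1); last by lia.
by rewrite (_ : m.*2.+1 - m.+1 = m)%N; lia.
Qed.

Lemma bin_central_step m :
  (m.+1 * 'C(m.*2.+2, m.+1) = 2 * m.*2.+1 * 'C(m.*2, m))%N.
Proof.
rewrite bin_central_odd; have /= := mul_bin_down m.*2.+1 m.
rewrite (_ : m.*2.+1 - m = m.+1)%N; last by lia.
by move=> h; rewrite mulnCA -h mulnA.
Qed.

(** The factor [2 m + 1] closes the induction: squaring [bin_central_step], it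
    remains to see that [(2 m + 1) (2 m + 3) <= 4 (m + 1) ^ 2]. *)
Lemma bin_central_le m : ('C(m.*2, m) ^ 2 * m.*2.+1 <= 16 ^ m)%N.
Proof.
elim: m => // m IH; rewrite doubleS.
have := bin_central_step m; move: IH; rewrite [(16 ^ m.+1)%N]expnS.
set b := 'C(m.*2, m); set b' := 'C(_, _); set e := (16 ^ m)%N => IH h.
rewrite -(@leq_pmul2l (m.+1 ^ 2)) ?expn_gt0// mulnA -expnMn h.
apply: (@leq_trans (4 * m.*2.+1 * m.*2.+3 * e)).
  apply: (@leq_trans (4 * m.*2.+1 * m.*2.+3 * (b ^ 2 * m.*2.+1))).
    by rewrite eq_leq// !expnMn; lia.
  by rewrite leq_mul2l IH orbT.
by rewrite mulnA leq_mul2r; apply/orP; right; rewrite -muln2; lia.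
Qed.

Lemma bin_central_ge m : (16 ^ m.+1 <= 'C(m.+1.*2, m.+1) ^ 2 * (4 * m.+1))%N.
Proof.
elim: m => // m IH; rewrite doubleS.
have := bin_central_step m.+1; move: IH; rewrite [(16 ^ m.+2)%N]expnS.
set b := 'C(m.+1.*2, m.+1); set b' := 'C(_, _); set e := (16 ^ m.+1)%N.
move: b b' e; set k := m.+1 => b b' e IH h.
have k0 : (0 < k)%N by [].
rewrite -(@leq_pmul2l (k.+1 ^ 2)) ?expn_gt0// [X in (_ <= X)%N]mulnA -expnMn h.
rewrite -(@leq_pmul2l (4 * k)) ?muln_gt0//.
apply: (@leq_trans (16 * k.*2.+1 ^ 2 * k.+1 * e)).
  apply: (@leq_trans (16 * (4 * k * k.+1) * k.+1 * e)).
    by rewrite eq_leq//; lia.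
  by rewrite leq_mul2r; apply/orP; right; rewrite leq_mul2r; apply/orP; right; lia.
apply: (@leq_trans (16 * k.*2.+1 ^ 2 * k.+1 * (b ^ 2 * (4 * k)))).
  by rewrite leq_mul2l IH orbT.
by rewrite eq_leq// !expnMn; lia.
Qed.

Lemma bin_le_half j t : ('C(j, t) <= 'C(j, j./2))%N.
Proof.
have up s : (s < j./2)%N -> ('C(j, s) <= 'C(j, s.+1))%N.
  move=> sj; rewrite -(@leq_pmul2l s.+1)// mul_bin_left leq_mul2r.
  by apply/orP; right; lia.
have low s : (s <= j./2)%N -> ('C(j, s) <= 'C(j, j./2))%N.
  move=> sj; rewrite -(subKn sj); elim: (j./2 - s)%N => [|k IH].
    by rewrite subn0.
  case: (ltnP k j./2) => kj; last by rewrite (_ : j./2 - k.+1 = j./2 - k)%N//; lia.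
  apply: leq_trans IH; rewrite (_ : j./2 - k = (j./2 - k.+1).+1)%N; last by lia.
  by apply: up; lia.
case: (leqP t j./2) => [/low//|jt].
case: (leqP t j) => [tj|tj]; last by rewrite bin_small.
by rewrite -bin_sub//; apply: low; lia.
Qed.

Lemma bin_sqr_le j t : ('C(j, t) ^ 2 * j.+1 <= 4 ^ j)%N.
Proof.
apply: (@leq_trans ('C(j, j./2) ^ 2 * j.+1)%N).
  by rewrite leq_mul2r leq_exp2r// bin_le_half.
have := odd_double_half j; move: j./2 => m; case: (odd j) => /= <-.
  rewrite add1n; have := bin_central_le m.+1; rewrite doubleS bin_central_odd.
  move=> h; rewrite -(@leq_pmul2l 4)// -expnS -doubleS.
  rewrite -[X in (_ <= 4 ^ X)%N]mul2n expnM.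
  apply: leq_trans h; rewrite expnMn -mulnA leq_mul2l /= leq_mul2l.
  by rewrite leqnSn orbT.
have := bin_central_le m.
by rewrite add0n (_ : 16 = 4 ^ 2)%N// -expnM mul2n.
Qed.

Context {R : realType}.

Lemma bin_density_le j t :
  ('C(j, t))%:R / 2 ^+ j <= (Num.sqrt j.+1%:R)^-1 :> R.
Proof.
have s0 : 0 < Num.sqrt j.+1%:R :> R by rewrite sqrtr_gt0 ltr0n.
rewrite ler_pdivrMr ?exprn_gt0// mulrC ler_pdivlMr//.
rewrite -(@ler_pXn2r _ 2)// ?nnegrE; last 2 first.
- by rewrite mulr_ge0// ltW.
- by rewrite exprn_ge0.
rewrite exprMn sqr_sqrtr// -exprM mulnC exprM -!natrX -natrM ler_nat.
exact: bin_sqr_le.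
Qed.

Lemma bin_central_density m :
  (2 * Num.sqrt m.+1%:R)^-1 <= ('C(m.+1.*2, m.+1))%:R / 4 ^+ m.+1 :> R.
Proof.
have s0 : 0 < Num.sqrt m.+1%:R :> R by rewrite sqrtr_gt0 ltr0n.
rewrite ler_pdivlMr ?exprn_gt0// mulrC ler_pdivrMr ?mulr_gt0//.
rewrite -(@ler_pXn2r _ 2)// ?nnegrE; last 2 first.
- by rewrite exprn_ge0.
- by rewrite mulr_ge0// mulr_ge0// ltW.
rewrite !exprMn sqr_sqrtr// -exprM mulnC exprM -!natrX -!natrM ler_nat.
exact: bin_central_ge.
Qed.

(** Each factor C(2m, m+d+1) / C(2m, m+d) = (m-d) / (m+d+1) with d < D is at
    least 1 - 2D/m. *)
Lemma bin_off_central m d D : (d <= D)%N -> (D.*2 <= m)%N -> (0 < m)%N ->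
  ('C(m.*2, m))%:R * (1 - D.*2%:R / m%:R) ^+ d <= ('C(m.*2, m + d))%:R :> R.
Proof.
move=> + Dm m0; have mR : 0 < m%:R :> R by rewrite ltr0n.
have q0 : 0 <= 1 - D.*2%:R / m%:R :> R.
  by rewrite subr_ge0 ler_pdivrMr// mul1r ler_nat.
elim: d => [_|d IH dD]; first by rewrite addn0 expr0 mulr1.
have {}IH := IH (ltnW dD).
rewrite exprSr mulrA; apply: (le_trans (ler_wpM2r q0 IH)).
have h : (m + d.+1)%:R * ('C(m.*2, m + d.+1))%:R =
         (m - d)%:R * ('C(m.*2, m + d))%:R :> R.
  rewrite -!natrM addnS mul_bin_left; congr (_ * _)%:R; lia.
rewrite -(@ler_pM2l _ (m + d.+1)%:R) ?ltr0n ?addnS// -addnS h mulrCA mulrC.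
rewrite ler_wpM2r// natrB; last by lia.
rewrite mulrBr mulr1 natrD -!addrA lerD2l.
suff : d.+1%:R + d%:R <= (m%:R + d.+1%:R) * (D.*2%:R / m%:R) :> R by lra.
apply: (@le_trans _ _ D.*2%:R).
  by rewrite -natrD ler_nat; lia.
by rewrite mulrCA ler_peMr// ler_pdivlMr// mul1r lerDl.
Qed.

Lemma expR_le_onem (x : R) : 0 <= x <= 1 / 2 -> expR (- (2 * x)) <= 1 - x.
Proof.
move=> /andP[x0 x2]; rewrite expRN -[leRHS]invrK lef_pV2 ?posrE ?invr_gt0 ?expR_gt0//; last by lra.
apply: le_trans (expR_ge1Dx _); rewrite -[leLHS]mul1r ler_pdivrMr; last by lra.
nra.
Qed.

(** At a distance [d] from the centre of order [sqrt m] the product of the [d]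
    factors of [bin_off_central] is at least [(1 - 2 d / m) ^ d], hence at least
    [exp (- 4 d ^ 2 / m)], which is bounded below. *)
Lemma bin_even_density_ge (K : R) : 0 <= K -> exists2 c : R, 0 < c &
  exists m0, forall m t, (m0 <= m)%N -> (t%:R - m%:R) ^+ 2 <= K * m%:R ->
  c / Num.sqrt m%:R <= ('C(m.*2, t))%:R / 4 ^+ m.
Proof.
move=> K0; exists (expR (- (4 * K)) / 2); first by rewrite divr_gt0// expR_gt0.
exists (Num.trunc (16 * K)).+1 => m t mK.
have {mK} mK : 16 * K <= m%:R.
  by rewrite ltW// (lt_le_trans (truncnS_gt _))// ler_nat.
have [->|m0] := posnP m.
  move=> _; rewrite sqrtr0 invr0 mulr0 expr0 divr1; exact: ler0n.
have off d : d%:R ^+ 2 <= K * m%:R ->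
    expR (- (4 * K)) / 2 / Num.sqrt m%:R <= ('C(m.*2, m + d))%:R / 4 ^+ m :> R.
  move=> dK; have mR : 0 < m%:R :> R by rewrite ltr0n.
  have dm : (4 * d <= m)%N.
    rewrite -(@ler_nat R) natrM -(@ler_pXn2r _ 2) ?nnegrE// ?mulr_ge0//.
    by rewrite exprMn; nra.
  case: m m0 mK dK mR dm => // m _ mK dK mR dm.
  have q : expR (- (4 * K)) <= (1 - d.*2%:R / m.+1%:R) ^+ d :> R.
    apply: (@le_trans _ _ (expR (- (2 * (d.*2%:R / m.+1%:R))) ^+ d)).
      rewrite -expRM_natl ler_expR mulrN lerN2.
      rewrite -muln2 natrM [leLHS](_ : _ = 4 * d%:R ^+ 2 / m.+1%:R); last by field; lra.
      by rewrite ler_pdivrMr//; lra.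
    rewrite lerXn2r// ?nnegrE ?expR_ge0//.
      rewrite subr_ge0 ler_pdivrMr// mul1r ler_nat; lia.
    rewrite expR_le_onem// divr_ge0//= ler_pdivrMr//.
    by move: dm; rewrite -(@ler_nat R) natrM -muln2 natrM; lra.
  have e0 : 0 < expR (- (4 * K)) by rewrite expR_gt0.
  have p4 : 0 < 4 ^+ m.+1 :> R by rewrite exprn_gt0.
  have b1 := @bin_off_central m.+1 d d (leqnn _) ltac:(lia) isT.
  have c1 := bin_central_density m.
  rewrite -mulrA -invfM.
  apply: (@le_trans _ _ (expR (- (4 * K)) * ('C(m.+1.*2, m.+1)%:R / 4 ^+ m.+1))).
    by rewrite ler_pM2l.
  rewrite mulrA ler_pM2r ?invr_gt0//; apply: le_trans b1.
  by rewrite mulrC ler_wpM2l.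
case: (leqP m t) => mt h.
  rewrite -(subnKC mt); apply: off.
  by rewrite natrB.
have tm : (m - t <= m)%N by rewrite leq_subr.
have -> : 'C(m.*2, t) = 'C(m.*2, m + (m - t)).
  rewrite -bin_sub; last by lia.
  by congr binomial; lia.
by apply: off; rewrite natrB 1?ltnW// sqrrB; move: h; rewrite sqrrB; lra.
Qed.

(** For odd j = 2m+1 one of the two summands of Pascal's rule is kept. *)
Lemma bin_density_ge (K : R) : 0 <= K -> exists2 c : R, 0 < c &
  exists j0, forall j (t : int), (j0 <= j)%N ->
  (j%:R - 2 * t%:~R) ^+ 2 <= K * j%:R ->
  exists2 s : nat, t = s%:Z & c / Num.sqrt j%:R <= ('C(j, s))%:R / 2 ^+ j.
Proof.
move=> K0; have K1 : 0 <= 6 * K + 2 by lra.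
have [c c0 [m0 even]] := bin_even_density_ge K1.
exists (c / 2); first by rewrite divr_gt0.
exists (maxn (m0.*2.+2) (Num.trunc K).+1) => j t; rewrite geq_max => /andP[jm0 jK].
have {jK} jK : K < j%:R by rewrite (lt_le_trans (truncnS_gt _))// ler_nat.
case: t => [s|s] h; last first.
  exfalso; move: h; rewrite NegzE mulrNz mulrN opprK.
  have : 0 <= (s.+1)%:~R :> R by rewrite ler0z.
  have : 0 < j%:R :> R by lra.
  nra.
exists s => //; move: h; rewrite -pmulrn => h.
have [m jE] : exists m, j = m.*2 \/ j = m.*2.+1.
  by exists j./2; lia.
have m0R : 1 <= m%:R :> R by rewrite ler1n; case: jE => ?; lia.
have mj : Num.sqrt m%:R <= Num.sqrt j%:R :> R.
  by rewrite ler_sqrt ?ler0n// ler_nat; case: jE => ->; lia.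
have sm : 0 < Num.sqrt m%:R :> R by rewrite sqrtr_gt0; lra.
have ev : c / Num.sqrt m%:R <= ('C(m.*2, s))%:R / 4 ^+ m.
  apply: even; first by case: jE => ?; lia.
  have Km : 0 <= K * (m%:R - 1) by rewrite mulr_ge0// subr_ge0.
  have sq : 0 <= (s%:R - m%:R) ^+ 2 :> R by rewrite sqr_ge0.
  case: jE => jE; move: h; rewrite jE -?[_.*2.+1]addn1 ?natrD -muln2 natrM.
    by rewrite !expr2 in sq *; lra.
  have : 0 <= (2 * (s%:R - m%:R) - 2) ^+ 2 :> R by rewrite sqr_ge0.
  by rewrite !expr2 in sq *; lra.
have p4 : 4 ^+ m = 2 ^+ m.*2 :> R by rewrite -mul2n exprM; congr (_ ^+ _); lra.
have pg : 0 < 2 ^+ m.*2 :> R by rewrite exprn_gt0.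
have step : c / Num.sqrt j%:R <= ('C(m.*2, s))%:R / 4 ^+ m.
  apply: le_trans ev; rewrite ler_pM2l// lef_pV2// posrE//.
  exact: lt_le_trans mj.
rewrite mulrAC; case: jE => jE.
  rewrite {2 3}jE -p4; apply: le_trans step.
  rewrite ler_pdivrMr// ler_peMr//; last by lra.
  by rewrite divr_ge0// ltW.
rewrite {2 3}jE exprS invfM mulrCA mulrC ler_pM2l ?invr_gt0// -p4.
apply: (le_trans step); rewrite ler_pM2r ?invr_gt0 ?p4// ler_nat.
by rewrite leq_bin2l// jE.
Qed.

End binomials.
(** * Averaging operators on functions of an integer *)

Section averaging.
Context {R : realType}.
Local Open Scope ereal_scope.
Implicit Types (p f h : int -> \bar R) (x y z u v g : int) (F : nat -> int -> \bar R).

(** When [p] is the law of a step, [avg p f x] is the expectation of [f] after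
    one step from [x]. *)
Definition avg p f x : \bar R := \esum_(y in setT) p y * f (x + y)%R.

Definition delta z x : \bar R := (x == z)%:R%:E.

Lemma delta_ge0 z x : 0 <= delta z x.
Proof. by rewrite lee_fin. Qed.

Section one_law.
Context p (p0 : forall y, 0 <= p y).

Lemma avg_ge0 f : (forall x, 0 <= f x) -> forall x, 0 <= avg p f x.
Proof. by move=> f0 x; apply: esum_ge0 => y _; exact: mule_ge0. Qed.

Lemma le_avg f h : (forall x, f x <= h x) -> forall x, avg p f x <= avg p h x.
Proof. by move=> fh x; apply: le_esum => y _; exact: lee_wpmul2l. Qed.

Lemma avgD f h : (forall x, 0 <= f x) -> (forall x, 0 <= h x) ->
  avg p (fun x => f x + h x) = fun x => avg p f x + avg p h x.
Proof.
move=> f0 h0; apply/funext => x; rewrite /avg -esumD; last 2 first.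
- by move=> y _; exact: mule_ge0.
- by move=> y _; exact: mule_ge0.
by apply: eq_esum => y _; rewrite ge0_muleDr.
Qed.

Lemma avgZ c f : 0 <= c -> (forall x, 0 <= f x) ->
  avg p (fun x => c * f x) = fun x => c * avg p f x.
Proof.
move=> c0 f0; apply/funext => x; rewrite /avg -ge0_esumZl//.
  by apply: eq_esum => y _; rewrite muleCA.
by move=> y _; exact: mule_ge0.
Qed.

Lemma avg_cst c : 0 <= c ->
  avg p (fun _ => c) = fun _ => (\esum_(y in setT) p y) * c.
Proof. by move=> c0; apply/funext => x; rewrite /avg ge0_esumZr. Qed.

Lemma avg_shift f z : avg p (fun x => f (x + z)%R) = fun x => avg p f (x + z)%R.
Proof.
by apply/funext => x; apply: eq_esum => y _; rewrite addrAC.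
Qed.

Lemma iter_avg_ge0 n f : (forall x, 0 <= f x) -> forall x, 0 <= iter n (avg p) f x.
Proof. by move=> f0; elim: n => //= n IH; exact: avg_ge0. Qed.

Lemma le_iter_avg n f h : (forall x, f x <= h x) ->
  forall x, iter n (avg p) f x <= iter n (avg p) h x.
Proof. by move=> fh; elim: n => //= n IH; exact: le_avg. Qed.

Lemma iter_avgD n f h : (forall x, 0 <= f x) -> (forall x, 0 <= h x) ->
  iter n (avg p) (fun x => f x + h x) =
  fun x => iter n (avg p) f x + iter n (avg p) h x.
Proof.
move=> f0 h0; elim: n => //= n ->; rewrite avgD// => x; exact: iter_avg_ge0.
Qed.

Lemma iter_avgZ n c f : 0 <= c -> (forall x, 0 <= f x) ->
  iter n (avg p) (fun x => c * f x) = fun x => c * iter n (avg p) f x.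
Proof.
move=> c0 f0; elim: n => //= n ->; rewrite avgZ// => x; exact: iter_avg_ge0.
Qed.

Lemma iter_avg_shift n f z :
  iter n (avg p) (fun x => f (x + z)%R) = fun x => iter n (avg p) f (x + z)%R.
Proof. by elim: n => //= n ->; rewrite avg_shift. Qed.

End one_law.

(** * Extracting fair coins from a step distribution *)

(** The contribution to [avg] of the part [r / 2 * (delta u + delta v)] of a
    step law. *)
Definition coin (r : R) u v f x : \bar R := (r / 2)%:E * (f (x + u)%R + f (x + v)%R).

(** [mix p' n F x] is the expectation of [F J] at the position reached from [x]
    by the steps of law [p'], where [J] counts the coins among [n] steps that
    are each either a coin or a [p']-step; the coins themselves are left to
    [F].  See [mix_coin]. *)
Fixpoint mix p' n F : int -> \bar R :=
  if n is m.+1 then mix p' m (fun j x => F j.+1 x + avg p' (F j) x) else F 0%N.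

(** The expectation of [s J] for [J] binomial of parameters [n] and [r]. *)
Fixpoint bin_mean (r : R) n (s : nat -> R) : R :=
  if n is m.+1 then bin_mean r m (fun j => r * s j.+1 + (1 - r) * s j)%R else s 0%N.

(** That is, the binomial law has mean [r n] and variance [n r (1 - r)]. *)
Lemma bin_mean_quad (r a al be : R) n :
  bin_mean r n (fun j => al + be * (j%:R - a) ^+ 2)%R =
  (al + be * ((r * n%:R - a) ^+ 2 + n%:R * r * (1 - r)))%R.
Proof.
elim: n a al => [|n IH] a al /=.
  by rewrite !mulr0 !mul0r addr0.
transitivity (bin_mean r n (fun j => (al + be * (r * (1 - r))) +
    be * (j%:R - (a - r)) ^+ 2)%R).
  congr bin_mean; apply/funext => j.
  rewrite -[j.+1]addn1 natrD; ring.
by rewrite IH -[n.+1]addn1 natrD; ring.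
Qed.

Section coins.
Context p p' (r : R) u v.
Hypothesis (p'0 : forall y, 0 <= p' y) (r0 : (0 <= r)%R).
Hypothesis pE : forall y, p y = p' y + ((r / 2)%:E * (delta u y + delta v y)).

Let r2 : 0 <= (r / 2)%:E. Proof. by rewrite lee_fin divr_ge0. Qed.

Let p0 y : 0 <= p y.
Proof. by rewrite pE adde_ge0// mule_ge0// adde_ge0// delta_ge0. Qed.

Lemma coin_ge0 f : (forall x, 0 <= f x) -> forall x, 0 <= coin r u v f x.
Proof. by move=> f0 x; rewrite mule_ge0// adde_ge0. Qed.

Lemma iter_coin_ge0 j f : (forall x, 0 <= f x) ->
  forall x, 0 <= iter j (coin r u v) f x.
Proof. by move=> f0; elim: j => //= j IH; exact: coin_ge0. Qed.

Lemma avg_delta_weight z f x : 0 <= f (x + z)%R ->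
  \esum_(y in setT) delta z y * f (x + y)%R = f (x + z)%R.
Proof.
move=> f0; rewrite (@esum_single _ _ _ z); last 2 first.
- by rewrite mule_ge0// ?delta_ge0// f0.
- by move=> y yz; rewrite /delta (negbTE yz) mul0e.
by rewrite /delta eqxx mul1e.
Qed.

Lemma avg_coin f : (forall x, 0 <= f x) ->
  avg p f = fun x => coin r u v f x + avg p' f x.
Proof.
move=> f0; apply/funext => x; rewrite /avg addeC /coin.
rewrite -(@avg_delta_weight u)// -(@avg_delta_weight v)//.
rewrite -esumD; last 2 first.
- by move=> y _; rewrite mule_ge0// delta_ge0.
- by move=> y _; rewrite mule_ge0// delta_ge0.
rewrite -ge0_esumZl//; last first.
  by move=> y _; rewrite adde_ge0// mule_ge0// delta_ge0.
rewrite -esumD; last 2 first.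
- by move=> y _; exact: mule_ge0.
- by move=> y _; rewrite mule_ge0// adde_ge0// mule_ge0// delta_ge0.
apply: eq_esum => y _; rewrite pE ge0_muleDl//; last first.
  by rewrite mule_ge0// adde_ge0// delta_ge0.
by rewrite -muleA ge0_muleDl// delta_ge0.
Qed.

Lemma coin_avg f : (forall x, 0 <= f x) ->
  avg p (coin r u v f) = coin r u v (avg p f).
Proof.
move=> f0; rewrite /coin avgZ//; last by move=> x; rewrite adde_ge0.
by rewrite avgD// !avg_shift.
Qed.

Lemma iter_coin_avg j f : (forall x, 0 <= f x) ->
  avg p (iter j (coin r u v) f) = iter j (coin r u v) (avg p f).
Proof.
move=> f0; elim: j => //= j IH; rewrite coin_avg ?IH//.
exact: iter_coin_ge0.
Qed.

Lemma le_mix n F G : (forall j x, F j x <= G j x) ->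
  forall x, mix p' n F x <= mix p' n G x.
Proof.
elim: n F G => //= n IH F G FG; apply: IH => j x; rewrite leeD//.
exact: le_avg.
Qed.

Lemma mixD n F G : (forall j x, 0 <= F j x) -> (forall j x, 0 <= G j x) ->
  mix p' n (fun j x => F j x + G j x) = fun x => mix p' n F x + mix p' n G x.
Proof.
elim: n F G => //= n IH F G F0 G0; rewrite -IH; last 2 first.
- by move=> j x; rewrite adde_ge0// avg_ge0.
- by move=> j x; rewrite adde_ge0// avg_ge0.
congr mix; apply/funext => j; apply/funext => x.
by rewrite avgD// addeACA.
Qed.

Lemma mixZ n c F : 0 <= c -> (forall j x, 0 <= F j x) ->
  mix p' n (fun j x => c * F j x) = fun x => c * mix p' n F x.
Proof.
move=> c0; elim: n F => //= n IH F F0; rewrite -IH; last first.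
  by move=> j x; rewrite adde_ge0// avg_ge0.
congr mix; apply/funext => j; apply/funext => x.
by rewrite avgZ// ge0_muleDr// avg_ge0.
Qed.

(** The coins commute with the averages, so that they can all be tossed last. *)
Lemma mix_coin n f : (forall x, 0 <= f x) ->
  mix p' n (fun j => iter j (coin r u v) f) = iter n (avg p) f.
Proof.
elim: n f => //= n IH f f0; rewrite -iterS iterSr -IH; last exact: avg_ge0.
congr mix; apply/funext => j; rewrite -iter_coin_avg//.
by rewrite avg_coin//; exact: iter_coin_ge0.
Qed.

Hypothesis (r1 : (r <= 1)%R) (p'1 : \esum_(y in setT) p' y = (1 - r)%:E).

(** For functions of the number of coins alone the mixture is a binomial mean;
    [r ^+ j] is the total mass that [j] coins carry. *)
Lemma mix_bin_mean n (s : nat -> R) : (forall j, 0 <= s j)%R ->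
  mix p' n (fun j _ => (r ^+ j * s j)%:E) = fun _ => (bin_mean r n s)%:E.
Proof.
elim: n s => [|n IH] s s0 /=; first by rewrite expr0 mul1r.
rewrite -IH; last first.
  by move=> j; rewrite addr_ge0// mulr_ge0// subr_ge0.
congr mix; apply/funext => j; apply/funext => x.
rewrite avg_cst ?lee_fin ?mulr_ge0 ?exprn_ge0// p'1 -EFinM -EFinD exprSr.
by congr EFin; ring.
Qed.

End coins.

End averaging.
(** * Local bounds for a step distribution containing a coin *)

Section coin_bounds.
Context {R : realType}.
Local Open Scope ereal_scope.
Context (p p' : int -> \bar R) (r : R) (u v : int).
Let g : int := (v - u)%R.
Hypothesis (p'0 : forall y, 0 <= p' y) (r0 : (0 < r)%R) (r1 : (r <= 1)%R).
Hypothesis pE : forall y, p y = p' y + ((r / 2)%:E * (delta u y + delta v y)).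
Hypothesis p'1 : \esum_(y in setT) p' y = (1 - r)%:E.
Hypothesis g0 : g != 0%R.

Let r0' : (0 <= r)%R. Proof. exact: ltW. Qed.

Let binz j (t : int) : nat := if t is Posz s then 'C(j, s) else 0%N.

Let binzS j t : binz j.+1 t = (binz j t + binz j (t - 1))%N.
Proof.
case: t => [[|t]|t]; first by rewrite /= !bin0.
  by rewrite (_ : t.+1%:Z - 1 = t)%R /= ?binS//; lia.
by rewrite NegzE -opprD -PoszD addn1.
Qed.

(** From the point [- (u j + g t)] the walk is at zero after [j] coins if and
    only if exactly [t] of them show [v]. *)
Lemma iter_coin_delta j (t : int) :
  iter j (coin r u v) (delta 0) (- (u * j%:Z + g * t))%R =
  (r ^+ j * ((binz j t)%:R / 2 ^+ j))%:E.
Proof.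
elim: j t => [|j IH] t.
  rewrite /= /delta mulr0 add0r expr0 mul1r expr0 divr1 oppr_eq0 mulf_eq0.
  by rewrite (negbTE g0) /=; case: t => [[|t]|t].
rewrite iterS /coin.
rewrite (_ : - _ + u = - (u * j%:Z + g * t))%R; last by rewrite -[j.+1]addn1 PoszD; ring.
rewrite (_ : - _ + v = - (u * j%:Z + g * (t - 1)))%R; last first.
  by rewrite -[j.+1]addn1 PoszD /g; ring.
rewrite !IH -EFinD -EFinM binzS natrD !exprS; congr EFin.
by field; rewrite expf_neq0.
Qed.

Lemma iter_coin_delta_out j x : (forall t : int, x <> - (u * j%:Z + g * t))%R ->
  iter j (coin r u v) (delta 0) x = 0.
Proof.
elim: j x => [|j IH] x xt.
  by rewrite /= /delta; case: eqP => // x0; case: (xt 0%R); rewrite x0 !mulr0 addr0 oppr0.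
rewrite iterS /coin !IH ?adde0 ?mule0// => t xE.
  apply: (xt (t + 1)%R); rewrite -[j.+1]addn1 PoszD.
  by apply: (addIr v); rewrite xE /g; ring.
apply: (xt t); rewrite -[j.+1]addn1 PoszD.
by apply: (addIr u); rewrite xE /g; ring.
Qed.

Lemma iter_coin_delta_le j x :
  iter j (coin r u v) (delta 0) x <= (r ^+ j * (Num.sqrt j.+1%:R)^-1)%:E.
Proof.
have rj : (0 <= r ^+ j)%R by rewrite exprn_ge0// ltW.
have [[t ->]|/forallNP xt] :=
    pselect (exists t : int, x = - (u * j%:Z + g * t))%R; last first.
  by rewrite iter_coin_delta_out// lee_fin mulr_ge0.
rewrite iter_coin_delta lee_fin ler_wpM2l//.
by case: t => t /=; [exact: bin_density_le|rewrite mul0r invr_ge0 sqrtr_ge0].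
Qed.

(** Given the number of coins the position has density at most the inverse
    square root of that number; Chebyshev's inequality, in the form of a
    quadratic majorant, makes that number proportional to [n]. *)
Lemma coin_hit_le : exists2 C : R, (0 < C)%R & forall n x,
  iter n (avg p) (delta 0) x <= (C / Num.sqrt n.+1%:R)%:E.
Proof.
exists (Num.sqrt (2 / r) + 4 / r)%R.
  by rewrite ltr_wpDl ?sqrtr_ge0// divr_gt0.
move=> n x; have d0 y : 0 <= delta 0 y :> \bar R by exact: delta_ge0.
rewrite -(mix_coin p'0 (ltW r0) pE)//.
pose N : R := n.+1%:R; have N1 : (1 <= N)%R by rewrite ler1n.
(* The term [al] dominates if [j] is at least half its mean, and otherwise the
   quadratic term is at least [1]. *)
pose al := Num.sqrt (2 / (r * N)); pose be := (4 / (r * N) ^+ 2)%R.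
pose s (j : nat) := (al + be * (j%:R - r * n%:R) ^+ 2)%R.
have al0 : (0 <= al)%R by rewrite sqrtr_ge0.
have rN : (0 < r * N)%R by rewrite mulr_gt0//; lra.
have rN' := ltW rN; have N0 : (0 <= N)%R by lra.
have be0 : (0 <= be)%R by rewrite divr_ge0// exprn_ge0// ltW.
have s0 j : (0 <= s j)%R by rewrite addr_ge0// mulr_ge0// sqr_ge0.
apply: (@le_trans _ _ (mix p' n (fun j _ => (r ^+ j * s j)%:E) x)).
  apply: le_mix => // j y; apply: (le_trans (iter_coin_delta_le j y)).
  rewrite lee_fin ler_wpM2l ?exprn_ge0// /s.
  have sq1 : (1 <= Num.sqrt j.+1%:R :> R)%R by rewrite -[leLHS]sqrtr1 ler_sqrt// ler1n.
  have [jN|jN] := leP (r * N / 2)%R (j.+1%:R : R)%R.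
    rewrite -[leLHS]addr0 lerD//; last by rewrite mulr_ge0// sqr_ge0.
    rewrite -sqrtrV// ler_sqrt ?divr_ge0//.
    by rewrite -[leRHS]invf_div lef_pV2// posrE ?divr_gt0.
  rewrite -[leLHS]add0r lerD//; apply: (@le_trans _ _ 1%R).
    by rewrite invf_le1//; lra.
  rewrite /be mulrAC ler_pdivlMr ?exprn_gt0// mul1r.
  have h : (r * N / 2 <= r * n%:R - j%:R)%R.
    have NE : N = (n%:R + 1)%R by rewrite /N -addn1 natrD.
    have jN' : (j%:R + 1 < r * N / 2)%R by rewrite natr1.
    by move: jN'; rewrite NE; move: (n%:R : R) (j%:R : R) (r1) => a b ? ?; lra.
  have : ((r * N / 2) ^+ 2 <= (r * n%:R - j%:R) ^+ 2)%R.
    by rewrite lerXn2r ?nnegrE//; lra.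
  by rewrite -[in leRHS]sqrrN opprB !expr2; lra.
rewrite (mix_bin_mean p'0 (ltW r0))// lee_fin bin_mean_quad subrr expr0n /= add0r.
rewrite mulrDl lerD//.
  rewrite /al -sqrtrV// -sqrtrM ?divr_ge0// ler_sqrt ?mulr_ge0 ?invr_ge0//.
  by rewrite invfM mulrA.
have sN : (Num.sqrt N <= N)%R.
  rewrite -[leRHS](@ger0_norm _ N); last by lra.
  by rewrite -sqrtr_sqr ler_sqrt ?sqr_ge0// expr2 ler_peMr//; lra.
have sN0 : (0 < Num.sqrt N)%R by rewrite sqrtr_gt0; lra.
apply: (@le_trans _ _ (4 / r / N)%R); last first.
  by rewrite ler_wpM2l ?divr_ge0// lef_pV2 ?posrE//; lra.
rewrite /be (_ : _ * (n%:R * r * (1 - r)) = 4 / r / N * ((1 - r) * (n%:R / N)))%R; last first.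
  by field; rewrite !gt_eqF//; lra.
have hr0 := r0; have hr1 := r1.
rewrite ler_piMr ?divr_ge0//.
have q1 : (n%:R / N <= 1)%R by rewrite ler_pdivrMr ?mul1r ?ler_nat//; lra.
have q0 : (0 <= n%:R / N)%R by rewrite divr_ge0.
by rewrite mulr_ile1// ?subr_ge0//; lra.
Qed.

Definition square (x : int) : \bar R := (x%:~R ^+ 2)%:E.

Definition multiple (m x : int) : \bar R := ((m %| x)%Z)%:R%:E.

Lemma square_ge0 x : 0 <= square x.
Proof. by rewrite lee_fin sqr_ge0. Qed.

Lemma multiple_ge0 m x : 0 <= multiple m x.
Proof. by rewrite lee_fin. Qed.

(** The mean of the square is at least the square of the mean position. *)
Lemma iter_coin_square_ge j x :
  (r ^+ j * (x%:~R + (u + v)%:~R * j%:R / 2) ^+ 2)%:E <=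
  iter j (coin r u v) square x.
Proof.
elim: j x => [|j IH] x.
  by rewrite /= expr0 mul1r mulr0 mul0r addr0.
rewrite iterS /coin; apply: (@le_trans _ _ ((r / 2)%:E *
   ((r ^+ j * ((x + u)%:~R + (u + v)%:~R * j%:R / 2) ^+ 2)%:E +
    (r ^+ j * ((x + v)%:~R + (u + v)%:~R * j%:R / 2) ^+ 2)%:E))); last first.
  by rewrite lee_wpmul2l ?leeD// lee_fin divr_ge0// ltW.
rewrite -EFinD -EFinM lee_fin exprS -[j.+1]addn1 natrD !intrD.
set X := x%:~R; set U := u%:~R; set V := v%:~R; set J : R := j%:R.
rewrite -mulrDr (_ : r / 2 * (r ^+ j * _) = r * r ^+ j * (1 / 2 *
  ((X + U + (U + V) * J / 2) ^+ 2 + (X + V + (U + V) * J / 2) ^+ 2)))%R; last by ring.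
rewrite ler_wpM2l ?mulr_ge0 ?exprn_ge0//.
have : (0 <= (U - V) ^+ 2)%R by rewrite sqr_ge0.
by rewrite !expr2; lra.
Qed.

(** The two faces of the coin agree modulo [g]. *)
Lemma iter_coin_multiple_le j x :
  iter j (coin r u v) (multiple g) x <= (r ^+ j)%:E * multiple g (x + u * j%:Z)%R.
Proof.
elim: j x => [|j IH] x; first by rewrite /= expr0 mul1e mulr0 addr0.
have r2 : 0 <= (r / 2)%:E by rewrite lee_fin divr_ge0// ltW.
rewrite iterS /coin; apply: (le_trans (lee_wpmul2l r2 (leeD (IH _) (IH _)))).
rewrite (_ : x + u + _ = x + u * j.+1%:Z)%R; last by rewrite -[j.+1]addn1 PoszD; ring.
rewrite (_ : x + v + _ = g + (x + u * j.+1%:Z))%R; last by rewrite -[j.+1]addn1 PoszD /g; ring.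
have dv (w : int) : (g %| (g + w)%R)%Z = (g %| w)%Z by exact: (rpredDl _ (dvdzz g)).
rewrite /multiple dv; move: ((g %| _)%Z%:R : R) => w.
rewrite -[leLHS]/((r / 2 * (r ^+ j * w + r ^+ j * w))%R%:E).
rewrite -[leRHS]/((r ^+ j.+1 * w)%R%:E) lee_fin exprS.
by rewrite (_ : r / 2 * _ = r * r ^+ j * w)%R//; field.
Qed.

(** Up to unlikely events (too few or too many coins, or a position too far
    away), being in the right class modulo the distance of the two faces of the
    coin is enough to hit [0] with probability of order [n ^ (-1/2)]. *)
Lemma coin_hit_ge (K : R) : (0 < K)%R -> exists2 c : R, (0 < c)%R &
  exists n0, forall n x, (n0 <= n)%N -> (0 < n)%N ->
  (c / Num.sqrt n%:R)%:E * iter n (avg p) (multiple g) x <=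
  iter n (avg p) (delta 0) x +
  (c / Num.sqrt n%:R / (K * n%:R))%:E * iter n (avg p) square x +
  (c / Num.sqrt n%:R * (4 / (r * n%:R)))%:E.
Proof.
move=> K0; pose G : R := g%:~R.
have G0 : (0 < G ^+ 2)%R by rewrite exprn_even_gt0//= intr_eq0.
have [|c c0 [j0 cP]] := @bin_density_ge R (8 * K / (r * G ^+ 2))%R.
  by rewrite ltW// divr_gt0// mulr_gt0.
exists (c / 2)%R; first by rewrite divr_gt0.
exists (Num.trunc (2 * j0%:R / r)).+1 => n x nj n1.
have {nj} nj : (2 * j0%:R / r <= n%:R)%R.
  by rewrite ltW// (lt_le_trans (truncnS_gt _))// ler_nat.
have N0 : (0 < n%:R :> R)%R by rewrite ltr0n.
set A := (c / 2 / Num.sqrt n%:R)%R.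
have sN0 : (0 < Num.sqrt n%:R :> R)%R by rewrite sqrtr_gt0.
have A0 : (0 <= A)%R by rewrite !divr_ge0// ltW.
set B := (A / (K * n%:R))%R.
have B0 : (0 <= B)%R by rewrite divr_ge0// ltW// mulr_gt0.
pose s (j : nat) := (0 + A * (4 / (r * n%:R) ^+ 2) * (j%:R - r * n%:R) ^+ 2)%R.
have s0 j : (0 <= s j)%R.
  by rewrite /s add0r mulr_ge0 ?sqr_ge0// mulr_ge0// divr_ge0// sqr_ge0.
have sE : (bin_mean r n s)%:E <= (A * (4 / (r * n%:R)))%:E.
  rewrite bin_mean_quad subrr expr0n /= !add0r lee_fin -mulrA ler_wpM2l//.
  rewrite (_ : 4 / _ ^+ 2 * _ = 4 / (r * n%:R) * (1 - r))%R; last first.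
    by field; rewrite !gt_eqF.
  by rewrite ler_piMr ?divr_ge0 ?mulr_ge0//; move: (r0) => ?; lra.
apply: (@le_trans _ _ (iter n (avg p) (delta 0) x + B%:E * iter n (avg p) square x +
    (bin_mean r n s)%:E)); last by rewrite leeD2l.
have d0 y : 0 <= delta 0 y :> \bar R by exact: delta_ge0.
rewrite -!(mix_coin p'0 (ltW r0) pE) ?d0//; last 2 first.
- exact: square_ge0.
- exact: multiple_ge0.
have cd0 j y : 0 <= iter j (coin r u v) (delta 0) y.
  by apply: iter_coin_ge0 => //; exact: ltW.
have cs0 j y : 0 <= iter j (coin r u v) square y.
  by apply: iter_coin_ge0 => [|z]; [exact: ltW|exact: square_ge0].
have cm0 j y : 0 <= iter j (coin r u v) (multiple g) y.
  by apply: iter_coin_ge0 => [|z]; [exact: ltW|exact: multiple_ge0].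
have rs0 j : 0 <= (r ^+ j * s j)%:E.
  by rewrite lee_fin mulr_ge0// exprn_ge0// ltW.
have BS j y : 0 <= B%:E * iter j (coin r u v) square y by rewrite mule_ge0.
rewrite -[X in _ <= _ + X]/((fun _ : int => (bin_mean r n s)%:E) x).
rewrite -(mix_bin_mean p'0 (ltW r0))//.
rewrite -[X in X <= _]/((fun y => A%:E * mix p' n _ y) x) -mixZ//.
rewrite -[X in _ + X + _]/((fun y => B%:E * mix p' n _ y) x) -mixZ//.
rewrite -[X in X + _]/((fun y => mix p' n _ y + mix p' n _ y) x) -mixD//.
rewrite -[X in _ <= X]/((fun y => mix p' n _ y + mix p' n _ y) x) -mixD//; last first.
  by move=> j y; rewrite adde_ge0.
apply: le_mix => // j y.
have rj : (0 <= r ^+ j)%R by rewrite exprn_ge0// ltW.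
apply: (le_trans (lee_wpmul2l _ (iter_coin_multiple_le j y))).
  by rewrite lee_fin.
have [yg|yg] := boolP (g %| (y + u * j%:Z)%R)%Z; last first.
  by rewrite /multiple (negbTE yg) mule0 mule0 !adde_ge0.
rewrite /multiple yg mule1 -EFinM; set D := (y%:~R + (u + v)%:~R * j%:R / 2 : R)%R.
have rn0 : (0 < r * n%:R)%R by rewrite mulr_gt0.
(* The square term pays for a position too far away, and [s] for an atypical
   number of coins. *)
have [far|near] := leP (K * n%:R)%R (D ^+ 2)%R.
  rewrite -[leLHS]adde0 leeD// -[leLHS]add0e leeD//.
  apply: (le_trans _ (lee_wpmul2l _ (iter_coin_square_ge j y))); last by rewrite lee_fin.
  rewrite -EFinM lee_fin -/D mulrCA mulrC ler_wpM2l// /B mulrAC.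
  by rewrite ler_pdivlMr ?mulr_gt0// ler_wpM2l.
have [out|inn] := leP ((r * n%:R / 2) ^+ 2)%R ((j%:R - r * n%:R) ^+ 2)%R.
  rewrite -[leLHS]add0e leeD ?adde_ge0// lee_fin mulrC ler_wpM2l// /s add0r.
  rewrite -mulrA ler_peMr// mulrAC ler_pdivlMr ?exprn_gt0// mul1r.
  by move: out; rewrite exprMn exprVn; lra.
have [jlo jhi] : (r * n%:R / 2 < j%:R)%R /\ (j%:R <= 4 * n%:R :> R)%R.
  move: inn rn0 (r1) N0; move: (n%:R : R) (j%:R : R) => N J inn rn0 hr1 N0.
  have {inn} : (`|J - r * N| < `|r * N / 2|)%R.
    by rewrite -(@ltr_pXn2r _ 2)// ?nnegrE// !real_normK// num_real.
  rewrite [X in (_ < X)%R]ger0_norm; last by lra.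
  by rewrite ltr_norml => /andP[? ?]; split; nra.
have jj0 : (j0 <= j)%N.
  rewrite -(@ler_nat R); move: nj; rewrite ler_pdivrMr// => nj.
  by move: jlo nj; rewrite (mulrC n%:R); lra.
have /dvdzP[t tE] := yg.
have DE : (D = G / 2 * (j%:R - 2 * (- t)%:~R))%R.
  have yE : y = (t * g - u * j%:Z)%R by rewrite -tE; ring.
  have VE : v%:~R = (G + u%:~R :> R)%R by rewrite /G -intrD /g; congr intr; ring.
  rewrite /D yE !intrD !rmorphN /= !intrM VE -/G -pmulrn; by field.
have [|s' ts cs] := cP j (- t)%R jj0.
  move: near; rewrite DE exprMn => near.
  have : ((j%:R - 2 * (- t)%:~R) ^+ 2 < 4 * K * n%:R / G ^+ 2 :> R)%R.
    by rewrite ltr_pdivlMr//; move: near; rewrite exprMn exprVn; lra.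
  move/ltW/le_trans; apply; rewrite ler_pdivrMr//.
  rewrite (_ : 8 * K / _ * _ * _ = 4 * K * (2 * j%:R / r))%R; last first.
    by field; rewrite gt_eqF//= intr_eq0.
  rewrite ler_wpM2l ?mulr_ge0 ?(ltW K0)// ler_pdivlMr//.
  by move: jlo; rewrite (mulrC n%:R); lra.
have -> : y = (- (u * j%:Z + g * s'%:Z))%R by rewrite -ts -[y](addrK (u * j%:Z)%R) tE; ring.
rewrite iter_coin_delta /= -[leLHS]adde0 -addeA leeD ?adde_ge0//.
rewrite lee_fin mulrC ler_wpM2l//; apply: le_trans cs.
have j1 : (0 < Num.sqrt j%:R :> R)%R by rewrite sqrtr_gt0; lra.
rewrite /A -mulrA -invfM ler_pM2l// lef_pV2 ?posrE ?mulr_gt0//.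
have -> : (2 = Num.sqrt (2 ^+ 2) :> R)%R by rewrite sqrtr_sqr ger0_norm.
by rewrite -sqrtrM// ler_sqrt// expr2; lra.
Qed.

End coin_bounds.
(** * Return probabilities of a walk on the integers *)

Section integer_walk.
Context {R : realType}.
Local Open Scope ereal_scope.

(** The mass at [y] of the law of the sum of [n] independent steps. *)
Definition mass (p : int -> \bar R) n y : \bar R := iter n (avg p) (delta y) 0%R.

(** The smaller of two atoms is common to both, and so it is the weight of a
    face of a fair coin. *)
Lemma split_coin (p : int -> \bar R) (u v : int) :
  (forall y, 0 <= p y) -> \esum_(y in setT) p y = 1 ->
  u != v -> 0 < p u -> 0 < p v ->
  exists r : R, exists p' : int -> \bar R,
  [/\ (0 < r)%R, (r <= 1)%R, forall y, 0 <= p' y,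
      forall y, p y = p' y + (r / 2)%:E * (delta u y + delta v y) &
      \esum_(y in setT) p' y = (1 - r)%:E].
Proof.
move=> p0 p1 uv pu pv.
have p_le1 y : p y <= 1 by rewrite -p1; apply: esum_ge_term.
have pfin y : p y = (fine (p y))%:E.
  by rewrite fineK// ge0_fin_numE// (le_lt_trans (p_le1 y))// ltry.
set a := Num.min (fine (p u)) (fine (p v)).
have a0 : (0 < a)%R by rewrite lt_min -!lte_fin -!pfin pu pv.
pose p' y := (fine (p y) - (a * ((y == u)%:R + (y == v)%:R)))%R%:E.
have p'0 y : 0 <= p' y.
  rewrite lee_fin subr_ge0; have [->|yu] := eqVneq y u.
    by rewrite (negbTE uv) addr0 mulr1 ge_min lexx.
  have [->|yv] := eqVneq y v; first by rewrite add0r mulr1 ge_min lexx orbT.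
  by rewrite addr0 mulr0 fine_ge0.
have pE y : p y = p' y + (a * 2 / 2)%:E * (delta u y + delta v y).
  rewrite mulfK// [LHS]pfin /p' /delta.
  by rewrite -[in LHS](subrK (a * ((y == u)%:R + (y == v)%:R))%R (fine _)).
have d0 y z : 0 <= delta y z :> \bar R by exact: delta_ge0.
have sum : \esum_(y in setT) p' y + (a * 2)%:E = 1.
  rewrite -p1 (eq_esum (fun y _ => pE y)) mulfK// esumD//; last first.
    by move=> y _; rewrite mule_ge0 ?adde_ge0// lee_fin ltW.
  congr (_ + _); rewrite ge0_esumZl ?lee_fin ?ltW//; last first.
    by move=> y _; rewrite adde_ge0.
  have dsum z : \esum_(y in setT) delta z y = 1 :> \bar R.
    rewrite (@esum_single _ _ _ z)//; first by rewrite /delta eqxx.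
    by move=> y yz; rewrite /delta (negbTE yz).
  by rewrite esumD// !dsum.
have s0 : 0 <= \esum_(y in setT) p' y by exact: esum_ge0.
have sumE : \esum_(y in setT) p' y = (1 - a * 2)%:E.
  by rewrite EFinB -sum addeK.
exists (a * 2)%R, p'; split => //; first by rewrite mulr_gt0.
by move: s0; rewrite sumE lee_fin subr_ge0.
Qed.

Context (p : int -> \bar R).
Hypothesis (p0 : forall y, 0 <= p y) (p1 : \esum_(y in setT) p y = 1).

Lemma mass_ge0 n y : 0 <= mass p n y.
Proof. by apply: iter_avg_ge0 => // x; exact: delta_ge0. Qed.

Lemma iter_avg_mass n f : (forall x, 0 <= f x) ->
  iter n (avg p) f = avg (mass p n) f.
Proof.
move=> f0; elim: n => [|n IH]; apply/funext => x.
  rewrite /avg (@esum_single _ _ _ 0%R).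
  - by rewrite /mass /delta /= mul1e addr0.
  - by rewrite mule_ge0 ?mass_ge0.
  - by move=> y y0; rewrite /mass /delta /= eq_sym (negbTE y0) mul0e.
have massS z : mass p n.+1 z = \esum_(y in setT) p y * mass p n (z - y)%R.
  rewrite /mass iterS /avg; apply: eq_esum => y _; congr (_ * _).
  have /(congr1 (@^~ 0%R)) /= <- := iter_avg_shift p n (delta z) y.
  by congr (iter _ _ _ _); apply/funext => w; rewrite /delta [in RHS]eq_sym subr_eq eq_sym.
rewrite iterS IH /avg.
transitivity (\esum_(y in setT) \esum_(z in setT) p y * mass p n (z - y)%R * f (x + z)%R).
  apply: eq_esum => y _; rewrite -ge0_esumZl//; last first.
    by move=> z _; rewrite mule_ge0 ?mass_ge0.
  rewrite -[RHS](@esum_bij _ _ _ (fun z => z + y)%R); last first.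
    by exists (fun z => z - y)%R => z; rewrite ?subrK ?addrK.
  by apply: eq_esum => z _; rewrite addrK muleA (addrC z) addrA.
rewrite exchange_esum; last by move=> y z; rewrite !mule_ge0 ?mass_ge0.
apply: eq_esum => z _; rewrite massS ge0_esumZr// => y _.
by rewrite mule_ge0 ?mass_ge0.
Qed.

Lemma iter_avg1 n c : 0 <= c -> iter n (avg p) (fun _ => c) = fun _ => c.
Proof. by move=> c0; elim: n => //= n ->; rewrite avg_cst// p1; under eq_fun do rewrite mul1e. Qed.

Lemma sum_mass n : \esum_(y in setT) mass p n y = 1.
Proof.
have := iter_avg1 n (@lee01 R); rewrite iter_avg_mass// avg_cst//.
  by move=> /(congr1 (@^~ 0%R)); rewrite mule1.
by move=> y; exact: mass_ge0.
Qed.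

Lemma mass0 y : mass p 0 y = delta y 0. Proof. by []. Qed.

Lemma mass1 y : mass p 1 y = p y.
Proof.
rewrite /mass /= /avg (@esum_single _ _ _ y).
- by rewrite /delta add0r eqxx mule1.
- by rewrite mule_ge0 ?delta_ge0.
- by move=> z zy; rewrite /delta add0r (negbTE zy) mule0.
Qed.

Lemma mass_addn_gt0 n m u v : 0 < mass p n u -> 0 < mass p m v ->
  0 < mass p (n + m) (u + v)%R.
Proof.
move=> nu mv; have d0 x : 0 <= delta (u + v)%R x :> \bar R by exact: delta_ge0.
rewrite /mass iterD iter_avg_mass; last exact: iter_avg_ge0.
have vE : iter m (avg p) (delta (u + v)%R) (0 + u)%R = mass p m v.
  have /(congr1 (@^~ 0%R)) /= <- := iter_avg_shift p m (delta (u + v)%R) u.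
  congr (iter _ _ _ _); apply/funext => x.
  by rewrite /delta (addrC u) (inj_eq (addIr u)).
apply: (@lt_le_trans _ _ (mass p n u * iter m (avg p) (delta (u + v)%R) (0 + u)%R)).
  by rewrite vE mule_gt0.
by apply: (@esum_ge_term _ _ _ (fun y => mass p n y * _)) => //;
  rewrite mule_ge0 ?mass_ge0// iter_avg_ge0.
Qed.

Lemma mass_muln_gt0 a n u : 0 < mass p n u -> 0 < mass p (a * n) (u * a%:Z)%R.
Proof.
move=> nu; elim: a => [|a IH]; first by rewrite mul0n mulr0 mass0 /delta eqxx.
by rewrite mulSn -[a.+1]add1n PoszD mulrDr mulr1; exact: mass_addn_gt0.
Qed.

Lemma exists_atom n : exists u, 0 < mass p n u.
Proof.
apply/not_existsP => h; have := sum_mass n; rewrite esum1; last first.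
  move=> y _; apply/eqP; rewrite eq_le mass_ge0 andbT leNgt.
  by apply/negP/h.
by move/eqP; rewrite eq_sym onee_eq0.
Qed.

Definition nondegenerate := exists u v, [/\ u != v, 0 < p u & 0 < p v].

(** With [g] the least positive difference of two atoms of a common convolution
    power, atoms of a common power are congruent modulo [g]: otherwise adding
    copies of the upper one of the two atoms at distance [g] to the smaller atom,
    and as many of the lower one to the larger atom, would leave a smaller
    positive difference. *)
Lemma atom_spacing : nondegenerate -> exists s (u v : int),
  [/\ (u < v)%R, 0 < mass p s u, 0 < mass p s v &
   forall n a b, 0 < mass p n a -> 0 < mass p n b -> ((v - u)%R %| (a - b)%R)%Z].
Proof.
move=> [u0 [v0 [uv0 pu0 pv0]]].
pose Q (d : nat) := `[< (0 < d)%N /\ exists s u, 0 < mass p s u /\ 0 < mass p s (u + d%:Z)%R >].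
have Q0 : exists d, Q d.
  wlog uv : u0 v0 uv0 pu0 pv0 / (u0 < v0)%R => [wl|].
    have [|vu|e] := ltgtP u0 v0; first exact: wl.
    - by apply: (wl v0 u0) => //; rewrite eq_sym.
    - by rewrite e eqxx in uv0.
  exists `|v0 - u0|%N; apply/asboolP; split; first by lia.
  exists 1%N, u0; rewrite !mass1; split => //.
  by rewrite (_ : u0 + _ = v0)%R//; lia.
case: (ex_minnP Q0) => g /asboolP[g0 [s [u [su sv]]]] gmin.
exists s, u, (u + g%:Z)%R; split => //; first by lia.
move=> n a b; wlog ab : a b / (b <= a)%R => [wl na nb|na nb].
  have [ba|ab] := leP b a; first exact: wl.
  by rewrite -opprB rpredN; apply: wl => //; exact: ltW.
rewrite (_ : u + g%:Z - u = g%:Z)%R; last by ring.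
pose k := ((a - b)%R %/ g%:Z)%Z; pose d := ((a - b)%R %% g%:Z)%Z.
have g0' : g%:Z != 0%R by rewrite gt_eqF.
have d0 : (0 <= d)%R by rewrite modz_ge0.
have dg : (d < g%:Z)%R by rewrite ltz_pmod.
have k0 : (0 <= k)%R by rewrite divz_ge0// subr_ge0.
have abE : (a - b = k * g%:Z + d)%R by exact: divz_eq.
have [dz|dn0] := eqVneq d 0%R; first exact/dvdz_mod0P.
exfalso; have : Q `|d|%N.
  apply/asboolP; split; first by rewrite absz_gt0.
  exists (n + `|k| * s)%N, (b + (u + g%:Z) * `|k|%N%:Z)%R; split.
    by apply: mass_addn_gt0 => //; exact: mass_muln_gt0.
  have -> : (b + (u + g%:Z) * `|k|%N%:Z + `|d|%N%:Z = a + u * `|k|%N%:Z)%R.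
    by rewrite !gez0_abs// -[a](subrK b) abE; ring.
  by apply: mass_addn_gt0 => //; exact: mass_muln_gt0.
by move/gmin; rewrite leqNgt => /negP; apply; lia.
Qed.

(** The probability that the walk started at [x] is at [0] after [n] steps. *)
Definition hit n x : \bar R := iter n (avg p) (delta 0%R) x.

Lemma hit_ge0 n x : 0 <= hit n x.
Proof. by apply: iter_avg_ge0 => // y; exact: delta_ge0. Qed.

Lemma hit_upper : nondegenerate ->
  exists2 C : R, (0 < C)%R & forall n x, hit n x <= (C / Num.sqrt n.+1%:R)%:E.
Proof.
move=> [u [v [uv pu pv]]].
have [r [p' [r0 r1 p'0 pE p'1]]] := split_coin p0 p1 uv pu pv.
by apply: (coin_hit_le p'0 r0 r1 pE p'1); rewrite subr_eq0 eq_sym.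
Qed.

Lemma iter_avg_mul k s f : (forall x, 0 <= f x) ->
  iter (s * k) (avg p) f = iter k (avg (mass p s)) f.
Proof.
move=> f0; elim: k => [|k IH]; first by rewrite muln0.
rewrite mulnS iterD IH iter_avg_mass//; apply: iter_avg_ge0 => //.
exact: mass_ge0.
Qed.

Lemma iter_avg_square_le (sig : R) n x :
  (0 <= sig)%R -> (forall y, avg p square y <= square y + sig%:E) ->
  iter n (avg p) square x <= (x%:~R ^+ 2 + n%:R * sig)%:E.
Proof.
move=> s0 h; elim: n x => [|n IH] x; first by rewrite /= mul0r addr0.
rewrite iterSr; apply: (le_trans (le_iter_avg p0 n h x)).
rewrite iter_avgD//; last by move=> y; exact: square_ge0.
rewrite iter_avg1// -natr1 mulrDl mul1r addrA EFinD leeD2r//; exact: IH.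
Qed.

(** The coin is extracted from the law of [s] steps, with its faces at the
    distance [g] of [atom_spacing], so that the only obstruction left is a
    congruence modulo [g]. If [x] can be reached in [m] steps and [g] divides
    [n + m], then [x] plus a sum of [n] steps is an atom of the law of [n + m]
    steps, and so it is congruent modulo [g] to [(n + m) w] for any atom [w] of
    one step, which is divisible by [g]. The starting point affects the threshold
    [K] only, not the constant [c]. *)
Lemma hit_lower (sig : R) : nondegenerate ->
  (0 <= sig)%R -> (forall y, avg p square y <= square y + sig%:E) ->
  exists2 q : nat, (0 < q)%N & exists2 c : R, (0 < c)%R &
  forall m x, 0 < mass p m x -> exists K, forall n, (K <= n)%N -> (q %| n + m)%N ->
  (c / Num.sqrt n.+1%:R)%:E <= hit n (x).
Proof.
move=> nd sig0 hsig.
have [s [u [v [uv su sv spacing]]]] := atom_spacing nd.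
have s0 : (0 < s)%N.
  have at0 w : 0 < mass p 0 w -> w = 0%R.
    by rewrite /mass /delta /= lte_fin; case: eqP => //; rewrite ltxx.
  rewrite lt0n; apply: contraTneq uv => s0; move: su sv; rewrite s0.
  by move=> /at0 -> /at0 ->; rewrite ltxx.
set g := (v - u)%R in spacing.
have g0 : (0 < g)%R by rewrite subr_gt0.
have [r [p' [r0 r1 p'0 pE p'1]]] :=
  split_coin (mass_ge0 s) (sum_mass s) (negbT (lt_eqF uv)) su sv.
(* The mean square after [k] blocks of [s] steps is about [k * (s * sig)], which
   is at most a quarter of [K * k]. *)
pose K := (4 * (s%:R * sig + 1))%R : R.
have ss0 : (0 <= s%:R * sig)%R by rewrite mulr_ge0.
have K0 : (0 < K)%R by rewrite /K; lra.
have gn0 : (v - u)%R != 0%R by rewrite gt_eqF.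
have [c c0 [n0 cP]] := coin_hit_ge p'0 r0 r1 pE p'1 gn0 K0.
exists `|g|%N; first by rewrite absz_gt0.
exists (c / 4)%R; first by rewrite divr_gt0.
move=> m x mx.
pose k0 := maxn n0.+1 (maxn (Num.trunc (x%:~R ^+ 2 + s%:R * sig : R)).+1
                            (Num.trunc (16 / r : R)).+1).
exists (s * k0)%N => n nk gnm.
pose k := (n %/ s)%N; pose t := (n %% s)%N.
have kk0 : (k0 <= k)%N by rewrite leq_divRL// mulnC.
have nE : n = (t + s * k)%N by rewrite addnC mulnC -divn_eq.
have kn : (k <= n)%N by exact: leq_div.
move: kk0; rewrite !geq_max => /and3P[kn0 kx kr].
have {kx} kx : (x%:~R ^+ 2 + s%:R * sig <= k%:R :> R)%R.
  by rewrite ltW// (lt_le_trans (truncnS_gt _))// ler_nat.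
have {kr} kr : (16 / r <= k%:R)%R.
  by rewrite ltW// (lt_le_trans (truncnS_gt _))// ler_nat.
have k1 : (0 < k)%N by apply: leq_ltn_trans kn0.
have kR : (0 < k%:R :> R)%R by rewrite ltr0n.
have sk : (0 < Num.sqrt k%:R :> R)%R by rewrite sqrtr_gt0.
set A := (c / Num.sqrt k%:R)%R.
have A0 : (0 < A)%R by rewrite divr_gt0.
have B0 : (0 <= A / (K * k%:R))%R by rewrite divr_ge0 ?(ltW A0)// mulr_ge0// ltW.
have E0 : (0 <= A * (4 / (r * k%:R)))%R.
  by rewrite mulr_ge0 ?(ltW A0)// divr_ge0// mulr_ge0// ltW.
have d0 y : 0 <= delta 0 y :> \bar R by exact: delta_ge0.
have m0 y : 0 <= multiple g y :> \bar R by exact: multiple_ge0.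
have q0 y : 0 <= square y :> \bar R by exact: square_ge0.
have fact (f : int -> \bar R) : (forall y, 0 <= f y) ->
    iter t (avg p) (iter k (avg (mass p s)) f) = iter n (avg p) f.
  by move=> f0; rewrite -iter_avg_mul// -iterD -nE.
have it0 (f : int -> \bar R) : (forall y, 0 <= f y) ->
    forall y, 0 <= iter k (avg (mass p s)) f y.
  by move=> f0; apply: iter_avg_ge0 => // y; exact: mass_ge0.
have := le_iter_avg p0 t (fun y => cP k y (ltnW kn0) k1) x.
rewrite iter_avgZ//; [|by rewrite lee_fin ltW|exact: it0].
rewrite !iter_avgD//; last 3 first.
- exact: it0.
- by move=> y; rewrite mule_ge0 ?lee_fin// it0.
- by move=> y; rewrite adde_ge0 ?mule_ge0 ?lee_fin// it0.
rewrite iter_avgZ ?lee_fin//; last exact: it0.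
rewrite iter_avg1// !fact// -/(hit n x).
have -> : iter n (avg p) (multiple g) x = 1.
  rewrite iter_avg_mass// /avg -[RHS](sum_mass n); apply: eq_esum => y _.
  have [yn|yn] := ltP 0 (mass p n y); last first.
    by rewrite (_ : mass p n y = 0) ?mul0e//; apply/eqP; rewrite eq_le mass_ge0 yn.
  have [w w1] := exists_atom 1.
  rewrite /multiple (_ : (g %| _)%Z = true) ?mule1//.
  have wn := mass_muln_gt0 (m + n) w1; rewrite muln1 in wn.
  have h := spacing _ _ _ (mass_addn_gt0 mx yn) wn.
  rewrite -[(x + y)%R](subrK (w * (m + n)%:Z)%R); apply: rpredD => //.
  by apply: dvdz_mull; rewrite addnC.
rewrite mule1 => h.
have {h} : (A * (1 / 4))%:E <= hit n x.
  have : (A / (K * k%:R))%:E * iter n (avg p) square x + (A * (4 / (r * k%:R)))%:E <=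
      (A * (3 / 4))%:E.
    apply: (@le_trans _ _ ((A / (K * k%:R) * (x%:~R ^+ 2 + n%:R * sig))%:E +
        (A * (4 / (r * k%:R)))%:E)).
      by rewrite leeD2r// [leRHS]EFinM lee_wpmul2l ?lee_fin//; exact: iter_avg_square_le.
    rewrite -EFinD lee_fin -mulrA -mulrDr ler_pM2l//.
    have e1 : (4 / (r * k%:R) <= 1 / 4)%R.
      rewrite ler_pdivrMr ?mulr_gt0//; move: kr; rewrite ler_pdivrMr//.
      by rewrite (mulrC k%:R); lra.
    have e2 : ((K * k%:R)^-1 * (x%:~R ^+ 2 + n%:R * sig) <= 1 / 2)%R.
      have Kk : (0 < K * k%:R)%R by exact: mulr_gt0.
      rewrite mulrC ler_pdivrMr//.
      have ns : (n%:R * sig <= s%:R * k%:R * sig + s%:R * sig)%R.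
        rewrite -mulrDl ler_wpM2r// -natrM -natrD ler_nat {1}nE addnC leq_add2l.
        by rewrite ltnW// ltn_pmod.
      by rewrite /K; move: ns kx ss0 kR; nra.
    by apply: (le_trans (lerD e2 e1)); lra.
  move=> h2; rewrite -addeA in h; have := le_trans h (leeD2l (hit n x) h2).
  rewrite -leeBlDr// -EFinB; apply: le_trans.
  by rewrite lee_fin -[X in (_ <= X - _)%R]mulr1 -mulrBr ler_pM2l//; lra.
apply: le_trans; rewrite lee_fin mulrAC mul1r ler_pM2r ?invr_gt0//.
rewrite ler_pM2l// lef_pV2 ?posrE ?sqrtr_gt0// ler_sqrt// ler_nat.
exact: leqW.
Qed.

End integer_walk.
(** * The coordinate laws of the step distribution *)

Section coordinate_laws.
Context {R : realType} (F : probability (lattice 3) R).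
Local Open Scope ereal_scope.

Definition i0 : 'I_3 := @Ordinal 3 0 isT.
Definition i1 : 'I_3 := @Ordinal 3 1 isT.
Definition i2 : 'I_3 := @Ordinal 3 2 isT.

Lemma ord3P (P : 'I_3 -> Prop) : P i0 -> P i1 -> P i2 -> forall i, P i.
Proof.
move=> P0 P1 P2 [[|[|[|//]]] h].
- by rewrite (_ : Ordinal h = i0)//; exact: val_inj.
- by rewrite (_ : Ordinal h = i1)//; exact: val_inj.
- by rewrite (_ : Ordinal h = i2)//; exact: val_inj.
Qed.

Definition coords (x : lattice 3) : int * int * int :=
  (entry i0 x, entry i1 x, entry i2 x).

Definition marginal (i : 'I_3) (y : int) : \bar R := F (entry i @^-1` [set y]).

Lemma marginal_ge0 i y : 0 <= marginal i y.
Proof. exact: measure_ge0. Qed.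

Lemma sum_marginal i : \esum_(y in setT) marginal i y = 1.
Proof.
rewrite -(@probability_setT _ _ _ F) (@measure_fibers _ _ _ F _ (entry i))//.
by apply: eq_esum => y _; rewrite setTI.
Qed.

Section moments.
Hypotheses (F_mean : mean_zero F) (F_var : finite_variance F).
Variable i : 'I_3.

Let X : lattice 3 -> R := entryR R i.

Let mX (f : R -> R) : measurable_fun setT (fun x => (f (X x))%:E).
Proof. by []. Qed.

Let intX2 : F.-integrable setT (fun x => ((X x) ^+ 2)%:E).
Proof.
apply/integrableP; split; first exact: (mX (fun t => t ^+ 2)%R).
have := F_var i; rewrite /variance unlock (F_mean i) unlock.
apply: le_lt_trans; rewrite le_eqVlt; apply/orP; left; apply/eqP.
apply: eq_integral => x _ /=.
by rewrite -[RHS]/(((X x - 0) * (X x - 0))%:E) subr0 -expr2 ger0_norm// sqr_ge0.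
Qed.

Let intX : F.-integrable setT (fun x => (X x)%:E).
Proof.
have i1 : F.-integrable setT (fun x => 1%:E + ((X x) ^+ 2)%:E).
  apply: integrableD => //; exact: finite_measure_integrable_cst.
apply: (le_integrable _ _ _ i1) => //.
move=> x _; rewrite -EFinD /= lee_fin [leRHS]ger0_norm ?addr_ge0 ?sqr_ge0//.
have : (0 <= (`|X x| - 1) ^+ 2)%R by rewrite sqr_ge0.
rewrite sqrrB expr1n mulr1 real_normK ?num_real// => h.
have := normr_ge0 (X x); lra.
Qed.

(** The cross term vanishes because the mean is zero, and [sig] is the variance
    of the coordinate. *)
Lemma avg_marginal_square : exists2 sig : R, (0 <= sig)%R &
  forall x, avg (marginal i) square x = square x + sig%:E.
Proof.
have X2fin : \int[F]_x ((X x) ^+ 2)%:E \is a fin_num by exact: integrable_fin_num.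
exists (fine (\int[F]_x ((X x) ^+ 2)%:E)).
  by rewrite fine_ge0// integral_ge0// => x _; rewrite lee_fin sqr_ge0.
move=> x; rewrite fineK//.
have -> : avg (marginal i) square x = \int[F]_z square (x + entry i z)%R.
  rewrite (@ge0_integral_law _ _ _ F _ (entry i) _ (fun y => square (x + y)%R))//.
  by move=> y; exact: square_ge0.
have Xx : F.-integrable setT (fun z => (2 * x%:~R)%:E * (X z)%:E).
  exact: integrableZl.
have cx : F.-integrable setT (fun _ => (x%:~R ^+ 2 : R)%:E).
  exact: finite_measure_integrable_cst.
transitivity (\int[F]_z ((x%:~R ^+ 2)%:E + ((2 * x%:~R)%:E * (X z)%:E + ((X z) ^+ 2)%:E))).
  apply: eq_integral => z _; rewrite /square /X /entryR intrD.
  by rewrite -EFinM -!EFinD; congr EFin; ring.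
rewrite integralD//; last exact: integrableD.
rewrite integralD// integralZl//.
have -> : \int[F]_z (X z)%:E = 0 by have := F_mean i; rewrite unlock.
rewrite mule0 add0e integral_cst//.
congr (_ + _); rewrite -[RHS]mule1; congr (_ * _); exact: probability_setT.
Qed.

(** The step is not supported in a hyperplane [x_i = 0], and a step with mean
    zero and a single atom would be supported there. *)
Lemma marginal_nondegenerate : truly_dimensional F -> nondegenerate (marginal i).
Proof.
move=> F_dim; have [sig sig0 sq] := avg_marginal_square.
have p0 := marginal_ge0 i.
pose V : {vspace 'rV[R]_3} := lker (linfun (mulmxr (delta_mx i ord0 : 'M[R]_(3, 1)))).
have VE (v : 'rV[R]_3) : (v \in V) = (v ord0 i == 0%R).
  rewrite memv_ker lfunE /=; apply/eqP/eqP => [/matrixP/(_ ord0 ord0)|v0].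
    rewrite !mxE (bigD1 i)//= mxE !eqxx mulr1 big1 ?addr0// => j ji.
    by rewrite mxE (negbTE ji) mulr0.
  apply/matrixP => a b; rewrite !mxE !ord1 (bigD1 i)//= mxE !eqxx mulr1 v0 add0r.
  by rewrite big1// => j ji; rewrite mxE (negbTE ji) mulr0.
have Vn : V != fullv.
  apply/eqP => VT; have := memvf (delta_mx ord0 i : 'rV[R]_3).
  by rewrite -VT VE mxE !eqxx oner_eq0.
have /eqP p1 := F_dim _ Vn.
have {}p1 : marginal i 0%R <> 1.
  rewrite /marginal => h; apply: p1; rewrite -h; congr (F _).
  apply/seteqP; split => x /=; rewrite VE mxE /entry.
    by rewrite intr_eq0 => /eqP.
  by move=> ->.
have [u u0 pu] : exists2 u, u != 0%R & 0 < marginal i u.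
  apply: contrapT => /forall2NP h; apply: p1.
  rewrite -(sum_marginal i) (@esum_single _ _ _ 0%R)// => j j0.
  by have [//|/negP] := h j; rewrite -leNgt => jle; apply/eqP; rewrite eq_le jle p0.
apply: contrapT => h.
have pz y : y != u -> marginal i y = 0.
  move=> yu; apply/eqP; rewrite eq_le p0 andbT leNgt; apply/negP => py.
  by apply: h; exists y, u.
have := sq (- u)%R; rewrite /avg esum1; last first.
  move=> y _; have [->|/pz ->] := eqVneq y u; last by rewrite mul0e.
  by rewrite addNr /square expr0n /= mule0.
rewrite /square -EFinD => -[] /esym/eqP; rewrite gt_eqF//.
by rewrite ltr_wpDr// lt0r sqr_ge0 sqrf_eq0 intr_eq0 oppr_eq0 u0.
Qed.

End moments.

Hypothesis F_indep : independent_coordinates F.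

Lemma law_coords12 (a b : int) :
  F [set z | entry i0 z = a /\ entry i1 z = b] = marginal i0 a * marginal i1 b.
Proof.
have := F_indep (i0 |` [fset i1])%fset
  (A := fun i => if i == i0 then [set a] else [set b]) (fun=> I).
rewrite big_fsetU1 ?inE//= big_seq_fset1 /= /marginal => <-.
congr (F _); apply/seteqP; split => z /=.
  move=> [za zb]; apply: ord3P; rewrite !inE//=.
by move=> h; split; [have := h i0|have := h i1]; rewrite !inE//=; apply.
Qed.

Lemma law_coords (a b c : int) :
  F (coords @^-1` [set (a, b, c)]) = marginal i0 a * marginal i1 b * marginal i2 c.
Proof.
have := F_indep (i0 |` (i1 |` [fset i2]))%fset
  (A := fun i => if i == i0 then [set a] else if i == i1 then [set b] else [set c])
  (fun=> I).
rewrite !big_fsetU1 ?inE//= big_seq_fset1 /= /marginal muleA => <-.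
congr (F _); apply/seteqP; split => z /=.
  by move=> [za zb zc]; apply: ord3P.
move=> h; rewrite /coords.
have -> : entry i0 z = a by have := h i0; rewrite !inE//=; apply.
have -> : entry i1 z = b by have := h i1; rewrite !inE//=; apply.
by have -> : entry i2 z = c by have := h i2; rewrite !inE//=; apply.
Qed.

Lemma law_first_coords (a b c : int) :
  F (first_coords 2 @^-1` (coords @^-1` [set (a, b, c)])) =
  marginal i0 a * marginal i1 b * delta 0%R c.
Proof.
have fE z : coords (first_coords 2 z) = (entry i0 z, entry i1 z, 0%R).
  by rewrite /coords /first_coords /entry !mxE.
rewrite /delta; have [->|c0] := eqVneq c 0%R.
  rewrite mule1 -law_coords12; congr (F _); apply/seteqP; split => z /=.
    by rewrite fE => -[-> ->].
  by rewrite fE => -[-> ->].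
rewrite mule0 (_ : _ @^-1` _ = set0) ?measure0//.
apply/seteqP; split => // z /=; rewrite fE => -[_ _ /eqP].
by rewrite eq_sym (negbTE c0).
Qed.

End coordinate_laws.

(** * Product functions *)

Section tensor.
Context {R : realType}.
Local Open Scope ereal_scope.
Implicit Types f h : int -> \bar R.

Definition tensor f0 f1 f2 (c : int * int * int) : \bar R :=
  f0 c.1.1 * f1 c.1.2 * f2 c.2.

Lemma esum_tensor f0 f1 f2 : (forall y, 0 <= f0 y) -> (forall y, 0 <= f1 y) ->
  (forall y, 0 <= f2 y) ->
  \esum_(c in setT) tensor f0 f1 f2 c =
  (\esum_(y in setT) f0 y) * (\esum_(y in setT) f1 y) * (\esum_(y in setT) f2 y).
Proof.
move=> f00 f10 f20.
rewrite -(@esum_pair R _ _ (fun ab c => f0 ab.1 * f1 ab.2 * f2 c)); last first.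
  by move=> *; rewrite !mule_ge0.
transitivity (\esum_(ab in [set: int * int])
    f0 ab.1 * f1 ab.2 * \esum_(y in setT) f2 y).
  by apply: eq_esum => ab _; rewrite ge0_esumZl// mule_ge0.
rewrite ge0_esumZr ?esum_ge0//; last by move=> *; rewrite mule_ge0.
congr (_ * _); rewrite -(@esum_pair R _ _ (fun a b => f0 a * f1 b)); last first.
  by move=> *; rewrite mule_ge0.
rewrite -ge0_esumZr ?esum_ge0//; apply: eq_esum => a _.
by rewrite ge0_esumZl.
Qed.

Lemma avg_tensor q0 q1 q2 f0 f1 f2 (x y z : int) :
  (forall y, 0 <= q0 y) -> (forall y, 0 <= q1 y) -> (forall y, 0 <= q2 y) ->
  (forall y, 0 <= f0 y) -> (forall y, 0 <= f1 y) -> (forall y, 0 <= f2 y) ->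
  \esum_(c in setT) tensor q0 q1 q2 c *
     tensor f0 f1 f2 (x + c.1.1, y + c.1.2, z + c.2)%R =
  tensor (avg q0 f0) (avg q1 f1) (avg q2 f2) (x, y, z).
Proof.
move=> q00 q10 q20 f00 f10 f20; rewrite /tensor /avg /= -esum_tensor.
- apply: eq_esum => -[[a b] c] _; rewrite /tensor /=.
  by rewrite muleACA; congr (_ * _); rewrite muleACA.
- by move=> *; rewrite mule_ge0.
- by move=> *; rewrite mule_ge0.
- by move=> *; rewrite mule_ge0.
Qed.

End tensor.
(** * Counting the special steps *)

Section special_steps.
Context (a : nat -> nat).
Hypothesis (a_pos : forall n, (0 < n)%N -> (0 < a n)%N).
Hypothesis (a_incr : forall m n, (0 < m)%N -> (m < n)%N -> (a m < a n)%N).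

(** The [k]-th step is the one from time [k] to time [k.+1]. *)
Definition special (k : nat) : Prop := exists2 n, (0 < n)%N & a n = k.+1.

Definition specials k : nat := (\sum_(i < k) `[< special i >])%N.

Lemma specials0 : specials 0 = 0%N. Proof. by rewrite /specials big_ord0. Qed.

Lemma specialsS k : specials k.+1 = (specials k + `[< special k >])%N.
Proof. by rewrite /specials big_ord_recr. Qed.

Lemma a_leq m n : (0 < m)%N -> (m <= n)%N -> (a m <= a n)%N.
Proof.
by move=> m0; rewrite leq_eqVlt => /orP[/eqP ->//|mn]; exact/ltnW/a_incr.
Qed.

Lemma a_ge_id n : (0 < n)%N -> (n <= a n)%N.
Proof.
case: n => // n _; elim: n => [|n IH]; first exact: a_pos.
by apply: leq_ltn_trans IH _; exact: a_incr.
Qed.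

Lemma specials_block k :
  (k < a (specials k).+1)%N && ((0 < specials k)%N ==> (a (specials k) <= k)%N).
Proof.
elim: k => [|k /andP[IH1 /implyP IH2]].
  by rewrite specials0 a_pos.
rewrite specialsS; case: asboolP => [[n n0 an]|nsp] /=.
  suff nE : n = (specials k).+1.
    by rewrite addn1 -nE an leqnn implybT andbT -an a_incr.
  apply/eqP; rewrite eqn_leq; apply/andP; split; rewrite leqNgt; apply/negP => h.
    by have := a_incr (ltn0Sn _) h; rewrite an ltnS leqNgt IH1.
  have s0 : (0 < specials k)%N by lia.
  have : (a n <= a (specials k))%N by apply: a_leq => //.
  by rewrite an => /leq_trans/(_ (IH2 s0)); rewrite ltnn.
rewrite addn0; apply/andP; split; last by apply/implyP => /IH2/leqW.
rewrite ltn_neqAle IH1 andbT; apply/negP => /eqP h; apply: nsp.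
by exists (specials k).+1.
Qed.

Lemma specials_bounds l : (a 1 <= l)%N ->
  [/\ (0 < specials l)%N, (a (specials l) <= l)%N & (l < a (specials l).+1)%N].
Proof.
move=> a1l; have /andP[h1 /implyP h2] := specials_block l.
have n0 : (0 < specials l)%N.
  by rewrite lt0n; apply: contraTneq a1l => n0; rewrite -ltnNge; rewrite n0 in h1.
by split => //; exact: h2.
Qed.

Lemma specialsE n k : (0 < n)%N -> (a n <= k)%N -> (k < a n.+1)%N -> specials k = n.
Proof.
move=> n0 ank kan; have /andP[h1 /implyP h2] := specials_block k.
apply/eqP; rewrite eqn_leq; apply/andP; split; rewrite leqNgt; apply/negP => h.
  have : (a n.+1 <= a (specials k))%N by exact: a_leq.
  by move=> /leq_trans/(_ (h2 (leq_ltn_trans (leq0n _) h))); rewrite leqNgt kan.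
have : (a (specials k).+1 <= a n)%N by exact: a_leq.
by move=> /leq_trans/(_ ank); rewrite leqNgt h1.
Qed.

Lemma specials_le j k : (j <= k)%N -> (specials j <= specials k)%N.
Proof.
by move=> /subnK <-; elim: (k - j)%N => //= n IH; rewrite addSn specialsS (leq_trans IH)// leq_addr.
Qed.

End special_steps.

(** * The Markov property *)

Definition increments (T : Type) (S : nat -> T -> lattice 3) k (w : T) : seq 'rV[int]_3 :=
  [seq increment S i w | i <- iota 0 k].

Arguments increments : simpl never.

Lemma incrementsS (T : Type) (S : nat -> T -> lattice 3) k (w : T) :
  increments S k.+1 w = rcons (increments S k w) (increment S k w).
Proof. by rewrite /increments -[k.+1]addn1 iotaD map_cat /= cats1. Qed.

Lemma size_increments (T : Type) (S : nat -> T -> lattice 3) k (w : T) :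
  size (increments S k w) = k.
Proof. by rewrite size_map size_iota. Qed.

Lemma nth_increments (T : Type) (S : nat -> T -> lattice 3) k i (w : T) :
  (i < k)%N -> nth 0 (increments S k w) i = increment S i w.
Proof. by move=> ik; rewrite (nth_map 0%N) ?size_iota// nth_iota. Qed.

Section markov.
Context {R : realType} (F : probability (lattice 3) R).
Hypothesis F_indep : independent_coordinates F.
Context (a : nat -> nat) {dT : measure_display} {T : measurableType dT}.
Context (P : probability T R) (S : nat -> {RV P >-> lattice 3}).
Hypothesis S_walk : walk_in_varying_dimension 2 F a S.
Local Open Scope ereal_scope.

Local Notation inc k := (increment S k : T -> 'rV[int]_3).
Local Notation incs := (increments S).

(** The sigma-algebra generated by the walk up to time [k]; since the walk has
    countably many paths up to that time, measurability is automatic, see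
    [past_measurable]. *)
Definition past k (E : set T) :=
  forall w w', (forall i, (i <= k)%N -> S i w = S i w') -> E w -> E w'.

Lemma measurable_S k (A : set (lattice 3)) : measurable (S k @^-1` A).
Proof. by rewrite -[X in measurable X]setTI; exact: measurable_funPT. Qed.

Let measurable_inc k A : measurable (inc k @^-1` A).
Proof.
pose X w : 'rV[int]_3 * 'rV[int]_3 := (S k.+1 w, S k w).
have mX c : measurable (X @^-1` [set c]).
  have -> : X @^-1` [set c] = S k.+1 @^-1` [set c.1] `&` S k @^-1` [set c.2].
    by apply/seteqP; split => w /=; case: c => c1 c2; [move=> [-> ->]|move=> /= [<- <-]].
  by apply: measurableI; exact: measurable_S.
exact: (measurable_discrete mX [set c | A (c.1 - c.2)%R]).
Qed.

Let J (k : nat) := seq_fset tt (iota 0 k).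

Let inJ k i : (i \in J k) = (i < k)%N.
Proof. by rewrite seq_fsetE mem_iota. Qed.

Let incs_cylinder k s (A : set 'rV[int]_3) : size s = k ->
  incs k @^-1` [set s] `&` inc k @^-1` A =
  [set w | forall i, i \in J k.+1 ->
    (if (i < k)%N then [set nth 0%R s i] else A) (inc i w)].
Proof.
move=> sk; apply/seteqP; split => w /=.
  move=> [<- Ak] i; rewrite inJ ltnS leq_eqVlt => /predU1P[->|ik]; first by rewrite ltnn.
  by rewrite ik (nth_map 0%N) ?size_iota// nth_iota.
move=> h; split; last first.
  by have := h k; rewrite inJ ltnn; apply.
apply: (@eq_from_nth _ 0%R); rewrite size_increments// => i ik.
rewrite nth_increments//.
by have := h i; rewrite inJ ltnS (ltnW ik) ik; apply.
Qed.

Let measurable_incs k s : measurable (incs k @^-1` [set s]).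
Proof.
elim: k s => [|k IH] s.
  have [->|s0] := eqVneq s [::].
    by rewrite (_ : _ @^-1` _ = setT)//; apply/seteqP; split.
  rewrite (_ : _ @^-1` _ = set0)//; apply/seteqP; split => // w /= /esym/eqP.
  by rewrite (negbTE s0).
case/lastP: s => [|s y].
  by rewrite (_ : _ @^-1` _ = set0)//; apply/seteqP; split.
rewrite (_ : _ @^-1` _ = incs k @^-1` [set s] `&` inc k @^-1` [set y]).
  exact: measurableI.
apply/seteqP; split => w /=; rewrite incrementsS; last by move=> [-> ->].
by move/rcons_inj => [-> ->].
Qed.

Let indep_incs k s A :
  P (incs k @^-1` [set s] `&` inc k @^-1` A) =
  P (incs k @^-1` [set s]) * P (inc k @^-1` A).
Proof.
have [sk|sk] := eqVneq (size s) k; last first.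
  rewrite (_ : incs k @^-1` [set s] = set0) ?set0I ?measure0 ?mul0e//.
  apply/seteqP; split => // w /= ws; move: sk.
  by rewrite -ws size_increments eqxx.
pose B (D : set (lattice 3)) i := if (i < k)%N then [set nth 0%R s i] else D.
have prodE (D : set (lattice 3)) : P (incs k @^-1` [set s] `&` inc k @^-1` D) =
    (\prod_(i <- iota 0 k) P (inc i @^-1` [set nth 0%R s i])) * P (inc k @^-1` D).
  rewrite (incs_cylinder _ sk).
  rewrite (walk_independent S_walk (J k.+1) (A := B D) (fun=> I)).
  rewrite (perm_big (iota 0 k.+1)); last first.
    apply: uniq_perm; rewrite ?fset_uniq ?iota_uniq// => i.
    by rewrite inJ mem_iota.
  rewrite -[in iota _ k.+1]addn1 iotaD big_cat /= big_seq1 add0n /B ltnn.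
  congr (_ * _); rewrite big_seq [RHS]big_seq; apply: eq_bigr => i.
  by rewrite mem_iota add0n => /andP[_ ->].
rewrite prodE -[incs k @^-1` _]setIT -[X in _ `&` X](preimage_setT (inc k)).
by rewrite prodE preimage_setT probability_setT mule1.
Qed.

Let walk_eq k w w' : incs k w = incs k w' ->
  forall i, (i <= k)%N -> S i w = S i w'.
Proof.
move=> ww'; elim=> [|i IH] ik; first by rewrite !(walk_start S_walk).
have /(congr1 (fun s => nth 0%R s i)) := ww'.
rewrite !nth_increments// /increment.
by rewrite (IH (ltnW ik)) => /(@addIr (lattice 3)).
Qed.

Let past_incs k E w : past k E -> E w -> incs k @^-1` [set incs k w] `<=` E.
Proof. by move=> Ek Ew w' /= ww'; apply: Ek Ew; apply: walk_eq. Qed.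

Lemma past_measurable k E : past k E -> measurable E.
Proof.
move=> Ek; rewrite (_ : E = incs k @^-1` (incs k @` E)).
  exact: measurable_discrete (measurable_incs k) _.
apply/seteqP; split => [w Ew|w [w' Ew' /esym ww']]; first by exists w.
exact: past_incs Ek Ew' _ ww'.
Qed.

Let past_indep k E A : past k E -> P (E `&` inc k @^-1` A) = P E * P (inc k @^-1` A).
Proof.
move=> Ek; have mE := past_measurable Ek.
rewrite (measure_fibers P (measurable_incs k) (measurableI _ _ mE (measurable_inc k A))).
rewrite [in RHS](measure_fibers P (measurable_incs k) mE) -ge0_esumZr//.
apply: eq_esum => s _; have [[w [Ew ws]]|h] := pselect (exists w, E w /\ incs k w = s).
  have sE : incs k @^-1` [set s] `<=` E by rewrite -ws; exact: past_incs.
  by rewrite setIAC (setIidr sE); exact: indep_incs.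
have Es : E `&` incs k @^-1` [set s] = set0.
  by apply/seteqP; split => // w [Ew /= ws]; apply: h; exists w.
by rewrite setIAC Es set0I measure0 mul0e.
Qed.

Lemma past_le j k E : (j <= k)%N -> past j E -> past k E.
Proof. by move=> jk Ej w w' ww'; apply: Ej => i /leq_trans/(_ jk)/ww'. Qed.

Lemma pastI k E E' : past k E -> past k E' -> past k (E `&` E').
Proof. by move=> h h' w w' ww' [/(h _ _ ww') ? /(h' _ _ ww') ?]. Qed.

Lemma past_S j k (A : set (lattice 3)) : (j <= k)%N -> past k (S j @^-1` A).
Proof. by move=> jk w w' /(_ _ jk) /= ->. Qed.

(** The law of the third coordinate of the step from time [k] to [k.+1]. *)
Let third k : int -> \bar R := if `[< special a k >] then marginal F i2 else delta 0%R.

Let law_inc k c : P (inc k @^-1` (coords @^-1` [set c])) =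
  tensor (marginal F i0) (marginal F i1) (third k) c.
Proof.
rewrite /third /tensor; case: c => [[x y] z] /=; case: asboolP => sk.
  by rewrite (walk_special_law S_walk sk) law_coords.
by rewrite (walk_regular_law S_walk sk) law_first_coords.
Qed.

Let third_ge0 k y : 0 <= third k y.
Proof. by rewrite /third; case: ifP => _; [exact: marginal_ge0|exact: delta_ge0]. Qed.

Let avg_third k f : (forall x, 0 <= f x) ->
  avg (third k) f = iter `[< special a k >] (avg (marginal F i2)) f.
Proof.
move=> f0; rewrite /third; case: asboolP => // _; apply/funext => x.
rewrite /avg (@esum_single _ _ _ 0%R)//=.
- by rewrite /delta eqxx mul1e addr0.
- by rewrite mule_ge0// delta_ge0.
- by move=> y y0; rewrite /delta (negbTE y0) mul0e.
Qed.

(** Given the walk up to time [k], the three coordinates of the walk move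
    independently, the third one at the special steps only. *)
Lemma markov k n E x (f0 f1 f2 : int -> \bar R) :
  past k E -> E `<=` S k @^-1` [set x] ->
  (forall y, 0 <= f0 y) -> (forall y, 0 <= f1 y) -> (forall y, 0 <= f2 y) ->
  \int[P]_(w in E) tensor f0 f1 f2 (coords (S (k + n)%N w)) =
  P E * tensor (iter n (avg (marginal F i0)) f0) (iter n (avg (marginal F i1)) f1)
    (iter (specials a (k + n) - specials a k) (avg (marginal F i2)) f2) (coords x).
Proof.
move=> Ek Ex f00 f10 f20; elim: n k E x Ek Ex => [|n IH] k E x Ek Ex.
  have mE := past_measurable Ek; rewrite addn0 subnn /=.
  rewrite (eq_integral (cst (tensor f0 f1 f2 (coords x)))).
    by rewrite integral_cst// muleC.
  by move=> w; rewrite inE => /Ex /= ->.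
have mE := past_measurable Ek.
have mX c : measurable ((coords \o increment S k) @^-1` [set c]).
  by rewrite comp_preimage; exact: measurable_inc.
have m0 := marginal_ge0 F.
rewrite (ge0_integral_fibers P mX mE); last 2 first.
- move=> _ Y mY; apply: measurableI => //.
  exact: (measurable_S _ ((tensor f0 f1 f2 \o coords) @^-1` Y)).
- by move=> w _; rewrite /tensor !mule_ge0.
pose x' (c : int * int * int) : lattice 3 :=
  \row_i (entry i x + [:: c.1.1; c.1.2; c.2]`_i)%R.
have cx' c : coords (x' c) = (entry i0 x + c.1.1, entry i1 x + c.1.2, entry i2 x + c.2)%R.
  by rewrite /coords /entry /x' !mxE.
transitivity (\esum_(c in setT) P E * (tensor (marginal F i0) (marginal F i1) (third k) c *
    tensor (iter n (avg (marginal F i0)) f0) (iter n (avg (marginal F i1)) f1)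
    (iter (specials a (k.+1 + n) - specials a k.+1) (avg (marginal F i2)) f2)
    (entry i0 x + c.1.1, entry i1 x + c.1.2, entry i2 x + c.2)%R)).
  apply: eq_esum => c _.
  set E' := E `&` _.
  have E'k : past k.+1 E'.
    move=> w w' ww' [Ew Ic]; split; first by apply: Ek Ew => i /leqW/ww'.
    by move: Ic; rewrite /preimage /= /increment !ww'.
  have E'x : E' `<=` S k.+1 @^-1` [set x' c].
    move=> w [/Ex /= Sx /= <-]; apply/rowP => i; rewrite !mxE.
    move: i; apply: ord3P => /=; rewrite /increment /entry !mxE Sx; ring.
  rewrite -addSnnS (IH _ _ _ E'k E'x) cx' [RHS]muleA; congr (_ * _).
  rewrite /E' comp_preimage -law_inc.
  exact: past_indep.
rewrite ge0_esumZl//; last first.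
  by move=> c _; rewrite /tensor !mule_ge0// ?third_ge0 ?iter_avg_ge0.
congr (_ * _); rewrite avg_tensor//; last 3 first.
- by move=> y; exact: iter_avg_ge0.
- by move=> y; exact: iter_avg_ge0.
- by move=> y; exact: iter_avg_ge0.
rewrite (avg_third _ (iter_avg_ge0 (m0 i2) _ f20)).
rewrite -iterD specialsS addSnnS.
have le : (specials a k.+1 <= specials a (k + n.+1))%N.
  by apply: specials_le; rewrite -addSnnS leq_addr.
rewrite (_ : (`[< special a k >] + _)%N = (specials a (k + n.+1) - specials a k)%N)//.
by move: le; rewrite specialsS; case: asboolP => _ /=; lia.
Qed.

End markov.
(** * Hitting probabilities of the walk *)

Section hitting.
Context {R : realType} (F : probability (lattice 3) R).
Hypothesis F_indep : independent_coordinates F.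
Context (a : nat -> nat) {dT : measure_display} {T : measurableType dT}.
Context (P : probability T R) (S : nat -> {RV P >-> lattice 3}).
Hypothesis S_walk : walk_in_varying_dimension 2 F a S.

(** The return probabilities of the three coordinate walks. *)
Definition ret (i : 'I_3) n y : R := fine (hit (marginal F i) n y).

Lemma hitE i n y : hit (marginal F i) n y = (ret i n y)%:E.
Proof.
have m0 := marginal_ge0 F i; have m1 := sum_marginal F i.
rewrite fineK// ge0_fin_numE ?hit_ge0//; apply: (@le_lt_trans _ _ 1%E); last exact: ltry.
have /(congr1 (@^~ y)) <- := iter_avg1 m0 m1 n (@lee01 R).
by apply: le_iter_avg => // x; rewrite lee_fin lern1 leq_b1.
Qed.

Lemma ret_ge0 i n y : 0 <= ret i n y.
Proof. by rewrite -lee_fin -hitE hit_ge0//; exact: marginal_ge0. Qed.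

Lemma ret0 i : ret i 0 0 = 1.
Proof. by []. Qed.

Lemma entry0 (i : 'I_3) : entry i (0 : lattice 3) = 0.
Proof. by rewrite /entry mxE. Qed.

Definition at_zero k : set T := S k @^-1` [set 0].
Definition plane_zero k : set T := [set w | entry i0 (S k w) = 0 /\ entry i1 (S k w) = 0].
Definition height_zero k : set T := [set w | entry i2 (S k w) = 0].

Lemma latticeP (x y : lattice 3) : coords x = coords y -> x = y.
Proof.
move=> [h0 h1 h2]; apply/rowP => i; move: i; exact: ord3P.
Qed.

Local Open Scope ereal_scope.

Lemma markov_set k l E x (A : set T) (f0 f1 f2 : int -> \bar R) : (k <= l)%N ->
  past S k E -> E `<=` S k @^-1` [set x] -> measurable A ->
  (forall y, 0 <= f0 y) -> (forall y, 0 <= f1 y) -> (forall y, 0 <= f2 y) ->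
  (forall w, tensor f0 f1 f2 (coords (S l w)) = (\1_A w)%:E) ->
  P (E `&` A) = P E * tensor (iter (l - k) (avg (marginal F i0)) f0)
    (iter (l - k) (avg (marginal F i1)) f1)
    (iter (specials a l - specials a k) (avg (marginal F i2)) f2) (coords x).
Proof.
move=> kl Ek Ex mA f00 f10 f20 fA; have mE := past_measurable S_walk Ek.
rewrite -{3}(subnKC kl) -(markov F_indep S_walk _ Ek Ex f00 f10 f20) subnKC//.
under eq_integral do rewrite fA.
by rewrite integral_indic// setIC.
Qed.

Lemma delta_tensor w l (y : lattice 3) :
  tensor (delta (entry i0 y)) (delta (entry i1 y)) (delta (entry i2 y)) (coords (S l w)) =
  (\1_(S l @^-1` [set y]) w)%:E :> \bar R.
Proof.
rewrite /tensor /delta -!EFinM indicE; congr EFin; rewrite -!natrM !mulnb; congr (_ : bool)%:R.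
apply/idP/idP => [/andP[/andP[/eqP h0 /eqP h1] /eqP h2]|].
  by rewrite inE /=; apply: latticeP; rewrite /coords -h0 -h1 -h2.
by rewrite inE /= => ->; rewrite !eqxx.
Qed.

Lemma markov_zero k l E x : (k <= l)%N -> past S k E -> E `<=` S k @^-1` [set x] ->
  P (E `&` at_zero l) = P E * (ret i0 (l - k) (entry i0 x) * ret i1 (l - k) (entry i1 x) *
     ret i2 (specials a l - specials a k) (entry i2 x))%:E.
Proof.
move=> kl Ek Ex.
rewrite (markov_set kl Ek Ex (measurable_S S _ _) _ _ _ (fun w => delta_tensor w l 0%R));
  try by move=> y; exact: delta_ge0.
by rewrite !entry0 /tensor /= -/(hit _ _ _) -!/(hit _ _ _) !hitE.
Qed.

Lemma markov_plane k l E x : (k <= l)%N -> past S k E -> E `<=` S k @^-1` [set x] ->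
  P (E `&` plane_zero l) =
  P E * (ret i0 (l - k) (entry i0 x) * ret i1 (l - k) (entry i1 x))%:E.
Proof.
move=> kl Ek Ex; rewrite (@markov_set k l E x _ (delta 0%R) (delta 0%R) (fun=> 1))//.
- rewrite /tensor (iter_avg1 (marginal_ge0 F i2) (sum_marginal F i2))// mule1 /=.
  by rewrite -!/(hit _ _ _) !hitE.
- exact: (measurable_S S l [set x | entry i0 x = 0%R /\ entry i1 x = 0%R]).
- exact: delta_ge0.
- exact: delta_ge0.
- move=> w; rewrite /tensor /delta mule1 -EFinM indicE -natrM mulnb.
  congr (_ : bool)%:R%:E; apply/andP/idP => [[/eqP h0 /eqP h1]|].
    by rewrite inE.
  by rewrite inE => -[/= -> ->].
Qed.

Lemma reachable m x : 0 < P (S m @^-1` [set x]) ->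
  [/\ 0 < mass (marginal F i0) m (entry i0 x), 0 < mass (marginal F i1) m (entry i1 x) &
      0 < mass (marginal F i2) (specials a m) (entry i2 x)].
Proof.
have pT : past S 0 [set: T] by [].
have S0 : [set: T] `<=` S 0 @^-1` [set 0%R] by move=> w _; exact: (walk_start S_walk).
rewrite -[X in P X]setTI.
rewrite (markov_set (leq0n m) pT S0 (measurable_S S _ _) _ _ _
   (fun w => delta_tensor w m x)); try by move=> y; exact: delta_ge0.
rewrite probability_setT mul1e subn0 specials0 subn0 /tensor /= !entry0.
rewrite -!/(mass _ _ _).
have := mass_ge0 (marginal_ge0 F i0) m (entry i0 x).
have := mass_ge0 (marginal_ge0 F i1) m (entry i1 x).
have := mass_ge0 (marginal_ge0 F i2) (specials a m) (entry i2 x).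
rewrite !le_eqVlt => /predU1P[<-|->]; first by rewrite mule0 ltxx.
move=> /predU1P[<-|->]; first by rewrite mule0 mul0e ltxx.
by move=> /predU1P[<-|->]; first by rewrite !mul0e ltxx.
Qed.

(** Given the position at time [k], the plane walk from then on does not see the
    height. *)
Lemma plane_height k l : (k <= l)%N -> P (height_zero k `&` plane_zero l) =
  (ret i0 l 0 * ret i1 l 0 * ret i2 (specials a k) 0)%:E.
Proof.
move=> kl.
have mX c : measurable ((coords \o S k) @^-1` [set c]).
  by rewrite comp_preimage; exact: measurable_S.
have mh : measurable (height_zero k) := measurable_S S k [set x | entry i2 x = 0%R].
have mp : measurable (plane_zero l) :=
  measurable_S S l [set x | entry i0 x = 0%R /\ entry i1 x = 0%R].
rewrite (measure_fibers P mX (measurableI _ _ mh mp)).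
transitivity (\esum_(c in setT) P ((coords \o S k) @^-1` [set c]) *
   tensor (hit (marginal F i0) (l - k)) (hit (marginal F i1) (l - k)) (delta 0%R) c).
  apply: eq_esum => -[[x y] z] _; rewrite /tensor /delta /=.
  have [->|z0] := eqVneq z 0%R; last first.
    rewrite !mule0 (_ : _ `&` _ = set0) ?measure0//.
    apply/seteqP; split => // w [[/= h _]] [_ _ zE].
    by move: z0; rewrite -zE h eqxx.
  rewrite mule1; pose xx : lattice 3 := \row_i [:: x; y; 0%R]`_i.
  have cxx : coords xx = (x, y, 0%R) by rewrite /coords /entry /xx !mxE.
  have hx : (coords \o S k) @^-1` [set (x, y, 0%R)] = S k @^-1` [set xx].
    apply/seteqP; split => w /=; first by rewrite -cxx => /latticeP.
    by move=> ->.
  rewrite hx setIAC [height_zero k `&` _](_ : _ = S k @^-1` [set xx]); last first.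
    apply: setIidr => w /= wx; rewrite /height_zero /= wx.
    by have [] := cxx.
  rewrite (@markov_plane k l _ xx)//; last exact: past_S.
  by have [-> ->] := cxx; rewrite !hitE.
have h0 := hit_ge0 (marginal_ge0 F i0); have h1 := hit_ge0 (marginal_ge0 F i1).
have t0 c : 0 <= tensor (hit (marginal F i0) (l - k)) (hit (marginal F i1) (l - k))
    (delta 0%R) c by rewrite /tensor !mule_ge0// delta_ge0.
rewrite -(ge0_integral_law P mX t0).
have pT : past S 0 [set: T] by [].
have S0 : [set: T] `<=` S 0 @^-1` [set 0%R] by move=> w _; exact: (walk_start S_walk).
have := markov F_indep S_walk k pT S0 (h0 (l - k)%N) (h1 (l - k)%N) (delta_ge0 0%R).
rewrite add0n /= => ->; rewrite probability_setT mul1e specials0 subn0 /tensor /=.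
by rewrite !entry0 /hit -!iterD subnKC// -!/(hit _ _ _) !hitE.
Qed.

End hitting.
(** * First visits *)

Section first_visits.
Context {R : realType} (F : probability (lattice 3) R).
Hypothesis F_indep : independent_coordinates F.
Context (a : nat -> nat) {dT : measure_display} {T : measurableType dT}.
Context (P : probability T R) (S : nat -> {RV P >-> lattice 3}).
Hypothesis S_walk : walk_in_varying_dimension 2 F a S.

Definition visit s n : set T := [set w | exists2 i, (i < n)%N & S (s + i)%N w = 0].

Definition first_visit s i : set T :=
  [set w | S (s + i)%N w = 0 /\ forall j, (j < i)%N -> S (s + j)%N w <> 0].

Lemma past_first_visit s i : past S (s + i) (first_visit s i).
Proof.
move=> w w' ww' [h0 h]; split; first by rewrite -ww'.
by move=> j ji; rewrite -ww' ?leq_add2l 1?ltnW//; exact: h.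
Qed.

Lemma visitE s n : visit s n = \big[setU/set0]_(i < n) first_visit s i.
Proof.
rewrite -bigcup_mkord; apply/seteqP; split => [w|w [i /= ni [h _]]]; last by exists i.
elim: n => [[i //]|n IH] [i ni Si].
have [[j jn Sj]|h] := pselect (visit s n w).
  by have [|k kn Sk] := IH; [exists j|exists k => //; exact: leqW].
have iE : i = n.
  apply/eqP; rewrite eqn_leq -ltnS ni leqNgt /=; apply/negP => lt.
  by apply: h; exists i.
exists n => /=; first exact: ltnSn.
by split; [rewrite -iE|move=> j jn Sj; apply: h; exists j].
Qed.

Lemma trivIset_first_visit s : trivIset setT (first_visit s).
Proof.
apply/trivIsetP => i j _ _; wlog ij : i j / (i < j)%N => [wl|_].
  by case: (ltngtP i j) => // h _; [|rewrite setIC]; apply: wl => //; rewrite ltn_eqF.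
by apply/seteqP; split => // w [[Si _] [_ /(_ _ ij)]].
Qed.

Lemma measurable_first_visit s i : measurable (first_visit s i).
Proof. exact: (past_measurable S_walk (@past_first_visit s i)). Qed.

Definition pr (A : set T) : R := fine (P A).

Lemma prE A : measurable A -> P A = (pr A)%:E.
Proof. by move=> mA; rewrite /pr fineK// fin_num_measure. Qed.

Lemma pr_ge0 A : 0 <= pr A. Proof. exact: fine_ge0. Qed.

Lemma le_pr A B : measurable A -> measurable B -> A `<=` B -> pr A <= pr B.
Proof. by move=> mA mB AB; rewrite -lee_fin -!prE// le_measure// inE. Qed.

Lemma pr_visit E s n : measurable E ->
  pr (E `&` visit s n) = \sum_(i < n) pr (E `&` first_visit s i).
Proof.
move=> mE; have mEf i : measurable (E `&` first_visit s i).
  by apply: measurableI => //; exact: measurable_first_visit.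
have tI : trivIset setT (fun i => E `&` first_visit s i).
  exact/trivIset_setIl/trivIset_first_visit.
rewrite visitE big_distrr /= /pr (measure_bigsetU P mEf tI).
by rewrite -sum_fine// => i _; rewrite fin_num_measure.
Qed.

Definition origin_ret k l : R :=
  ret F i0 (l - k) 0 * ret F i1 (l - k) 0 * ret F i2 (specials a l - specials a k) 0.

Definition plane_ret n : R := ret F i0 n 0 * ret F i1 n 0.

Lemma measurable_at_zero k : measurable (at_zero S k).
Proof. exact: measurable_S. Qed.

Lemma past_first_visitI E s i : past S s E -> past S (s + i) (E `&` first_visit s i).
Proof.
by move=> Es; apply: pastI; [exact: past_le (leq_addr _ _) Es|exact: past_first_visit].
Qed.

(** By the Markov property at the first visit: all the visits counted on the left
    come at that time or later, and [D] bounds the expected weight that they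
    carry given that time. *)
Lemma visit_ge E s n (w : nat -> R) (D : R) : past S s E ->
  (forall i, (i < n)%N ->
    \sum_(k < n | (i <= k)%N) w k * origin_ret (s + i) (s + k) <= D) ->
  \sum_(k < n) w k * pr (E `&` at_zero S (s + k)) <= D * pr (E `&` visit s n).
Proof.
move=> Es wD; have mE := past_measurable S_walk Es.
have step k : (k < n)%N -> pr (E `&` at_zero S (s + k)) =
    \sum_(i < n | (i <= k)%N) pr (E `&` first_visit s i) * origin_ret (s + i) (s + k).
  move=> kn; have -> : E `&` at_zero S (s + k) = (E `&` at_zero S (s + k)) `&` visit s k.+1.
    apply/seteqP; split => v; last by case.
    by move=> [Ev vk]; split => //; exists k.
  rewrite pr_visit; last by apply: measurableI => //; exact: measurable_at_zero.
  rewrite (big_ord_widen n (fun i => pr (E `&` at_zero S (s + k) `&` first_visit s i)))//.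
  apply: eq_bigr => i ik; rewrite setIAC.
  have iz : E `&` first_visit s i `<=` S (s + i)%N @^-1` [set 0] by move=> v [_ []].
  have := markov_zero F_indep S_walk (_ : s + i <= s + k)%N (@past_first_visitI E s i Es) iz.
  rewrite leq_add2l -ltnS => /(_ ik); rewrite !entry0 => h.
  by rewrite /pr h prE ?fineM//; exact: (past_measurable S_walk (@past_first_visitI E s i Es)).
under eq_bigr do rewrite step//.
rewrite pr_visit// mulr_sumr.
under eq_bigr do rewrite mulr_sumr.
rewrite (exchange_big_dep xpredT)//=; apply: ler_sum => i _.
have -> : \sum_(k < n | (i <= k)%N) w k * (pr (E `&` first_visit s i) * origin_ret (s + i) (s + k)) =
    (\sum_(k < n | (i <= k)%N) w k * origin_ret (s + i) (s + k)) * pr (E `&` first_visit s i).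
  by rewrite mulr_suml; apply: eq_bigr => k _; ring.
by rewrite ler_wpM2r ?pr_ge0// wD.
Qed.

(** Without special steps the height does not move. *)
Lemma height_still s l : (s <= l)%N -> specials a l = specials a s ->
  P (~` height_zero S s `&` height_zero S l) = 0%E.
Proof.
move=> sl sE.
have mA k : measurable (height_zero S k) := measurable_S S k [set x | entry i2 x = 0].
have mX c : measurable ((coords \o S s) @^-1` [set c]).
  by rewrite comp_preimage; exact: measurable_S.
rewrite (measure_fibers P mX); last by apply: measurableI => //; exact: measurableC.
apply: esum1 => -[[x y] z] _; pose xx : lattice 3 := \row_i [:: x; y; z]`_i.
have cxx : coords xx = (x, y, z) by rewrite /coords /entry /xx !mxE.
apply/eqP; rewrite -measure_le0.
have [->|z0] := eqVneq z 0.
  rewrite (_ : _ `&` _ = set0) ?measure0//.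
  by apply/seteqP; split => // w [[/= h _]] [_ _ /h].
have Sxx : past S s (S s @^-1` [set xx]) by exact: past_S.
have one0 (u : int) : (0 <= 1 :> \bar R)%E by exact: lee01.
have deltaE w : tensor (fun=> 1%E) (fun=> 1%E) (delta 0) (coords (S l w)) =
    (\1_(height_zero S l) w)%:E :> \bar R.
  rewrite /tensor !mul1e /delta indicE; congr (_ : bool)%:R%:E.
  by apply/eqP/idP; rewrite inE.
have := markov_set F_indep S_walk sl Sxx (fun _ => id) (mA l) one0 one0 (delta_ge0 0) deltaE.
rewrite sE subnn /tensor /= (_ : delta 0 _ = 0%E); last first.
  by have [_ _ ->] := cxx; rewrite /delta (negbTE z0).
rewrite !mule0 => <-; apply: le_measure; rewrite ?inE.
- by apply: measurableI => //; apply: measurableI => //; exact: measurableC.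
- by apply: measurableI => //; exact: measurable_S.
- move=> w [[_ hl] /= wc]; split => //=; apply: latticeP.
  by rewrite cxx -wc.
Qed.

(** In the block of length [g] starting at time [s] only the plane walk moves;
    after a visit in the block the plane walk is, during the next [g] steps, at
    zero as often as a walk started at zero. Those steps lie in a window of
    length [g + g], and the height at time [s] is zero already. *)
Lemma visit_le s g : (forall i, (i < g)%N -> specials a (s + i) = specials a s) ->
  pr (visit s g) * \sum_(k < g) plane_ret k <=
  \sum_(k < g + g) ret F i0 (s + k) 0 * ret F i1 (s + k) 0 * ret F i2 (specials a s) 0.
Proof.
move=> sg.
have mA k : measurable (height_zero S k) := measurable_S S k [set x | entry i2 x = 0].
have mW k : measurable (plane_zero S k) :=
  measurable_S S k [set x | entry i0 x = 0 /\ entry i1 x = 0].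
pose A := height_zero S s; have mAs : measurable A := mA s.
have pastA : past S s A.
  exact: (@past_S _ _ _ _ S s s [set x | entry i2 x = 0]).
have mf i : measurable (first_visit s i) by exact: measurable_first_visit.
have fvA i : (i < g)%N -> pr (first_visit s i) = pr (A `&` first_visit s i).
  move=> ig; rewrite /pr -[in LHS](setIT (first_visit s i)) -(setUv A) setIUr.
  rewrite measureU; last 3 first.
  - exact: measurableI.
  - by apply: measurableI => //; exact: measurableC.
  - by apply/seteqP; split => // w [[_ h] [_ h']].
  rewrite [X in (_ + X)%E](_ : _ = 0%E) ?adde0; first by rewrite setIC.
  apply/eqP; rewrite -measure_le0 -(height_still (leq_addr i s) (sg i ig)).
  apply: le_measure; rewrite ?inE.
  - by apply: measurableI => //; exact: measurableC.
  - by apply: measurableI => //; exact: measurableC.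
  - by move=> w [[h _] hA]; split => //; rewrite /height_zero /= h entry0.
have -> : pr (visit s g) = \sum_(i < g) pr (A `&` first_visit s i).
  rewrite -(setTI (visit s g)) pr_visit//; apply: eq_bigr => i _.
  by rewrite setTI fvA.
have rhs k : (k < g + g)%N -> ret F i0 (s + k) 0 * ret F i1 (s + k) 0 * ret F i2 (specials a s) 0 =
    pr (A `&` plane_zero S (s + k)).
  by move=> _; rewrite /pr (plane_height F_indep S_walk (leq_addr _ _)).
have lower k : (k < g + g)%N ->
    \sum_(i < g | (i <= k)%N) pr (A `&` first_visit s i) * plane_ret (k - i) <=
    pr (A `&` plane_zero S (s + k)).
  move=> kg.
  have mAW : measurable (A `&` plane_zero S (s + k)) by exact: measurableI.
  apply: (@le_trans _ _ (pr ((A `&` plane_zero S (s + k)) `&` visit s g))); last first.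
    apply: le_pr => //; apply: measurableI => //.
    by rewrite visitE; apply: bigsetU_measurable => i _.
  rewrite pr_visit// [leRHS](bigID (fun i : 'I_g => (i <= k)%N)) /=.
  rewrite -[leLHS]addr0 lerD//; last by apply: sumr_ge0 => i _; exact: pr_ge0.
  apply: ler_sum => i ik; rewrite setIAC.
  have iz : A `&` first_visit s i `<=` S (s + i)%N @^-1` [set 0] by move=> v [_ []].
  have := markov_plane F_indep S_walk (_ : s + i <= s + k)%N (@past_first_visitI A s i pastA) iz.
  rewrite leq_add2l => /(_ ik); rewrite !entry0 subnDl => h.
  by rewrite {2}/pr h prE ?fineM//; exact: measurableI.
rewrite (eq_bigr (fun k : 'I_(g + g) => pr (A `&` plane_zero S (s + k)))); last first.
  by move=> k _; exact: rhs.
apply: le_trans (ler_sum _ (fun (k : 'I_(g + g)) _ => lower k (ltn_ord k))).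
rewrite (exchange_big_dep xpredT)//= mulr_suml; apply: ler_sum => i _.
rewrite -mulr_sumr ler_wpM2l ?pr_ge0//.
have pr0 n : 0 <= plane_ret n by rewrite mulr_ge0// ret_ge0.
rewrite -(big_mkord (fun k => i <= k)%N (fun k => plane_ret (k - i))).
rewrite (big_cat_nat (n := i)) //=; last by rewrite (leq_trans (ltnW (ltn_ord i))) ?leq_addr.
rewrite -[leLHS]add0r lerD//; first by apply: sumr_ge0.
rewrite [leRHS](_ : _ = \sum_(0 <= k < g + g - i) plane_ret k); last first.
  have := big_addn 0 (g + g) i (fun k => i <= k)%N (fun k => plane_ret (k - i)).
  rewrite add0n => ->; apply: congr_big_nat => // k; first by rewrite leq_addl.
  by rewrite addnK.
rewrite -(big_mkord xpredT plane_ret) [leRHS](big_cat_nat (n := g))//=.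
  by rewrite lerDl; apply: sumr_ge0.
by rewrite -addnBA ?leq_addr// ltnW.
Qed.

End first_visits.
(** * Harmonic sums, and sums over multiples *)

Section sums.
Context {R : realType}.
Implicit Types (f : nat -> R) (k m n q : nat).

Lemma ln_step k : (0 < k)%N ->
  k.+1%:R^-1 <= ln k.+1%:R - ln k%:R :> R /\ ln k.+1%:R - ln k%:R <= k%:R^-1 :> R.
Proof.
move=> k0; have kR : 0 < k%:R :> R by rewrite ltr0n.
have k1 : 0 < k.+1%:R :> R by [].
have kE : k.+1%:R = k%:R + 1 :> R by rewrite natr1.
split.
  rewrite -lerN2 opprB -ln_div ?posrE//.
  have -> : k%:R / k.+1%:R = 1 + - k.+1%:R^-1 :> R by rewrite kE; field; lra.
  apply: le_ln1Dx; rewrite ltrN2 invf_lt1//; rewrite kE; lra.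
rewrite -ln_div ?posrE//.
have -> : k.+1%:R / k%:R = 1 + k%:R^-1 :> R by rewrite kE; field; lra.
by apply: le_ln1Dx; apply: (@lt_trans _ _ 0) => //; rewrite invr_gt0.
Qed.

Lemma sum_inv_ge m n : (0 < m)%N -> (m <= n)%N ->
  ln n%:R - ln m%:R <= \sum_(m <= k < n) k%:R^-1 :> R.
Proof.
move=> m0 mn; rewrite -(telescope_sumr (fun k => ln k%:R))//.
rewrite big_nat [leRHS]big_nat; apply: ler_sum => k /andP[mk _].
by have [] := ln_step (leq_trans m0 mk).
Qed.

Lemma sum_inv_le m n : (0 < m)%N -> (m <= n)%N ->
  \sum_(m <= k < n) k%:R^-1 <= 2 * (ln n%:R - ln m%:R) :> R.
Proof.
move=> m0 mn; rewrite -(telescope_sumr (fun k => ln k%:R))// mulr_sumr.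
rewrite big_nat [leRHS]big_nat; apply: ler_sum => k /andP[mk _].
have k0 := leq_trans m0 mk; have [h _] := ln_step k0.
apply: (@le_trans _ _ (2 * k.+1%:R^-1)); last by rewrite ler_pM2l.
rewrite ler_pdivlMr ?ltr0n// mulrC ler_pdivrMr ?ltr0n// -natrM ler_nat.
lia.
Qed.

Definition nonincreasing_from m f := forall k l, (m <= k)%N -> (k <= l)%N -> f l <= f k.

Lemma sum_window_le q m l f : (forall k, 0 <= f k) -> nonincreasing_from m f ->
  (l <= m + q)%N -> \sum_(m <= k < l) f k <= q%:R * f m.
Proof.
move=> f0 fm lmq; apply: (@le_trans _ _ (\sum_(m <= k < l) f m)).
  by rewrite big_nat [leRHS]big_nat; apply: ler_sum => k /andP[mk _]; exact: fm.
by rewrite sumr_const_nat -[leLHS]mulr_natl ler_wpM2r// ler_nat; lia.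
Qed.

Lemma sum_multiples_aux q m n f : (0 < q)%N -> (q %| m)%N -> (forall k, 0 <= f k) ->
  nonincreasing_from m f ->
  \sum_(m <= k < n) f k <= q%:R * \sum_(m <= k < n | (q %| k)%N) f k.
Proof.
move=> q0 + f0; have [d] := ubnP (n - m); elim: d m => // d IH m nmd qm fm.
case: (leqP n m) => [nm|mn].
  by rewrite !big_geq// mulr0.
have mE : \sum_(m <= k < n | (q %| k)%N) f k =
    f m + \sum_(m.+1 <= k < n | (q %| k)%N) f k.
  by rewrite big_ltn_cond// qm.
case: (leqP n (m + q)) => nq.
  apply: (le_trans (sum_window_le f0 fm nq)); rewrite ler_wpM2l// mE lerDl.
  exact: sumr_ge0.
have mq : (m <= m + q)%N by exact: leq_addr.
rewrite (big_cat_nat (n := m + q)) ?(ltnW nq)//= [X in _ <= _ * X](big_cat_nat (n := m + q)) ?(ltnW nq)//= mulrDr.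
apply: lerD; last first.
  apply: IH; first by lia.
    by rewrite dvdn_addl.
  by move=> k l mk; apply: fm; exact: leq_trans mk.
apply: (le_trans (sum_window_le f0 fm (leqnn _))); rewrite ler_wpM2l//.
rewrite big_ltn_cond ?qm; last by lia.
by rewrite lerDl sumr_ge0.
Qed.

(** The term at a multiple of [q] dominates the [q] terms that start there, and
    [f m] those before the first multiple. *)
Lemma sum_multiples q m n f : (0 < q)%N -> (forall k, 0 <= f k) ->
  nonincreasing_from m f ->
  \sum_(m <= k < n) f k <= q%:R * (\sum_(m <= k < n | (q %| k)%N) f k + f m).
Proof.
move=> q0 f0 fm; case: (leqP n m) => [nm|mn].
  by rewrite !big_geq// add0r mulr_ge0.
pose m' := ((m %/ q).+1 * q)%N.
have mm' : (m <= m')%N by rewrite ltnW// ltn_ceil.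
have m'q : (m' <= m + q)%N by rewrite /m' mulSn addnC leq_add2r leq_trunc_div.
rewrite mulrDr; case: (leqP n m') => nm'.
  apply: (@le_trans _ _ (q%:R * f m)).
    exact: sum_window_le (leq_trans nm' m'q).
  by rewrite lerDr mulr_ge0// sumr_ge0.
rewrite (big_cat_nat (n := m')) ?(ltnW nm')//= addrC; apply: lerD; last exact: sum_window_le.
apply: (le_trans (sum_multiples_aux n q0 (dvdn_mull _ (dvdnn q)) f0 _)).
  by move=> k l mk; apply: fm; exact: leq_trans mk.
rewrite ler_wpM2l// [leRHS](big_cat_nat (n := m')) ?(ltnW nm')//= lerDr.
exact: sumr_ge0.
Qed.

(** The summable sequence [n ^ (- 5 / 4)]. *)
Definition inv54 n : R := (Num.sqrt (Num.sqrt n%:R) ^+ 5)^-1.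

Lemma inv54_ge0 n : 0 <= inv54 n.
Proof. by rewrite invr_ge0 exprn_ge0// sqrtr_ge0. Qed.

Lemma sqrt_sqrt4 n : Num.sqrt (Num.sqrt n%:R) ^+ 4 = n%:R :> R.
Proof. by rewrite (exprM _ 2 2) sqr_sqrtr ?sqrtr_ge0// sqr_sqrtr. Qed.

(** Comparison with the increments of [n ^ (- 1 / 4)]. *)
Lemma inv54_le n : (0 < n)%N -> inv54 n.+1 <=
  4 * ((Num.sqrt (Num.sqrt n%:R))^-1 - (Num.sqrt (Num.sqrt n.+1%:R))^-1).
Proof.
move=> n0; rewrite /inv54; have := sqrt_sqrt4 n; have := sqrt_sqrt4 n.+1.
have u0 : 0 < Num.sqrt (Num.sqrt n%:R) :> R by rewrite !sqrtr_gt0 ltr0n.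
have uv : Num.sqrt (Num.sqrt n%:R) <= Num.sqrt (Num.sqrt n.+1%:R) :> R.
  by rewrite ler_sqrt ?sqrtr_ge0// ler_sqrt// ler_nat.
have v0 := lt_le_trans u0 uv.
move: u0 uv v0.
set u := Num.sqrt (Num.sqrt n%:R); set v := Num.sqrt (Num.sqrt n.+1%:R) => u0 uv v0 v4 u4.
have vu : 1 = (v - u) * ((v + u) * (v ^+ 2 + u ^+ 2)).
  have -> : (v - u) * ((v + u) * (v ^+ 2 + u ^+ 2)) = v ^+ 4 - u ^+ 4 by ring.
  by rewrite v4 u4 -natrB// subSnn.
have up : (v + u) * (v ^+ 2 + u ^+ 2) <= 4 * v ^+ 3.
  have u2 : u ^+ 2 <= v ^+ 2 by rewrite lerXn2r ?nnegrE// ltW.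
  rewrite (_ : 4 * v ^+ 3 = (v + v) * (v ^+ 2 + v ^+ 2)); last by ring.
  by rewrite ler_pM ?addr_ge0 ?sqr_ge0 ?(ltW u0) ?(ltW v0)// lerD2l.
have d : (4 * v ^+ 3)^-1 <= v - u.
  rewrite -[leLHS]mul1r ler_pdivrMr ?mulr_gt0 ?exprn_gt0//.
  by rewrite {1}vu ler_wpM2l ?subr_ge0.
have -> : u^-1 - v^-1 = (v - u) / (u * v) by field; rewrite !gt_eqF.
apply: (@le_trans _ _ (4 * ((4 * v ^+ 3)^-1 / (u * v)))); last first.
  by rewrite ler_pM2l// ler_wpM2r ?invr_ge0 ?mulr_ge0// ltW.
have -> : 4 * ((4 * v ^+ 3)^-1 / (u * v)) = (v ^+ 4 * u)^-1.
  by field; rewrite !gt_eqF.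
rewrite lef_pV2 ?posrE ?mulr_gt0 ?exprn_gt0// [leRHS]exprSr ler_wpM2l ?exprn_ge0//.
exact: ltW.
Qed.

Lemma sum_inv54 m n : (0 < m)%N -> \sum_(m <= k < n) inv54 k <= 5.
Proof.
move=> m0; apply: (@le_trans _ _ (\sum_(1 <= k < n) inv54 k)).
  case: (leqP n m) => [nm|mn]; first by rewrite big_geq// sumr_ge0// => *; exact: inv54_ge0.
  rewrite [leRHS](big_cat_nat (n := m)) ?(ltnW mn)//= lerDr sumr_ge0// => *.
  exact: inv54_ge0.
case: n => [|n]; first by rewrite big_geq.
case: n => [|n]; first by rewrite big_geq.
rewrite big_ltn// {1}/inv54 !sqrtr1 expr1n invr1.
have : \sum_(2 <= k < n.+2) inv54 k <= 4; last by lra.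
rewrite big_add1 /=.
apply: (@le_trans _ _ (\sum_(1 <= k < n.+1) - (4 * ((Num.sqrt (Num.sqrt k.+1%:R))^-1) - 4 * (Num.sqrt (Num.sqrt k%:R))^-1))).
  rewrite big_nat [leRHS]big_nat; apply: ler_sum => k /andP[k0 _].
  by apply: (le_trans (inv54_le k0)); lra.
rewrite sumrN (telescope_sumr (fun k => 4 * (Num.sqrt (Num.sqrt k%:R))^-1))//.
rewrite !sqrtr1 invr1 opprB mulr1 gerBl mulr_ge0// invr_ge0 sqrtr_ge0//.
Qed.

End sums.
(** * Bounds for the coordinate walks *)

Section coordinate_bounds.
Context {R : realType} (F : probability (lattice 3) R).
Hypothesis F_dim : truly_dimensional F.
Hypothesis F_mean : mean_zero F.
Hypothesis F_var : finite_variance F.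

Lemma ret_upper : exists2 C : R, 0 < C &
  forall i n y, ret F i n y <= C / Num.sqrt n.+1%:R.
Proof.
have up i : exists2 C : R, 0 < C & forall n y, ret F i n y <= C / Num.sqrt n.+1%:R.
  have [C C0 h] := hit_upper (marginal_ge0 F i) (sum_marginal F i)
    (marginal_nondegenerate F_mean F_var i F_dim).
  by exists C => // n y; rewrite -lee_fin -hitE.
have [C0 C00 h0] := up i0; have [C1 C10 h1] := up i1; have [C2 C20 h2] := up i2.
exists (C0 + C1 + C2); first by rewrite !addr_gt0.
have le i n y (C : R) : C <= C0 + C1 + C2 -> ret F i n y <= C / Num.sqrt n.+1%:R ->
    ret F i n y <= (C0 + C1 + C2) / Num.sqrt n.+1%:R.
  by move=> CC /le_trans; apply; rewrite ler_wpM2r// invr_ge0.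
apply: ord3P => n y; [apply: le (h0 n y)|apply: le (h1 n y)|apply: le (h2 n y)]; lra.
Qed.

Lemma ret_lower : exists2 q : nat, (0 < q)%N & exists2 c : R, 0 < c &
  forall i m x, (0 < mass (marginal F i) m x)%E -> exists K, forall n, (K <= n)%N ->
    (q %| n + m)%N -> c / Num.sqrt n.+1%:R <= ret F i n x.
Proof.
have low i : exists2 q : nat, (0 < q)%N & exists2 c : R, 0 < c &
  forall m x, (0 < mass (marginal F i) m x)%E -> exists K, forall n, (K <= n)%N ->
    (q %| n + m)%N -> c / Num.sqrt n.+1%:R <= ret F i n x.
  have [sig s0 hs] := avg_marginal_square F_mean F_var i.
  have [|q q0 [c c0 h]] := hit_lower (marginal_ge0 F i) (sum_marginal F i)
    (marginal_nondegenerate F_mean F_var i F_dim) s0.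
    by move=> y; rewrite hs.
  exists q => //; exists c => // m x /h [K hK]; exists K => n nK nq.
  by rewrite -lee_fin -hitE; exact: hK.
have [q0 q00 [c0 c00 h0]] := low i0; have [q1 q10 [c1 c10 h1]] := low i1.
have [q2 q20 [c2 c20 h2]] := low i2.
exists (q0 * q1 * q2)%N; first by rewrite !muln_gt0 q00 q10 q20.
exists (Num.min c0 (Num.min c1 c2)); first by rewrite !lt_min c00 c10 c20.
have le (c r : R) n : Num.min c0 (Num.min c1 c2) <= c -> c / Num.sqrt n.+1%:R <= r ->
    Num.min c0 (Num.min c1 c2) / Num.sqrt n.+1%:R <= r.
  by move=> cc; apply: le_trans; rewrite ler_wpM2r// invr_ge0.
apply: ord3P => m x mx.
- have [K hK] := h0 m x mx; exists K => n nK nq; apply: le (hK n nK _).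
    by rewrite ge_min lexx.
  by apply: dvdn_trans nq; rewrite -mulnA dvdn_mulr.
- have [K hK] := h1 m x mx; exists K => n nK nq; apply: le (hK n nK _).
    by rewrite !ge_min lexx orbT.
  by apply: dvdn_trans nq; rewrite dvdn_mulr// dvdn_mull.
- have [K hK] := h2 m x mx; exists K => n nK nq; apply: le (hK n nK _).
    by rewrite !ge_min lexx !orbT.
  by apply: dvdn_trans nq; rewrite dvdn_mull.
Qed.

Lemma plane_ret_ge0 n : 0 <= plane_ret F n.
Proof. by rewrite mulr_ge0// ret_ge0. Qed.

(** At the multiples [k] of [q] each coordinate walk is at zero with probability
    at least of order [k ^ (- 1 / 2)], hence the plane walk with probability at
    least of order [1 / k]: the logarithm is the harmonic sum. *)
Lemma green_ge : exists2 c : R, 0 < c & forall g, (0 < g)%N ->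
  c * ln g.+1%:R <= \sum_(k < g) plane_ret F k.
Proof.
have [q q0 [c c0 low]] := ret_lower.
have m00 i : (0 < mass (marginal F i) 0 0)%E by rewrite mass0 /delta eqxx lte_fin.
have [K0 h0] := low i0 0%N 0 (m00 i0); have [K1 h1] := low i1 0%N 0 (m00 i1).
pose K := maxn K0 K1; pose s := (q * K)%N.
pose al := c ^+ 2 / q%:R; have qR : 0 < q%:R :> R by rewrite ltr0n.
have al0 : 0 < al by rewrite divr_gt0// exprn_gt0.
pose Lam := ln s.+1%:R : R; have Lam0 : 0 <= Lam by rewrite ln_ge0// ler1n.
have one g : (0 < g)%N -> 1 <= \sum_(k < g) plane_ret F k.
  case: g => // g _; rewrite big_ord_recl {1}/plane_ret !ret0 mulr1 lerDl.
  by apply: sumr_ge0 => i _; exact: plane_ret_ge0.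
have bound g : (0 < g)%N -> al * (ln g.+1%:R - Lam) <= \sum_(k < g) plane_ret F k.
  move=> g0; case: (leqP g s) => gs.
    apply: (@le_trans _ _ 0); last by rewrite (le_trans _ (one g g0)).
    by rewrite mulr_ge0_le0 ?(ltW al0)// subr_le0 ler_ln ?posrE// ler_nat ltnS.
  have f0 (k : nat) : 0 <= k.+1%:R^-1 :> R by [].
  have fm : nonincreasing_from s (fun k => k.+1%:R^-1 : R).
    by move=> k l _ kl; rewrite lef_pV2 ?posrE// ler_nat.
  have := sum_multiples_aux g q0 (dvdn_mulr _ (dvdnn q)) f0 fm.
  have := @sum_inv_ge R s.+1 g.+1 isT (leqW gs).
  rewrite big_add1 /= -/Lam => h1' h2'; have {h1' h2'} h := le_trans h1' h2'.
  rewrite /al mulrAC ler_pdivrMr//.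
  apply: (@le_trans _ _ (c ^+ 2 * (q%:R * \sum_(s <= k < g | (q %| k)%N) k.+1%:R^-1))).
    by rewrite ler_wpM2l ?exprn_ge0// ltW.
  rewrite mulrCA mulrC ler_wpM2r// -(big_mkord xpredT (plane_ret F)).
  rewrite [leRHS](big_cat_nat (n := s)) ?(ltnW gs)//=.
  rewrite -[leLHS]add0r lerD//.
    by apply: sumr_ge0 => k _; exact: plane_ret_ge0.
  rewrite mulr_sumr big_mkcond big_nat [leRHS]big_nat; apply: ler_sum => k /andP[sk _].
  case: ifP => [qk|_]; last exact: plane_ret_ge0.
  have kK : (K <= k)%N by apply: leq_trans sk; rewrite leq_pmull.
  have := h0 k (leq_trans (leq_maxl _ _) kK); rewrite addn0 => /(_ qk) r0.
  have := h1 k (leq_trans (leq_maxr _ _) kK); rewrite addn0 => /(_ qk) r1.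
  have sk0 : 0 <= c / Num.sqrt k.+1%:R by rewrite divr_ge0 ?sqrtr_ge0// ltW.
  apply: le_trans (ler_pM sk0 sk0 r0 r1).
  by rewrite -expr2 exprMn exprVn sqr_sqrtr.
have den : 0 < 1 + al * Lam by rewrite ltr_pwDl// mulr_ge0// ltW.
exists (al / (1 + al * Lam)); first by rewrite divr_gt0.
move=> g g0; rewrite mulrAC ler_pdivrMr//.
have := bound g g0; have := one g g0.
set G := \sum_(k < g) _ => G1 Gb; rewrite mulrDr mulr1.
have : al * Lam <= G * (al * Lam) by rewrite ler_peMl// mulr_ge0// ltW.
by move: Gb; rewrite mulrBr; lra.
Qed.

End coordinate_bounds.
(** * Transience *)

Section special_sequence.
Context {R : realType} (a : nat -> nat).
Hypothesis (a_pos : forall n, (0 < n)%N -> (0 < a n)%N).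
Hypothesis (a_incr : forall m n, (0 < m)%N -> (m < n)%N -> (a m < a n)%N).

Lemma aR_gt0 n : (0 < n)%N -> 0 < (a n)%:R :> R.
Proof. by move=> n0; rewrite ltr0n a_pos. Qed.

Lemma aS_gt1 n : (0 < n)%N -> (1 < a n.+1)%N.
Proof. by move=> n0; apply: leq_ltn_trans (a_pos n0) (a_incr n0 (ltnSn n)). Qed.

Lemma ln_aS_gt0 n : (0 < n)%N -> 0 < ln (a n.+1)%:R :> R.
Proof. by move=> n0; rewrite ln_gt0// ltr1n aS_gt1. Qed.

Lemma phiE n : (0 < n)%N ->
  phi R a n = (ln (a n.+1)%:R - ln (a n)%:R) / ln (a n.+1)%:R.
Proof. by move=> n0; rewrite /phi ln_div// posrE aR_gt0. Qed.

Lemma phi_ge0 n : (0 < n)%N -> 0 <= phi R a n.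
Proof.
move=> n0; rewrite phiE// divr_ge0 ?(ltW (ln_aS_gt0 n0))// subr_ge0.
by rewrite ler_ln ?posrE ?aR_gt0// ler_nat ltnW// a_incr.
Qed.

Lemma phi_le1 n : (0 < n)%N -> phi R a n <= 1.
Proof.
move=> n0; rewrite phiE// ler_pdivrMr ?ln_aS_gt0// mul1r gerBl ln_ge0//.
by rewrite ler1n a_pos.
Qed.

(** The general term of the series in the criterion. *)
Definition term n : R := n%:R `^ (- (1 / 2)) * phi R a n.

Lemma termE n : term n = phi R a n / Num.sqrt n%:R.
Proof. by rewrite /term powRN div1r powR12_sqrt// mulrC. Qed.

Lemma term_ge0 n : 0 <= term n.
Proof.
case: n => [|n]; first by rewrite termE sqrtr0 invr0 mulr0.
by rewrite termE divr_ge0 ?sqrtr_ge0// phi_ge0.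
Qed.

End special_sequence.

Section transience.
Context {R : realType} (F : probability (lattice 3) R).
Hypothesis F_dim : truly_dimensional F.
Hypothesis F_mean : mean_zero F.
Hypothesis F_var : finite_variance F.
Hypothesis F_indep : independent_coordinates F.
Context (a : nat -> nat).
Hypothesis (a_pos : forall n, (0 < n)%N -> (0 < a n)%N).
Hypothesis (a_incr : forall m n, (0 < m)%N -> (m < n)%N -> (a m < a n)%N).
Context {dT : measure_display} {T : measurableType dT}.
Context (P : probability T R) (S : nat -> {RV P >-> lattice 3}).
Hypothesis S_walk : walk_in_varying_dimension 2 F a S.

Definition block_visit n : set T := visit S (a n) (a n.+1 - a n).

(** The expected time at zero of the plane walk in a block lengthened by its
    own length is at most of order [ln (a_(n+1) / a_n)], and the height is zero
    at the beginning of the block with probability at most of order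
    [n ^ (- 1 / 2)]. *)
Lemma block_visit_green : exists2 C : R, 0 < C & forall n, (0 < n)%N ->
  pr P (block_visit n) * \sum_(k < a n.+1 - a n) plane_ret F k <=
  C * ((ln (a n.+1)%:R - ln (a n)%:R) / Num.sqrt n%:R).
Proof.
have [C C0 up] := ret_upper F_dim F_mean F_var.
exists (C ^+ 3 * 4); first by rewrite mulr_gt0// exprn_gt0.
move=> n n0; set A := a n; set B := a n.+1; set g := (B - A)%N.
have A0 : (0 < A)%N by exact: a_pos.
have AB : (A < B)%N by exact: a_incr.
have BE : B = (A + g)%N by rewrite subnKC// ltnW.
have sA : specials a A = n by apply: specialsE.
have sg i : (i < g)%N -> specials a (A + i) = specials a A.
  move=> ig; rewrite sA; apply: specialsE; rewrite ?leq_addr// -/B BE.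
  by rewrite ltn_add2l.
apply: (le_trans (visit_le F_indep S_walk sg)); rewrite sA.
have sqn : 0 < Num.sqrt n%:R :> R by rewrite sqrtr_gt0 ltr0n.
have retn i k y : (0 < k)%N -> 0 < Num.sqrt k%:R :> R -> ret F i k y <= C / Num.sqrt k%:R.
  move=> k0 sk; apply: (le_trans (up i k y)); rewrite ler_pM2l// lef_pV2 ?posrE// ?sqrtr_gt0//.
  by rewrite ler_sqrt// ler_nat.
apply: (@le_trans _ _ (\sum_(k < g + g) C ^+ 3 / Num.sqrt n%:R * (A + k)%:R^-1)).
  apply: ler_sum => k _; have k0 : (0 < A + k)%N by rewrite addn_gt0 A0.
  have sk : 0 < Num.sqrt (A + k)%:R :> R by rewrite sqrtr_gt0 ltr0n.
  have -> : C ^+ 3 / Num.sqrt n%:R / (A + k)%:R =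
      (C / Num.sqrt (A + k)%:R) * (C / Num.sqrt (A + k)%:R) * (C / Num.sqrt n%:R).
    by rewrite -[in LHS](sqr_sqrtr (ler0n R (A + k))); field; rewrite !gt_eqF.
  by rewrite !ler_pM ?mulr_ge0 ?ret_ge0 ?retn.
rewrite -mulr_sumr -(big_mkord xpredT (fun k => (A + k)%:R^-1)).
have -> : \sum_(0 <= k < g + g) (A + k)%:R^-1 = \sum_(A <= k < B + g) k%:R^-1 :> R.
  rewrite BE -addnA (addnC A) -{2}[A]add0n big_addn addnK.
  by apply: eq_bigr => k _; rewrite addnC.
have BAg : (A <= B + g)%N by rewrite (leq_trans (ltnW AB)) ?leq_addr.
apply: (le_trans (ler_wpM2l _ (@sum_inv_le R _ _ A0 BAg))).
  by rewrite divr_ge0 ?exprn_ge0// ltW.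
have lnB : ln (B + g)%:R - ln A%:R <= 2 * (ln B%:R - ln A%:R) :> R.
  have : ln ((B + g)%:R * A%:R) <= ln (B%:R ^+ 2) :> R.
    rewrite ler_ln ?posrE ?mulr_gt0 ?exprn_gt0 ?ltr0n ?addn_gt0 ?A0 ?(leq_ltn_trans _ AB)//.
    by rewrite -natrM -natrX ler_nat; nia.
  rewrite lnXn ?ltr0n ?(leq_ltn_trans _ AB)// lnM ?posrE ?ltr0n ?addn_gt0 ?A0 ?(leq_ltn_trans _ AB)//.
  by rewrite mulr2n; lra.
have -> : C ^+ 3 * 4 * ((ln B%:R - ln A%:R) / Num.sqrt n%:R) =
    C ^+ 3 / Num.sqrt n%:R * (2 * (2 * (ln B%:R - ln A%:R))) by ring.
by rewrite ler_wpM2l ?divr_ge0 ?exprn_ge0 ?(ltW C0)// ler_pM2l.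
Qed.

(** If the block is long, the Green function is of order [ln a_(n+1)], which
    gives the general term of the series; if it is short, it is so short that
    [ln (a_(n+1) / a_n)] alone is summable against [n ^ (- 1 / 2)]. *)
Lemma block_visit_le : exists2 C : R, 0 < C & forall n, (0 < n)%N ->
  pr P (block_visit n) <= C * (term a n + inv54 n).
Proof.
have [C C0 hC] := block_visit_green.
have [c c0 hc] := green_ge F_dim F_mean F_var.
exists (C * 4 / c + C * 2); first by rewrite addr_gt0 ?mulr_gt0 ?invr_gt0.
move=> n n0; have := hC n n0; set A := a n; set B := a n.+1; set g := (B - A)%N.
have A0 : (0 < A)%N by exact: a_pos.
have AB : (A < B)%N by exact: a_incr.
have BE : B = (A + g)%N by rewrite subnKC// ltnW.
have g0 : (0 < g)%N by rewrite subn_gt0.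
have nA : (n <= A)%N by exact: (a_ge_id a_pos a_incr).
have nR : 0 < n%:R :> R by rewrite ltr0n.
have AR : 0 < A%:R :> R by rewrite ltr0n.
have sqn : 0 < Num.sqrt n%:R :> R by rewrite sqrtr_gt0.
have lnB : 0 < ln B%:R :> R by exact: ln_aS_gt0.
have lnBA : 0 <= ln B%:R - ln A%:R :> R.
  by rewrite subr_ge0 ler_ln ?posrE ?ltr0n ?(leq_ltn_trans _ AB)// ler_nat ltnW.
have t0 : 0 <= term a n :> R by exact: term_ge0.
have i0 : 0 <= inv54 n :> R by exact: inv54_ge0.
have p0 : 0 <= pr P (block_visit n) by exact: pr_ge0.
have aux (X Y t i : R) : 0 < X -> 0 < Y -> 0 <= t -> 0 <= i ->
    X * t <= (X + Y) * (t + i) /\ Y * i <= (X + Y) * (t + i).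
  by move=> *; split; nra.
have X0 : 0 < C * 4 / c by rewrite !mulr_gt0// invr_gt0.
have Y0 : 0 < C * 2 by rewrite mulr_gt0.
set p := pr P _ in p0 *; set G := \sum_(k < g) _ => pG.
(* The power [4] makes a short block shorter than [(2 a_n) ^ (1 / 4)]; any power
   greater than [2] would lead to a summable sequence. *)
case: (leqP B (g ^ 4)) => Bg.
  have GB : c / 4 * ln B%:R <= G.
    apply: le_trans (hc g g0); rewrite -mulrA ler_pM2l// ler_pdivrMl//.
    have -> : 4 * ln g.+1%:R = ln (g.+1%:R ^+ 4) :> R by rewrite lnXn// mulr_natl.
    rewrite ler_ln ?posrE ?exprn_gt0 ?ltr0n ?(leq_ltn_trans _ AB)//.
    by rewrite -natrX ler_nat (leq_trans Bg)// leq_exp2r.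
  have : p <= C * 4 / c * term a n.
    rewrite termE phiE// -/A -/B.
    have -> : C * 4 / c * ((ln B%:R - ln A%:R) / ln B%:R / Num.sqrt n%:R) =
      (C * ((ln B%:R - ln A%:R) / Num.sqrt n%:R)) / (c / 4 * ln B%:R).
      by field; rewrite !gt_eqF.
    rewrite ler_pdivlMr ?mulr_gt0 ?divr_gt0//; apply: le_trans pG.
    by rewrite ler_wpM2l.
  by move=> h; apply: (le_trans h); have [] := aux _ _ _ _ X0 Y0 t0 i0.
have G1 : 1 <= G.
  rewrite /G; case: (g) g0 => // g' _; rewrite big_ord_recl {1}/plane_ret !ret0 mulr1 lerDl.
  by apply: sumr_ge0 => k _; exact: plane_ret_ge0.
have {pG} pG : p <= C * ((ln B%:R - ln A%:R) / Num.sqrt n%:R).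
  by apply: le_trans pG; rewrite ler_peMr.
have lnBAg : ln B%:R - ln A%:R <= g%:R / A%:R :> R.
  rewrite -ln_div ?posrE ?ltr0n ?(leq_ltn_trans _ AB)// BE natrD mulrDl divff ?gt_eqF//.
  by apply: le_ln1Dx; apply: (@lt_le_trans _ _ 0) => //; rewrite divr_ge0.
set v : R := Num.sqrt (Num.sqrt n%:R).
have v0 : 0 < v by rewrite sqrtr_gt0.
have v4 : v ^+ 4 = n%:R by exact: sqrt_sqrt4.
have gA : g%:R / A%:R <= 2 / v ^+ 3.
  have g4 : (g ^ 4 < 2 * A)%N.
    have gA' : (g <= A)%N.
      rewrite leqNgt; apply/negP => Ag.
      have : (2 ^ 3 * g <= g ^ 4)%N.
        by rewrite (expnSr g 3) leq_mul2r leq_exp2r// (leq_ltn_trans A0 Ag) orbT.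
      by move: Bg Ag g0; rewrite BE; move: (g ^ 4)%N => x; clear; lia.
    by move: Bg gA'; rewrite BE; move: (g ^ 4)%N => x; clear; lia.
  rewrite -(@ler_pXn2r _ 4)// ?nnegrE ?divr_ge0 ?exprn_ge0 ?(ltW v0)//.
  rewrite !exprMn !exprVn -exprM (exprM v 4 3) v4 ler_pdivrMr ?exprn_gt0//.
  rewrite mulrAC ler_pdivlMr ?exprn_gt0// -!natrX -!natrM ler_nat.
  have : (n ^ 3 <= A ^ 3)%N by rewrite leq_exp2r.
  move=> n3; apply: (@leq_trans (2 * A * A ^ 3)); first by rewrite leq_mul// ltnW.
  by rewrite (expnS A 3); move: (A ^ 3)%N => x; clear; nia.
have : p <= C * 2 * inv54 n.
  apply: (le_trans pG); rewrite -mulrA ler_pM2l// /inv54 -/v.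
  have -> : Num.sqrt n%:R = v ^+ 2 :> R by rewrite sqr_sqrtr// sqrtr_ge0.
  rewrite ler_pdivrMr ?exprn_gt0//; apply: (le_trans lnBAg); apply: (le_trans gA).
  by rewrite [leLHS](_ : _ = 2 / v ^+ 5 * v ^+ 2)//; field; rewrite gt_eqF.
by move=> h; apply: (le_trans h); have [] := aux _ _ _ _ X0 Y0 t0 i0.
Qed.

Lemma in_block_visit k w : (a 1 <= k)%N -> S k w = 0 ->
  (0 < specials a k)%N /\ block_visit (specials a k) w.
Proof.
move=> a1k Sk; have [n0 h1 h2] := specials_bounds a_pos a_incr a1k.
split => //; exists (k - a (specials a k))%N; last by rewrite subnKC.
by rewrite ltn_sub2r// (leq_ltn_trans h1 h2).
Qed.

Lemma measurable_block_visit n : measurable (block_visit n).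
Proof.
rewrite /block_visit visitE; apply: bigsetU_measurable => i _.
exact: (measurable_first_visit S_walk).
Qed.

(** By the Borel-Cantelli lemma only finitely many blocks contain a visit. *)
Theorem transient_of_summable :
  (\sum_(1 <= n <oo) (term a n : R)%:E < +oo)%E -> transient S.
Proof.
move=> sum_fin; have [C C0 hC] := block_visit_le.
have term0 n : (1 <= n)%N -> true -> (0 <= (term a n : R)%:E)%E.
  by move=> n1 _; rewrite lee_fin term_ge0.
have part N : \sum_(1 <= n < N) term a n <=
    fine (\sum_(1 <= n <oo) (term a n : R)%:E)%E.
  have fin : (\sum_(1 <= n <oo) (term a n : R)%:E)%E \is a fin_num.
    by rewrite ge0_fin_numE//; apply: nneseries_ge0.
  rewrite -lee_fin fineK// -sumEFin.
  exact: nneseries_lim_ge.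
set M := fine _ in part.
pose B n := if n is 0%N then set0 else block_visit n.
have mB n : measurable (B n) by case: n => [|n] //=; exact: measurable_block_visit.
have BC : (\sum_(0 <= n <oo) P (B n) < +oo)%E.
  apply: (@le_lt_trans _ _ (C * (M + 5))%:E); last exact: ltry.
  apply: lime_le; first by apply: is_cvg_nneseries => n _ _; exact: measure_ge0.
  apply: nearW => N; case: N => [|N].
    rewrite big_geq// lee_fin mulr_ge0 ?(ltW C0)// addr_ge0//.
    by have := part 1%N; rewrite big_geq.
  rewrite big_ltn// measure0 add0e.
  apply: (@le_trans _ _ (\sum_(1 <= n < N.+1) (C * (term a n + inv54 n))%:E)%E).
    rewrite big_nat [leRHS]big_nat; apply: lee_sum => n /andP[n0 _].
    rewrite -[B n](_ : block_visit n = _); last by case: (n) n0.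
    rewrite prE; last exact: measurable_block_visit.
    by rewrite lee_fin hC.
  rewrite sumEFin lee_fin -mulr_sumr ler_wpM2l ?(ltW C0)// big_split lerD//=.
  exact: sum_inv54.
have lim0 := lim_sup_set_cvg0 mB BC.
exists (lim_sup_set B); split => //.
  by apply: bigcapT_measurable => n; apply: bigcup_measurable => k _.
move=> w /= nfin; apply: contrapT => /existsNP[N] /not_implyP[_ h].
apply: nfin; apply: (@sub_finite_set _ _ `I_(a (maxn N 1))); last exact: finite_II.
move=> k /= Sk; rewrite ltnNge; apply/negP => kN.
have a1k : (a 1 <= k)%N by apply: leq_trans kN; apply: a_leq => //; exact: leq_maxr.
have [n0 wn] := in_block_visit a1k Sk.
apply: h; exists (specials a k); last by move: wn; rewrite /B; case: (specials a k) n0.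
rewrite /= leqNgt; apply/negP => nN.
have /andP[h1 _] := specials_block a_pos a_incr k.
have : (a (specials a k).+1 <= a (maxn N 1))%N.
  by apply: a_leq => //; rewrite leq_max nN.
by move=> /(leq_trans h1); rewrite ltnNge kN.
Qed.

End transience.
(** * Recurrence *)

Section recurrence.
Context {R : realType} (F : probability (lattice 3) R).
Hypothesis F_dim : truly_dimensional F.
Hypothesis F_mean : mean_zero F.
Hypothesis F_var : finite_variance F.
Hypothesis F_indep : independent_coordinates F.
Context (a : nat -> nat).
Hypothesis (a_pos : forall n, (0 < n)%N -> (0 < a n)%N).
Hypothesis (a_incr : forall m n, (0 < m)%N -> (m < n)%N -> (a m < a n)%N).
Context {dT : measure_display} {T : measurableType dT}.
Context (P : probability T R) (S : nat -> {RV P >-> lattice 3}).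
Hypothesis S_walk : walk_in_varying_dimension 2 F a S.
Hypothesis phi_nonincr : forall m n, (0 < m)%N -> (m <= n)%N -> phi R a n <= phi R a m.

Definition Phi N : R := \sum_(1 <= n < N.+1) term a n.

(** Visits are weighted so that the expected weight of a block is of the order
    of the general term of the series. *)
Definition weight l : R := (ln (a (specials a l).+1)%:R)^-1.

Lemma weight_ge0 l : 0 <= weight l.
Proof. by rewrite invr_ge0 ln_ge0// ler1n a_pos. Qed.

Lemma term_nonincr m n : (0 < m)%N -> (m <= n)%N -> term a n <= term a m :> R.
Proof.
move=> m0 mn; rewrite !termE ler_pM ?invr_ge0 ?sqrtr_ge0//.
- by apply: phi_ge0 => //; exact: leq_trans mn.
- exact: phi_nonincr.
- by rewrite lef_pV2 ?posrE ?sqrtr_gt0 ?ltr0n ?(leq_trans m0)// ler_sqrt// ler_nat.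
Qed.

Lemma sum_blocks (f : nat -> R) p N : (0 < p)%N -> (p <= N)%N ->
  \sum_(a p <= l < a N) f l = \sum_(p <= n < N) \sum_(a n <= l < a n.+1) f l.
Proof.
move=> p0 /subnK <-; elim: (N - p)%N => [|d IH]; first by rewrite !big_geq.
rewrite addSn big_nat_recr ?leq_addl//= -IH.
by rewrite [LHS](big_cat_nat (n := a (d + p)))//=; apply: a_leq => //;
  rewrite ?leq_addl// addn_gt0 p0 orbT.
Qed.

(** After a visit at time [j], the visits before time [2 j] have a bounded
    expected weight, since the plane walk returns [O(ln j)] times by then; for the later
    ones the time elapsed since [j] is comparable to the time itself, and
    monotonicity of [phi] compares the sum with [Phi]. *)
Lemma weight_after : exists2 C : R, 0 < C & forall j N,
  (a 1 <= j)%N -> (j < a N.+1)%N ->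
  \sum_(j <= l < a N.+1) weight l * origin_ret F a j l <= C * (1 + Phi N).
Proof.
have [C C0 up] := ret_upper F_dim F_mean F_var.
have C30 : 0 < C ^+ 3 by rewrite exprn_gt0.
exists (4 * C ^+ 3); first by rewrite mulr_gt0.
move=> j N a1j jL; set L := a N.+1 in jL *.
have [n0 anj jan] := specials_bounds a_pos a_incr a1j; set n := specials a j in n0 anj jan.
have j0 : (0 < j)%N by apply: leq_trans a1j; exact: a_pos.
have lnj : 0 < ln j.+1%:R :> R by rewrite ln_gt0// ltr1n.
pose f1 l : R := if (l < j + j)%N then C ^+ 3 / ln j.+1%:R * (l - j).+1%:R^-1 else 0.
pose f2 l : R := 2 * C ^+ 3 * weight l / Num.sqrt (specials a l - n).+1%:R * l%:R^-1.
have f20 l : 0 <= f2 l.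
  by rewrite !mulr_ge0 ?weight_ge0 ?invr_ge0 ?sqrtr_ge0// ltW.
have f10 l : 0 <= f1 l.
  by rewrite /f1; case: ifP => // _; rewrite mulr_ge0 ?invr_ge0// divr_ge0// ltW.
have ret_bound l : (j <= l)%N -> origin_ret F a j l <=
    C ^+ 3 * (l - j).+1%:R^-1 / Num.sqrt (specials a l - n).+1%:R.
  move=> jl; have -> : C ^+ 3 * (l - j).+1%:R^-1 / Num.sqrt (specials a l - n).+1%:R =
      (C / Num.sqrt (l - j).+1%:R) * (C / Num.sqrt (l - j).+1%:R) *
      (C / Num.sqrt (specials a l - n).+1%:R).
    rewrite -[in LHS](sqr_sqrtr (ler0n R (l - j).+1)); field.
    by rewrite !gt_eqF ?sqrtr_gt0.
  by rewrite !ler_pM ?mulr_ge0 ?ret_ge0// up.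
have main l : (j <= l)%N -> weight l * origin_ret F a j l <= f1 l + f2 l.
  move=> jl; have l0 := leq_trans j0 jl.
  have w0 := weight_ge0 l; have h := ret_bound l jl.
  have s1 : (Num.sqrt (specials a l - n).+1%:R)^-1 <= 1 :> R.
    by rewrite invf_le1 ?sqrtr_gt0// -[leLHS]sqrtr1 ler_sqrt// ler1n.
  case: (ltnP l (j + j)) => lj.
    rewrite -[leLHS]addr0 lerD// /f1 lj.
    have [_ _ lan] := specials_bounds a_pos a_incr (leq_trans a1j jl).
    have w1 : weight l <= (ln j.+1%:R)^-1.
      rewrite lef_pV2 ?posrE// ?ln_gt0 ?ltr1n ?(leq_ltn_trans l0)//.
      rewrite ler_ln ?posrE ?ltr0n ?(leq_ltn_trans _ lan)// ler_nat.
      exact: leq_ltn_trans lan.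
    rewrite [leRHS](_ : _ = (ln j.+1%:R)^-1 * (C ^+ 3 * (l - j).+1%:R^-1)); last by ring.
    rewrite ler_pM ?mulr_ge0 ?ret_ge0//; apply: (le_trans h).
    by rewrite ler_piMr// mulr_ge0 ?invr_ge0// ltW.
  rewrite -[leLHS]add0r lerD// /f2.
  rewrite [leRHS](_ : _ = weight l * (C ^+ 3 * (2 / l%:R) / Num.sqrt (specials a l - n).+1%:R)); last by ring.
  rewrite ler_wpM2l//; apply: (le_trans h).
  rewrite ler_wpM2r ?invr_ge0 ?sqrtr_ge0// ler_wpM2l ?(ltW C30)//.
  rewrite ler_pdivlMr ?ltr0n// mulrC ler_pdivrMr// -natrM ler_nat; lia.
apply: (@le_trans _ _ (\sum_(j <= l < L) f1 l + \sum_(j <= l < L) f2 l)).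
  rewrite -big_split [leLHS]big_nat [leRHS]big_nat; apply: ler_sum => l /andP[jl _].
  exact: main.
have sum1 : \sum_(j <= l < L) f1 l <= 2 * C ^+ 3.
  apply: (@le_trans _ _ (\sum_(j <= l < L + (j + j)) f1 l)).
    by rewrite [leRHS](big_cat_nat (n := L)) ?leq_addr 1?ltnW//= lerDl sumr_ge0.
  rewrite /f1 -big_mkcond /=.
  rewrite -(@big_nat_widen _ _ _ j (j + j) (L + (j + j)) xpredT) ?leq_addl//.
  have hs : \sum_(j <= l < j + j) (l - j).+1%:R^-1 <= 2 * ln j.+1%:R :> R.
    have := @sum_inv_le R 1 j.+1 isT isT; rewrite ln1 subr0 big_add1 /=.
    apply: le_trans; rewrite -{1}[j]add0n big_addn addnK.
    by rewrite le_eqVlt; apply/orP; left; apply/eqP; apply: eq_bigr => l _; rewrite addnK.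
  rewrite -mulr_sumr; apply: (le_trans (ler_wpM2l _ hs)).
    by rewrite divr_ge0// ltW.
  by rewrite [leLHS](_ : _ = 2 * C ^+ 3)//; field; rewrite gt_eqF.
have nN : (n <= N)%N.
  rewrite leqNgt; apply/negP => Nn; have : (L <= a n)%N by exact: a_leq.
  by move=> /leq_trans/(_ anj); rewrite leqNgt jL.
have sum2 : \sum_(j <= l < L) f2 l <= 4 * C ^+ 3 * Phi N.
  apply: (@le_trans _ _ (\sum_(a n <= l < L) f2 l)).
    by rewrite [leRHS](big_cat_nat (n := j)) ?(ltnW jL)//= lerDr sumr_ge0.
  rewrite sum_blocks//; last exact: leqW.
  apply: (@le_trans _ _ (\sum_(n <= i < N.+1) 4 * C ^+ 3 * term a (i - n).+1)).
    rewrite big_nat [leRHS]big_nat; apply: ler_sum => i /andP[ni _].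
    have i0 := leq_trans n0 ni; have ai0 := a_pos i0.
    have lni := @ln_aS_gt0 R a a_pos a_incr i i0.
    have aii : (a i <= a i.+1)%N by rewrite ltnW// a_incr.
    have sqi : 0 < Num.sqrt (i - n).+1%:R :> R by rewrite sqrtr_gt0.
    rewrite (_ : \sum_(a i <= l < a i.+1) f2 l =
      \sum_(a i <= l < a i.+1) 2 * C ^+ 3 / ln (a i.+1)%:R / Num.sqrt (i - n).+1%:R * l%:R^-1).
      rewrite -mulr_sumr.
      apply: (le_trans (ler_wpM2l _ (@sum_inv_le R _ _ ai0 aii))).
        by rewrite !mulr_ge0 ?invr_ge0 ?(ltW sqi) ?(ltW lni)// ltW.
      rewrite [leLHS](_ : _ = 4 * C ^+ 3 * (phi R a i / Num.sqrt (i - n).+1%:R)); last first.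
        by rewrite phiE//; field; rewrite !gt_eqF.
      rewrite ler_pM2l ?mulr_gt0// termE ler_wpM2r ?invr_ge0 ?(ltW sqi)//.
      by apply: phi_nonincr => //; lia.
    rewrite big_nat [RHS]big_nat; apply: eq_bigr => l /andP[il li].
    by rewrite /f2 /weight (specialsE a_pos a_incr i0 il li).
  rewrite -mulr_sumr ler_pM2l ?mulr_gt0// /Phi.
  rewrite -{1}[n]add0n big_addn (eq_bigr (fun i => term a i.+1)); last first.
    by move=> i _; rewrite addnK.
  rewrite [leRHS]big_add1 /= [leRHS](big_cat_nat (n := N.+1 - n))//=.
    by rewrite lerDl sumr_ge0// => k _; exact: (term_ge0 a_pos a_incr).
  by lia.
have : 0 <= Phi N by apply: sumr_ge0 => k _; exact: (term_ge0 a_pos a_incr).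
by nra.
Qed.

Lemma ln2_ge : 1 / 2 <= ln 2 :> R.
Proof. by have [] := @ln_step R 1 isT; rewrite ln1 subr0 div1r. Qed.

Lemma inv_lnS_le n : (0 < n)%N -> (ln (a n.+1)%:R)^-1 <= 2 :> R.
Proof.
move=> n0; have h := aS_gt1 a_pos a_incr n0.
rewrite -[leRHS]invrK lef_pV2 ?posrE ?invr_gt0 ?ln_gt0 ?ltr1n//.
rewrite -[2^-1]div1r (le_trans ln2_ge)// ler_ln ?posrE ?ltr0n ?ler_nat//.
exact: ltnW.
Qed.

Lemma inv32_le n : (0 < n)%N -> (n%:R * Num.sqrt n%:R)^-1 <= inv54 n :> R.
Proof.
move=> n0; have nR : 0 < n%:R :> R by rewrite ltr0n.
have v1 : 1 <= Num.sqrt (Num.sqrt n%:R) :> R.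
  by rewrite -[leLHS]sqrtr1 ler_sqrt ?sqrtr_ge0// -[leLHS]sqrtr1 ler_sqrt// ler1n.
rewrite /inv54 -{1}(@sqrt_sqrt4 R n) -{2}(sqr_sqrtr (sqrtr_ge0 n%:R)) -exprD.
have v0 : 0 < Num.sqrt (Num.sqrt n%:R) :> R by lra.
rewrite lef_pV2 ?posrE ?exprn_gt0//.
by rewrite [leRHS]exprSr ler_peMr// exprn_ge0// ltW.
Qed.

(** At the times divisible by [q] in the blocks whose number is divisible by [q],
    the three lower bounds for the coordinate walks multiply. By monotonicity
    the multiples of [q] carry at least the [q]-th part of a sum, both within a
    block and among the blocks. The starting point [x] affects [p] and [be]
    only. *)
Lemma weight_from : exists2 al : R, 0 < al & forall m x,
  (0 < P (S m @^-1` [set x]))%E -> exists p, [/\ (0 < p)%N, (m < a p)%N &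
  exists be, forall N, (p <= N)%N -> al * Phi N - be <=
    \sum_(a p <= l < a N.+1) weight l * (ret F i0 (l - m) (entry i0 x) *
      ret F i1 (l - m) (entry i1 x) * ret F i2 (specials a l - specials a m) (entry i2 x))].
Proof.
have dbl k l : (0 < l)%N -> ((l - k).+1 <= l + l)%N by lia.
have [q q0 [c c0 low]] := ret_lower F_dim F_mean F_var.
have qR : 0 < q%:R :> R by rewrite ltr0n.
(* One factor [2] because the elapsed time is at most [2 l], the other because
   [sqrt (2 n) <= 2 sqrt n]. *)
pose d := c ^+ 3 / 4; have d0 : 0 < d by rewrite divr_gt0// exprn_gt0.
exists (d / q%:R ^+ 2); first by rewrite divr_gt0// exprn_gt0.
move=> m x /(reachable F_indep S_walk)[mx0 mx1 mx2].
have [K0 h0] := low _ _ _ mx0; have [K1 h1] := low _ _ _ mx1.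
have [K2 h2] := low _ _ _ mx2; set sm := specials a m in mx2 h2 *.
pose p := (m + K0 + K1 + K2 + sm).+1.
have [mp mK0 mK1 smp smK2] :
    [/\ m < p, m + K0 <= p, m + K1 <= p, sm <= p & sm + K2 <= p]%N.
  by rewrite /p; clear; split; lia.
have p1 : (0 < p)%N by [].
exists p; split => //; first exact: leq_trans (a_ge_id a_pos a_incr p1).
clearbody p.
exists (d * (Phi p / q%:R ^+ 2 + q%:R^-1 + 10)) => N pN.
pose Q l := ret F i0 (l - m) (entry i0 x) * ret F i1 (l - m) (entry i1 x) *
   ret F i2 (specials a l - sm) (entry i2 x).
have Q0 l : 0 <= weight l * Q l by rewrite !mulr_ge0 ?weight_ge0 ?ret_ge0.
rewrite -[leRHS]/(\sum_(a p <= l < a N.+1) weight l * Q l) sum_blocks//; last exact: leqW.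
have block n : (p <= n)%N -> (q %| n)%N ->
    d * (term a n / q%:R - 2 * inv54 n) <= \sum_(a n <= l < a n.+1) weight l * Q l.
  move=> pn qn; have n0 : (0 < n)%N by apply: leq_trans pn.
  have nR : 0 < n%:R :> R by rewrite ltr0n.
  have sqn : 0 < Num.sqrt n%:R :> R by rewrite sqrtr_gt0.
  have an0 := a_pos n0; have lnn := @ln_aS_gt0 R a a_pos a_incr n n0.
  have nan : (n <= a n)%N := a_ge_id a_pos a_incr n0.
  have aan : (a n <= a n.+1)%N by rewrite ltnW// a_incr.
  pose e := d / Num.sqrt n%:R / ln (a n.+1)%:R.
  have e0 : 0 < e := divr_gt0 (divr_gt0 d0 sqn) lnn.
  apply: (@le_trans _ _ (e * \sum_(a n <= l < a n.+1 | (q %| l)%N) l%:R^-1)); last first.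
    rewrite mulr_sumr big_mkcond big_nat [leRHS]big_nat; apply: ler_sum => l /andP[nl ln1].
    case: ifP => [ql|_]; last exact: Q0.
    have l0 : (0 < l)%N by apply: leq_trans nl.
    have sl : specials a l = n by apply: specialsE.
    have pl : (p <= l)%N := leq_trans pn (leq_trans nan nl).
    have ml : (m <= l)%N by exact: leq_trans (ltnW mp) pl.
    have smn : (sm <= n)%N by exact: leq_trans pn.
    have r0 : c / Num.sqrt (l - m).+1%:R <= ret F i0 (l - m) (entry i0 x).
      by apply: h0; rewrite ?subnK// leq_subRL// (leq_trans mK0).
    have r1 : c / Num.sqrt (l - m).+1%:R <= ret F i1 (l - m) (entry i1 x).
      by apply: h1; rewrite ?subnK// leq_subRL// (leq_trans mK1).
    have r2 : c / Num.sqrt (n - sm).+1%:R <= ret F i2 (n - sm) (entry i2 x).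
      by apply: h2; rewrite ?subnK// leq_subRL// (leq_trans smK2).
    have low0 i k r : (0 < k)%N -> (i.+1 <= k + k)%N -> c / Num.sqrt i.+1%:R <= r ->
        c / Num.sqrt (2 * k%:R) <= r.
      move=> k0 ik; apply: le_trans; rewrite ler_pM2l// lef_pV2 ?posrE ?sqrtr_gt0//; last first.
        by rewrite mulr_gt0// ltr0n.
      by rewrite ler_sqrt ?mulr_ge0// -natrM ler_nat mul2n -addnn.
    have {}r0 := low0 _ l _ l0 (dbl m l l0) r0; have {}r1 := low0 _ l _ l0 (dbl m l l0) r1.
    have {}r2 := low0 _ n _ n0 (dbl sm n n0) r2.
    rewrite /weight /Q sl /e (_ : _ * l%:R^-1 =
      (ln (a n.+1)%:R)^-1 * (d / Num.sqrt n%:R / l%:R)); last by ring.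
    rewrite ler_wpM2l ?invr_ge0 ?(ltW lnn)//.
    have lR : 0 < l%:R :> R by rewrite ltr0n.
    have cl0 k : 0 <= c / Num.sqrt (2 * k%:R) by rewrite divr_ge0 ?sqrtr_ge0// ltW.
    apply: le_trans (ler_pM (mulr_ge0 (cl0 l) (cl0 l)) (cl0 n) (ler_pM (cl0 l) (cl0 l) r0 r1) r2).
    have -> : c / Num.sqrt (2 * l%:R) * (c / Num.sqrt (2 * l%:R)) = c ^+ 2 / (2 * l%:R).
      by rewrite -expr2 exprMn exprVn sqr_sqrtr// mulr_ge0.
    have s4 : Num.sqrt (2 * n%:R) <= 2 * Num.sqrt n%:R :> R.
      have -> : 2 * Num.sqrt n%:R = Num.sqrt (2 ^+ 2 * n%:R) :> R.
        by rewrite sqrtrM ?exprn_ge0// sqrtr_sqr ger0_norm.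
      by rewrite ler_sqrt ?mulr_ge0 ?exprn_ge0// ler_wpM2r// expr2; lra.
    apply: (@le_trans _ _ (c ^+ 2 / (2 * l%:R) * (c / (2 * Num.sqrt n%:R)))).
      by rewrite le_eqVlt; apply/orP; left; apply/eqP; rewrite /d; field; rewrite !gt_eqF.
    rewrite ler_wpM2l ?divr_ge0 ?exprn_ge0 ?mulr_ge0 ?(ltW c0)//.
    rewrite ler_pM2l// lef_pV2 ?posrE ?mulr_gt0// sqrtr_gt0.
    by rewrite mulr_gt0.
  have inv_nonincr : nonincreasing_from (a n) (fun l => l%:R^-1 : R).
    move=> k l ak kl; have k0 : (0 < k)%N by exact: leq_trans ak.
    by rewrite lef_pV2 ?posrE ?ltr0n ?(leq_trans k0)// ler_nat.
  have inv0 k : 0 <= k%:R^-1 :> R by rewrite invr_ge0.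
  have sm1 := sum_multiples (a n.+1) q0 inv0 inv_nonincr.
  have sm2 := le_trans (@sum_inv_ge R _ _ an0 aan) sm1.
  set Z := \sum_(_ <= l < _ | _) _ in sm2 *.
  have ann : (a n)%:R^-1 <= n%:R^-1 :> R by rewrite lef_pV2 ?posrE ?ltr0n// ler_nat.
  have Zge : (ln (a n.+1)%:R - ln (a n)%:R) / q%:R - n%:R^-1 <= Z.
    rewrite lerBlDr ler_pdivrMr// mulrC; apply: (le_trans sm2).
    by rewrite ler_pM2l// lerD2l.
  apply: (le_trans _ (ler_wpM2l (ltW e0) Zge)).
  rewrite /e termE phiE//.
  rewrite [leRHS](_ : _ = d * ((ln (a n.+1)%:R - ln (a n)%:R) / ln (a n.+1)%:R / Num.sqrt n%:R / q%:R
     - (ln (a n.+1)%:R)^-1 * (n%:R * Num.sqrt n%:R)^-1)); last first.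
    by field; rewrite !gt_eqF.
  rewrite ler_pM2l// lerD2l lerN2 ler_pM ?invr_ge0 ?mulr_ge0 ?(ltW lnn)// ?(ltW sqn)//.
    exact: inv_lnS_le.
  exact: inv32_le.
apply: (@le_trans _ _ (\sum_(p <= n < N.+1 | (q %| n)%N) d * (term a n / q%:R - 2 * inv54 n))); last first.
  rewrite big_mkcond big_nat [leRHS]big_nat; apply: ler_sum => n /andP[pn _].
  by case: ifP => [qn|_]; [exact: block|apply: sumr_ge0].
rewrite -mulr_sumr (_ : d / q%:R ^+ 2 * Phi N - _ =
  d * (Phi N / q%:R ^+ 2 - (Phi p / q%:R ^+ 2 + q%:R^-1 + 10))); last by ring.
rewrite ler_pM2l// big_split /= sumrN -mulr_suml -mulr_sumr.
have tm := @sum_multiples R q p N.+1 (term a) q0 (term_ge0 a_pos a_incr) (fun k l pk => term_nonincr (leq_trans p1 pk)).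
have tp : term a p <= 1 :> R.
  rewrite termE ler_pdivrMr ?sqrtr_gt0 ?ltr0n// mul1r (le_trans (@phi_le1 R a a_pos a_incr p p1))//.
  by rewrite -[leLHS]sqrtr1 ler_sqrt// ler1n.
have i5 : \sum_(p <= n < N.+1 | (q %| n)%N) inv54 n <= 5 :> R.
  apply: le_trans (sum_inv54 N.+1 p1); rewrite big_mkcond big_nat [leRHS]big_nat.
  by apply: ler_sum => n _; case: ifP => // _; exact: inv54_ge0.
have PhiE : Phi N = \sum_(1 <= n < p) term a n + \sum_(p <= n < N.+1) term a n.
  by rewrite /Phi (big_cat_nat (n := p))//= ltnW.
have Phip : \sum_(1 <= n < p) term a n <= Phi p.
  rewrite /Phi [leRHS](big_cat_nat (n := p))//= lerDl.
  by apply: sumr_ge0 => k _; exact: (term_ge0 a_pos a_incr).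
move: i5 tm; set I5 := \sum_(_ <= _ < _ | _) inv54 _; set TQ := \sum_(p <= k < N.+1 | (q %| k)%N) term a k.
move=> i5 tm.
have {}tm : Phi N <= Phi p + q%:R * (TQ + 1).
  rewrite PhiE lerD//; apply: (le_trans tm); by rewrite ler_pM2l// lerD2l.
have : Phi N / q%:R ^+ 2 <= Phi p / q%:R ^+ 2 + (TQ + 1) / q%:R.
  have -> : Phi p / q%:R ^+ 2 + (TQ + 1) / q%:R = (Phi p + q%:R * (TQ + 1)) / q%:R ^+ 2.
    by field; rewrite gt_eqF.
  by rewrite ler_wpM2r// invr_ge0 exprn_ge0.
by rewrite mulrDl mul1r; lra.
Qed.

Lemma Phi_ge0 N : 0 <= Phi N.
Proof. by apply: sumr_ge0 => k _; exact: (term_ge0 a_pos a_incr). Qed.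

Lemma Phi_le M N : (M <= N)%N -> Phi M <= Phi N.
Proof.
move=> MN; rewrite /Phi [leRHS](big_cat_nat (n := M.+1))//= lerDl.
by apply: sumr_ge0 => k _; exact: (term_ge0 a_pos a_incr).
Qed.

Lemma Phi_unbounded : (\sum_(1 <= n <oo) (term a n : R)%:E = +oo)%E ->
  forall B, exists N, B <= Phi N.
Proof.
move=> oo B; apply: contrapT => /forallNP h.
have : (\sum_(1 <= n <oo) (term a n : R)%:E <= (Num.max B 0)%:E)%E.
  apply: lime_le; first by apply: is_cvg_nneseries => n _ _; rewrite lee_fin (term_ge0 a_pos a_incr).
  apply: nearW => N; rewrite sumEFin lee_fin le_max.
  case: N => [|N]; first by rewrite big_geq// lexx orbT.
  by have /negP := h N; rewrite -ltNge => /ltW ->.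
by rewrite oo leye_eq.
Qed.

Definition visit_after m : set T := [set w | exists2 k, (m < k)%N & S k w = 0].

Lemma measurable_visit_after m : measurable (visit_after m).
Proof.
rewrite (_ : visit_after m = \bigcup_(k in [set k | (m < k)%N]) (S k @^-1` [set 0])).
  by apply: bigcup_measurable => k _; exact: measurable_S.
by apply/seteqP; split => w [k mk Sk]; exists k.
Qed.

Lemma big_ord_shift (f : nat -> R) s L i :
  \sum_(k < L - s | (i <= k)%N) f (s + k)%N = \sum_(s + i <= l < L) f l.
Proof.
rewrite addnC big_addn -(big_mkord (fun k => i <= k)%N (fun k => f (s + k)%N)).
rewrite [RHS](big_nat_widenl _ 0)//=; apply: eq_bigr => k _.
by rewrite addnC.
Qed.

Hypothesis diverges : (\sum_(1 <= n <oo) (term a n : R)%:E = +oo)%E.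

(** From any position the walk returns to zero with probability bounded below,
    because the expected weight of the visits in a long time window exceeds a
    fixed proportion of the largest expected weight after a visit. *)
Lemma visit_after_ge_at : exists2 ka : R, 0 < ka & forall m x E,
  past S m E -> E `<=` S m @^-1` [set x] -> ka * pr P E <= pr P (E `&` visit_after m).
Proof.
have [C C0 hC] := weight_after; have [al al0 hal] := weight_from.
exists (al / (2 * C)); first by rewrite divr_gt0// mulr_gt0.
move=> m x E Em Ex; have mE := past_measurable S_walk Em.
have mEl : measurable (E `&` visit_after m) by apply: measurableI => //; exact: measurable_visit_after.
have [E0|E0] := eqVneq (pr P E) 0; first by rewrite E0 mulr0 pr_ge0.
have Egt0 : 0 < pr P E by rewrite lt0r E0 pr_ge0.
have xgt0 : (0 < P (S m @^-1` [set x]))%E.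
  apply: (@lt_le_trans _ _ (P E)); first by rewrite prE// lte_fin.
  by apply: le_measure; rewrite ?inE//; exact: measurable_S.
have [p [p0 mp [be hbe]]] := hal m x xgt0.
have [N0 hN0] := Phi_unbounded diverges (2 * be / al + 1).
pose N := maxn N0 p; have pN : (p <= N)%N by exact: leq_maxr.
have hN : 2 * be / al + 1 <= Phi N by apply: le_trans hN0 _; apply: Phi_le; exact: leq_maxl.
have {}hbe := hbe N pN.
have Eap : past S (a p) E by exact: past_le (ltnW mp) Em.
have paN : (a p <= a N.+1)%N by apply: a_leq => //; exact: leqW.
have D i : (i < a N.+1 - a p)%N ->
    \sum_(k < a N.+1 - a p | (i <= k)%N) weight (a p + k) * origin_ret F a (a p + i) (a p + k)
    <= C * (1 + Phi N).
  move=> iN; rewrite (big_ord_shift (fun l => weight l * origin_ret F a (a p + i) l)).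
  apply: hC; last by rewrite -ltn_subRL.
  by rewrite (leq_trans _ (leq_addr _ _))// a_leq.
have := visit_ge F_indep S_walk (w := fun k => weight (a p + k)) Eap D.
have -> : \sum_(k < a N.+1 - a p) weight (a p + k) * pr P (E `&` at_zero S (a p + k)) =
   pr P E * \sum_(a p <= l < a N.+1) weight l * (ret F i0 (l - m) (entry i0 x) *
      ret F i1 (l - m) (entry i1 x) * ret F i2 (specials a l - specials a m) (entry i2 x)).
  rewrite mulr_sumr -[X in \sum_(X <= _ < _) _]addn0 -big_ord_shift; apply: eq_bigr => k _.
  rewrite /pr (markov_zero F_indep S_walk (leq_trans (ltnW mp) (leq_addr k _)) Em Ex).
  by rewrite prE// fineM//=; ring.
move=> vis; have {vis} vis := le_trans (ler_wpM2l (ltW Egt0) hbe) vis.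
have sub : pr P (E `&` visit S (a p) (a N.+1 - a p)) <= pr P (E `&` visit_after m).
  apply: le_pr => //.
    apply: measurableI => //; rewrite visitE; apply: bigsetU_measurable => i _.
    exact: (measurable_first_visit S_walk).
  move=> w [Ew [i _ Si]]; split => //; exists (a p + i)%N => //.
  exact: leq_trans mp (leq_addr _ _).
apply: le_trans sub; set V := pr P (E `&` visit _ _ _) in vis *.
have den : 0 < C * (1 + Phi N) by rewrite mulr_gt0// ltr_pwDl// Phi_ge0.
rewrite -(ler_pM2l den); apply: le_trans vis.
rewrite [leLHS](_ : _ = pr P E * (al / 2 * (1 + Phi N))); last by field; rewrite gt_eqF.
rewrite ler_pM2l//.
have : al * (2 * be / al + 1) <= al * Phi N by rewrite ler_pM2l.
rewrite mulrDr mulr1 mulrCA divff ?gt_eqF// mulr1; lra.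
Qed.

Lemma visit_after_ge : exists2 ka : R, 0 < ka & forall m E,
  past S m E -> (ka%:E * P E <= P (E `&` visit_after m))%E.
Proof.
have [ka ka0 h] := visit_after_ge_at; exists ka => // m E Em.
have mE := past_measurable S_walk Em.
have mX (x : 'rV[int]_3) : measurable (S m @^-1` [set x]) by exact: measurable_S.
have mEl : measurable (E `&` visit_after m) by apply: measurableI => //; exact: measurable_visit_after.
rewrite (measure_fibers P mX mE) (measure_fibers P mX mEl) -ge0_esumZl ?lee_fin ?(ltW ka0)//.
apply: le_esum => x _; rewrite setIAC.
have Ex : past S m (E `&` S m @^-1` [set x]) by apply: pastI => //; exact: past_S.
have := h m x _ Ex (@subIsetr _ _ _).
have mEx := past_measurable S_walk Ex.
by rewrite -lee_fin EFinM -!prE//; apply: measurableI => //; exact: measurable_visit_after.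
Qed.

Definition no_visit M m : set T := [set w | forall k, (M < k <= m)%N -> S k w <> 0].

Definition no_more_visit M : set T := [set w | forall k, (M < k)%N -> S k w <> 0].

Lemma past_no_visit M m : past S m (no_visit M m).
Proof. by move=> w w' ww' h k /[dup] /andP[_ km] /h; rewrite ww'. Qed.

Lemma no_more_visitE M : no_more_visit M = \bigcap_m no_visit M m.
Proof.
apply/seteqP; split => [w h' m _ k /andP[Mk _]|w h' k Mk]; first exact: h'.
by apply: (h' k I); rewrite Mk leqnn.
Qed.

Lemma measurable_no_more_visit M : measurable (no_more_visit M).
Proof.
rewrite no_more_visitE; apply: bigcapT_measurable => m.
exact: (past_measurable S_walk (@past_no_visit M m)).
Qed.

(** If [u] is the probability of no visit after time [M] and [u_m] that of no
    visit between [M] and [m], then [u_m] exceeds [u] by the probability of a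
    return after [m] only, which is at least [ka * u_m >= ka * u]; and [u_m]
    tends to [u]. *)
Lemma no_more_visit_null M : P (no_more_visit M) = 0%E.
Proof.
have [ka ka0 h] := visit_after_ge.
have mno m : measurable (no_visit M m) := past_measurable S_walk (@past_no_visit M m).
have mn := measurable_no_more_visit M.
have cvg : (P \o no_visit M) @ \oo --> P (no_more_visit M).
  rewrite no_more_visitE; apply: nonincreasing_cvg_mu => //.
  - by rewrite ltey_eq fin_num_measure.
  - exact: bigcapT_measurable.
  - move=> m n mn'; apply/subsetPset => w h' k /andP[Mk km]; apply: h'.
    by rewrite Mk (leq_trans km).
pose u := pr P (no_more_visit M).
have decr m n : (m <= n)%N -> no_visit M n `<=` no_visit M m.
  by move=> mn' w h' k /andP[Mk km]; apply: h'; rewrite Mk (leq_trans km).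
have bound m : (M <= m)%N -> (((1 + ka) * u)%:E <= P (no_visit M m))%E.
  move=> Mm; have split : no_visit M m `&` ~` visit_after m = no_more_visit M.
    apply/seteqP; split => [w [h1 h2] k Mk Sk|w hw].
      case: (leqP k m) => km; first by apply: (h1 k) => //; rewrite Mk.
      by apply: h2; exists k.
    split; first by move=> k /andP[Mk _]; exact: hw.
    by move=> [k mk Sk]; apply: (hw k) => //; exact: leq_ltn_trans mk.
  have hm := h m _ (@past_no_visit M m).
  have mno' : measurable (no_visit M m `&` visit_after m).
    by apply: measurableI => //; exact: measurable_visit_after.
  have : P (no_visit M m) = (P (no_visit M m `&` visit_after m) + P (no_more_visit M))%E.
    rewrite -[in LHS](setIT (no_visit M m)) -(setUv (visit_after m)) setIUr measureU ?split//.
    by rewrite -split; apply/seteqP; split => // w [[_ h1] [_ h2]].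
  move: hm; rewrite !prE// -EFinM -EFinD !lee_fin -/u => hm [un].
  have uno : u <= pr P (no_visit M m) by rewrite un lerDr pr_ge0.
  rewrite un mulrDl mul1r addrC lerD2r; apply: le_trans hm.
  by rewrite ler_pM2l.
have : (((1 + ka) * u)%:E <= P (no_more_visit M))%E.
  rewrite -(cvg_lim _ cvg)//; apply: lime_ge; first by apply/cvg_ex; exists (P (no_more_visit M)).
  apply: nearW => m; apply: (le_trans (bound _ (leq_maxl M m))).
  by apply: le_measure; rewrite ?inE//; apply: decr; exact: leq_maxr.
rewrite prE// lee_fin -/u => hu; congr EFin.
have u0 : 0 <= u by exact: pr_ge0.
by apply/eqP; rewrite eq_le u0 andbT -(pmulr_rle0 _ ka0); lra.
Qed.

Theorem recurrent_of_divergent : recurrent S.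
Proof.
rewrite /recurrent; apply: (@negligibleS _ _ _ _ (\bigcup_M no_more_visit M)).
  move=> w /= /contrapT/finite_fsetP[X hX].
  exists (\max_(k <- X) k)%N => // k Mk Sk.
  suff : (k <= \max_(k <- X) k)%N by rewrite leqNgt Mk.
  apply: leq_bigmax_seq => //.
  by have : [set k | S k w = 0] k by []; rewrite hX.
apply: negligible_bigcup => M; exists (no_more_visit M); split => //.
  exact: measurable_no_more_visit.
exact: no_more_visit_null.
Qed.

End recurrence.
Theorem theorem2p4 (R : realType) (F : probability (lattice 3) R)
  (F_dim : truly_dimensional F)
  (F_mean : mean_zero F)
  (F_var : finite_variance F)
  (F_indep : independent_coordinates F)
  (a : nat -> nat)
  (a_pos : forall n, (0 < n)%N -> (0 < a n)%N)
  (a_incr : forall m n, (0 < m)%N -> (m < n)%N -> (a m < a n)%N)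
  (dT : measure_display) (T : measurableType dT) (P : probability T R)
  (S : nat -> {RV P >-> lattice 3})
  (S_walk : walk_in_varying_dimension 2 F a S) :
  ((\sum_(1 <= n <oo) (n%:R `^ (- (1 / 2)) * phi R a n)%:E < +oo)%E ->
    transient S) /\
  ((\sum_(1 <= n <oo) (n%:R `^ (- (1 / 2)) * phi R a n)%:E = +oo)%E ->
    (forall m n, (0 < m)%N -> (m <= n)%N -> phi R a n <= phi R a m) ->
    recurrent S).
Proof.
split=> [fin|div mono].
  exact: (transient_of_summable F_dim F_mean F_var F_indep a_pos a_incr S_walk fin).
exact: (recurrent_of_divergent F_dim F_mean F_var F_indep a_pos a_incr S_walk mono div).
Qed.
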